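(* Let $X,Y,Z,P$ be Asplund spaces, $K\subset Z$ a closed convex pointed cone with $\operatorname{int}K\ne\emptyset$, $g:X\times P\to Z$ a map, $H:X\times P\rightrightarrows Y$ a set-valued map, $H_p(\cdot)=H(\cdot,p)$, and $S(p)=\{x\in X\mid 0\in H(x,p)\}$. Let $M\subset P$ be nonempty, $\overline{x}\in X$, $L>0$. Suppose: (1) $g$ is $L$-strictly Lipschitz at $\overline{x}$ with respect to $M$: for every $p\in M$ the map $g(\cdot,p)$ is strictly Lipschitz at $\overline{x}$ and there is a neighborhood $U_p$ of $\overline{x}$ with $\|g(x,p)-g(u,p)\|\le L\|x-u\|$ for all $x,u\in U_p$; (2) $\overline{x}$ is a weak solution of ''minimize $g(x,p)$ subject to $0\in H(x,p)$'' with respect to $M$: $\overline{x}\in\bigcap_{p\in M}S(p)$ and for every $p\in M$ there is $\varepsilon_p>0$ such that $g(x,p)-g(\overline{x},p)\notin-\operatorname{int}K$ for all $x\in B(\overline{x},\varepsilon_p)\cap S(p)$; (3) there exist $r>0$ and a neighborhood $V$ of $\overline{x}$ such that $d(x,S(p))\le r\,d(0,H(x,p))$ for all $p\in M$ and all $x\in V$; (4) for every $p\in M$, $H_p$ has closed graph and $H$ is Lipschitz-like around $((\overline{x},p),0)$. Then for every $e\in\operatorname{int}K$ and every $p\in M$ there exist $z^*\in K^*$ with $z^*(e)=1$ and $y^*\in Y^*$ such that \[ 0\in\partial(z^*\circ g(\cdot,p))(\overline{x})+D_N^*H_p(\overline{x},0)(y^* ). \]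
   Context: $K^*=\{z^*\in Z^*\mid z^*(z)\ge0\ \forall z\in K\}$. A function $h:X\to Z$ is strictly Lipschitz at $\overline{x}$ if it is Lipschitz around $\overline{x}$ and there is a neighborhood $V_0$ of $0$ in $X$ such that the sequence $(t_k^{-1}(h(x_k+t_kv)-h(x_k)))_k$ has a norm convergent subsequence whenever $v\in V_0$, $x_k\to\overline{x}$, $t_k\downarrow0$. A multifunction $F:W\rightrightarrows Y$ is Lipschitz-like around $(\overline{w},\overline{y})\in\operatorname{Gr}F$ if there exist $L'>0$ and neighborhoods $U$ of $\overline{w}$, $V$ of $\overline{y}$ with $F(w)\cap V\subset F(u)+L'\|w-u\|\mathbb{D}_Y$ for all $w,u\in U$ ($\mathbb{D}_Y$ the closed unit ball; $X\times P$ carries the sum norm). $d(x,A)=\inf_{a\in A}\|x-a\|$, $d(x,\emptyset)=\infty$. For $\Omega$ in an Asplund space and $\overline{x}\in\Omega$: Fréchet normal cone $\widehat N(\Omega,x)=\{x^*\mid\limsup_{u\to x,u\in\Omega}\frac{x^*(u-x)}{\|u-x\|}\le0\}$; limiting normal cone $N(\Omega,\overline{x})$ is the set of $w^*$-limits of $x_n^*\in\widehat N(\Omega,x_n)$ with $x_n\to\overline{x}$, $x_n\in\Omega$. The limiting subdifferential of $\varphi$ at $\overline{x}$ is $\partial\varphi(\overline{x})=\{x^*\mid(x^*,-1)\in N(\operatorname{epi}\varphi,(\overline{x},\varphi(\overline{x})))\}$. The normal coderivative is $D_N^*F(x,y)(y^* )=\{x^*\mid(x^*,-y^* )\in N(\operatorname{Gr}F,(x,y))\}$.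 *)

(* Defs.v *)
From HB Require Import structures.
From mathcomp Require Import all_boot all_order all_algebra.
From mathcomp Require Import all_classical all_reals all_analysis.
Set Implicit Arguments. Unset Strict Implicit. Unset Printing Implicit Defensive.
Import Order.TTheory GRing.Theory Num.Theory.
Import numFieldNormedType.Exports.
Local Open Scope classical_set_scope.
Local Open Scope ring_scope.

Section VarDefs.
Context {R : realType}.

Definition clin {W : normedModType R} (f : W -> R) : Prop :=
  (forall (a : R) (x y : W), f (a *: x + y) = a * f x + f y) /\ continuous f.

Definition lin_on {W : normedModType R} (S : set W) (f : W -> R) : Prop :=
  forall (a : R) (x y : W), S x -> S y -> f (a *: x + y) = a * f x + f y.

Definition bdd_on {W : normedModType R} (S : set W) (f : W -> R) : Prop :=
  exists C : R, forall y, S y -> `|f y| <= C * `|y|.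

Definition closed_subspace {W : normedModType R} (S : set W) : Prop :=
  S 0 /\ (forall (a : R) x y, S x -> S y -> S (a *: x + y)) /\ closed S.

Definition separable_set {W : normedModType R} (S : set W) : Prop :=
  exists s : nat -> W, (forall n, S (s n)) /\ S `<=` closure (range s).

Definition separable_dual_of {W : normedModType R} (S : set W) : Prop :=
  exists fs : nat -> W -> R,
    (forall n, lin_on S (fs n) /\ bdd_on S (fs n)) /\
    (forall f, lin_on S f -> bdd_on S f -> forall eps : R, 0 < eps ->
       exists n, forall y, S y -> `|f y - fs n y| <= eps * `|y|).

Definition asplund (W : completeNormedModType R) : Prop :=
  forall S : set W, closed_subspace S -> separable_set S -> separable_dual_of S.

Definition cvx_set {W : normedModType R} (K : set W) : Prop :=
  forall (x y : W) (t : R), K x -> K y -> 0 <= t <= 1 -> K (t *: x + (1 - t) *: y).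

Definition is_cone {W : normedModType R} (K : set W) : Prop :=
  forall (t : R) (z : W), 0 <= t -> K z -> K (t *: z).

Definition pointed {W : normedModType R} (K : set W) : Prop :=
  forall z, K z -> K (- z) -> z = 0.

Definition dual_cone {W : normedModType R} (K : set W) : set (W -> R) :=
  [set zs | clin zs /\ forall z, K z -> 0 <= zs z].

Definition lipschitz_near {U V : normedModType R} (h : U -> V) (x : U) (L : R) : Prop :=
  exists N, nbhs x N /\ forall a b, N a -> N b -> `|h a - h b| <= L * `|a - b|.

Definition strictly_lipschitz {U V : normedModType R} (h : U -> V) (xbar : U) : Prop :=
  (exists L : R, lipschitz_near h xbar L) /\
  exists V0, nbhs (0 : U) V0 /\
    forall v, V0 v -> forall (xs : nat -> U) (ts : nat -> R),
      xs @ \oo --> xbar -> (forall k, 0 < ts k) -> ts @ \oo --> (0 : R) ->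
      exists phi : nat -> nat, {homo phi : m n / (m < n)%N} /\
        exists l : V, (fun k => (ts (phi k))^-1 *:
                   (h (xs (phi k) + ts (phi k) *: v) - h (xs (phi k)))) @ \oo --> l.

(** distance, with d(x, emptyset) = +oo *)
Definition dist {W : normedModType R} (x : W) (A : set W) : \bar R :=
  ereal_inf [set (`|x - a|)%:E | a in A].

(** Lipschitz-like (Aubin) property of F : X x P => Y around (wbar, ybar),
    X x P with the sum norm *)
Definition lipschitz_like {X P Y : normedModType R} (F : X -> P -> set Y)
    (wbar : X * P) (ybar : Y) : Prop :=
  exists L' : R, 0 < L' /\ exists (U : set (X * P)) (V : set Y),
    nbhs wbar U /\ nbhs ybar V /\
    forall w u, U w -> U u -> forall y, F w.1 w.2 y -> V y ->
      exists y', F u.1 u.2 y' /\ `|y - y'| <= L' * (`|w.1 - u.1| + `|w.2 - u.2|).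

Definition fnormal {W : normedModType R} (Om : set W) (x : W) : set (W -> R) :=
  [set xs | clin xs /\ forall eps : R, 0 < eps -> exists2 delta : R, 0 < delta &
     forall u, Om u -> `|u - x| < delta -> xs (u - x) <= eps * `|u - x|].

(** limiting normal cone (sequential weak-star limits) *)
Definition lnormal {W : normedModType R} (Om : set W) (x : W) : set (W -> R) :=
  [set ws | clin ws /\ exists (xn : nat -> W) (xsn : nat -> W -> R),
     (forall n, Om (xn n)) /\ xn @ \oo --> x /\
     (forall n, fnormal Om (xn n) (xsn n)) /\
     forall w, (fun n => xsn n w) @ \oo --> ws w].

Definition epi {X : normedModType R} (phi : X -> R) : set (X * R^o) :=
  [set w | phi w.1 <= w.2].

(** limiting subdifferential: (xs, -1) in N(epi phi, (x, phi x)) *)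
Definition lsubdiff {X : normedModType R} (phi : X -> R) (x : X) : set (X -> R) :=
  [set xs | lnormal (epi phi) (x, phi x : R^o) (fun w => xs w.1 - w.2)].

Definition graph {X Y : normedModType R} (F : X -> set Y) : set (X * Y) :=
  [set w | F w.1 w.2].

(** normal coderivative: (xs, -ys) in N(Gr F, (x, y)) *)
Definition coderivN {X Y : normedModType R} (F : X -> set Y) (x : X) (y : Y)
    (ys : Y -> R) : set (X -> R) :=
  [set xs | lnormal (graph F) (x, y) (fun w => xs w.1 - ys w.2)].

Definition solset {X P Y : normedModType R} (H : X -> P -> set Y) (p : P) : set X :=
  [set x | H x p 0].

End VarDefs.

(* Main.v *)
Require Import Defs.
From HB Require Import structures.
From mathcomp Require Import all_boot all_order all_algebra.
From mathcomp Require Import all_classical all_reals all_analysis.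
From mathcomp Require Import ring lra.
Set Implicit Arguments. Unset Strict Implicit. Unset Printing Implicit Defensive.
Import Order.TTheory GRing.Theory Num.Theory.
Import numFieldNormedType.Exports.
Local Open Scope classical_set_scope.
Local Open Scope ring_scope.

(** Fix [p] and put h = g(., p), F = H(., p).  With
    phi(z) = inf {t | t e - z \in K}, a sublinear function whose linear minorants
    are exactly the z* in K* with z*(e) = 1, exact penalization and (3) show that
    (xbar, 0) is a local minimizer of phi(h(x) - h(xbar)) + c |y| on the graph
    of F.  Decoupling the variables turns this into the minimization of a
    sublinear function s(e0 - .) on a closed set Th of a product of Asplund
    spaces.

    The engine is [normal_at_minimizer]: arbitrarily close to e0 there are Frechet
    normals nu of Th with nu <= s + gam |.|.  By Hahn-Banach, the existence of
    such a normal at a point is equivalent to the absence of finite "violations",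
    a condition that is determined by a separable subspace T.  Since T has a
    separable dual, s is uniformly approximated on T by suprema of
    f - k theta(f) over the f <= s, where theta is a rotund penalty built
    from a dense sequence of the dual; these suprema are convex and smooth.  The
    Borwein-Preiss principle then yields an exact minimizer of a smooth convex
    function on Th, where second differences exclude violations.

    The multipliers obtained in this way are bounded, hence have weak-star
    convergent subsequences (a dyadic tree argument based on separable duals).  A
    second application of [normal_at_minimizer] splits a subgradient of
    <z_k*, h> = <z*, h> + <z_k* - z*, h>, and strict Lipschitz continuity of h
    makes the part coming from z_k* - z* vanish in the limit. *)

(** * Sublinear functions and the Hahn-Banach theorem *)

(** An Asplund space need not carry an equivalent Frechet smooth norm, so smoothness is sought only
    on separable subspaces, where a separable dual provides it. What travels between the subspace
    and the whole space is never a normal, only the absence of violations: a violation is a finite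
    list, and apart from its points it is described by integers up to small errors. The bound
    [nu <= s + gam |.|] is one-sided but holds in every direction. Testing it along single
    coordinates and along diagonals therefore gives all estimates on the multipliers, and a diagonal
    direction annihilates the penalty that couples two copies of a variable, which is how sum rules
    appear. The obstacle in the limit is that the multipliers on [Z] converge only weak-star: a
    subgradient of a varying scalarization of [h] says nothing about the limiting scalarization
    until the varying part has been separated from it. *)

Section HahnBanach.
Context {R : realType}.

Lemma inf_le_mem {A : set R} {b x : R} :
  (forall r, A r -> b <= r) -> A x -> inf A <= x.
Proof. by move=> lbA Ax; apply: ge_inf => //; exists b. Qed.

Lemma inf_approx {A : set R} {b eps : R} : A !=set0 ->
  (forall r, A r -> b <= r) -> 0 < eps -> exists2 x, A x & x < inf A + eps.
Proof. by move=> A0 lbA e0; apply: inf_adherent => //; split=> //; exists b. Qed.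

Lemma le_sup_mem {A : set R} {b x : R} :
  (forall r, A r -> r <= b) -> A x -> x <= sup A.
Proof. by move=> ubA Ax; apply: ub_le_sup => //; exists b. Qed.

Lemma sup_approx {A : set R} {b eps : R} : A !=set0 ->
  (forall r, A r -> r <= b) -> 0 < eps -> exists2 x, A x & sup A - eps < x.
Proof. by move=> A0 ubA e0; apply: sup_adherent => //; split=> //; exists b. Qed.

Lemma le_eps (x y : R) : (forall eps : R, 0 < eps -> x <= y + eps) -> x <= y.
Proof.
move=> H; rewrite leNgt; apply/negP => yx.
have := H ((x - y) / 2); have : 0 < (x - y) / 2 by lra.
by move=> h /(_ h); lra.
Qed.

Definition sublinear {V : lmodType R} (p : V -> R) : Prop :=
  (forall x y, p (x + y) <= p x + p y) /\
  (forall t x, 0 <= t -> p (t *: x) = t * p x).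

Definition linear_form {V : lmodType R} (f : V -> R) : Prop :=
  forall (a : R) x y, f (a *: x + y) = a * f x + f y.

Lemma sublinear0 {V : lmodType R} (p : V -> R) : sublinear p -> p 0 = 0.
Proof. by case=> _ /(_ 0 0 (lexx _)); rewrite scale0r mul0r. Qed.

Lemma sublinearN_ge {V : lmodType R} (p : V -> R) x :
  sublinear p -> - p (- x) <= p x.
Proof.
move=> sp; have := sp.1 x (- x); rewrite subrr (sublinear0 sp); lra.
Qed.

(** Common source of the sublinear functions built as infima. Stability of [A] under sums and
    dilations is asked only up to a smaller value, so that the values of a chain of sublinear
    functions qualify too; dilation by the inverse of [t] gives the reverse inequality. *)
Lemma sublinear_inf {V : lmodType R} (A : V -> set R) (b : V -> R) :
  (forall w, A w !=set0) -> (forall w r, A w r -> b w <= r) ->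
  (forall w w' r r', A w r -> A w' r' ->
     exists2 r'', A (w + w') r'' & r'' <= r + r') ->
  (forall t w r, 0 < t -> A w r -> exists2 r'', A (t *: w) r'' & r'' <= t * r) ->
  A 0 0 -> 0 <= b 0 -> sublinear (fun w => inf (A w)).
Proof.
move=> A0 lbA AD AZ A00 b0.
have ZA t w : 0 < t -> inf (A (t *: w)) <= t * inf (A w).
  move=> t0; apply: le_eps => e e0.
  have et : 0 < e / t by rewrite divr_gt0.
  have [r Ar rl] := inf_approx (A0 w) (lbA w) et.
  have [r' Ar' r'l] := AZ _ _ _ t0 Ar.
  apply: (le_trans (inf_le_mem (lbA _) Ar')); apply: (le_trans r'l).
  have : t * r <= t * (inf (A w) + e / t) by rewrite ler_pM2l// ltW.
  by rewrite mulrDr [t * (e / t)]mulrC divfK ?gt_eqF.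
split=> [x y|t x].
  apply: le_eps => e e0; have e2 : 0 < e / 2 by lra.
  have [r Ar rl] := inf_approx (A0 x) (lbA x) e2.
  have [r' Ar' r'l] := inf_approx (A0 y) (lbA y) e2.
  have [r'' Ar'' r''l] := AD _ _ _ _ Ar Ar'.
  by have := inf_le_mem (lbA _) Ar''; lra.
rewrite le_eqVlt => /orP[/eqP <-|t0].
  rewrite scale0r mul0r; apply/eqP; rewrite eq_le.
  rewrite (inf_le_mem (lbA _) A00)/=; apply: lb_le_inf => // r /lbA.
  exact: le_trans.
apply/eqP; rewrite eq_le ZA//=.
have ti : 0 < t^-1 by rewrite invr_gt0.
have := ZA t^-1 (t *: x) ti.
rewrite scalerA mulVf ?gt_eqF// scale1r => h.
by rewrite -(@ler_pM2l _ t^-1)// mulrA mulVf ?gt_eqF// mul1r.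
Qed.

(** The infimum over [t >= 0] of [p (w + t x) - t p x] is linear along [x]. A minimal [p] coincides
    with it and is therefore additive; in general it forces a linear minorant to touch [p] at
    [x]. *)
Lemma sublinear_steep {V : lmodType R} (p : V -> R) (x : V) : sublinear p ->
  exists p', [/\ sublinear p', forall w, p' w <= p w &
    forall w, p' w <= p (w + x) - p x].
Proof.
move=> sp.
pose A w := [set p (w + t *: x) - t * p x | t in [set t : R | 0 <= t]].
have lbA w r : A w r -> - p (- w) <= r.
  move=> [t /= tp <-]; have := sp.1 (w + t *: x) (- w).
  by rewrite addrAC subrr add0r sp.2//; lra.
have Ap w : A w (p w) by exists 0 => //=; rewrite scale0r addr0 mul0r subr0.
exists (fun w => inf (A w)); split=> [|w|w].
- apply: (@sublinear_inf V A (fun w => - p (- w))) => //.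
  + by move=> w'; exists (p w').
  + move=> w1 w2 _ _ [t1 /= h1 <-] [t2 /= h2 <-].
    exists (p ((w1 + w2) + (t1 + t2) *: x) - (t1 + t2) * p x).
      by exists (t1 + t2) => //=; exact: addr_ge0.
    have := sp.1 (w1 + t1 *: x) (w2 + t2 *: x).
    by rewrite addrACA -scalerDl; lra.
  + move=> t w1 _ tp [t1 /= h1 <-].
    exists (p (t *: w1 + (t * t1) *: x) - (t * t1) * p x).
      by exists (t * t1) => //=; apply: mulr_ge0 => //; exact: ltW.
    by rewrite -scalerA -scalerDr sp.2 ?(ltW tp)// mulrBr mulrA.
  + by have := Ap 0; rewrite (sublinear0 sp).
  + by rewrite oppr0 (sublinear0 sp) oppr0.
- exact: (inf_le_mem (lbA w) (Ap w)).
- apply: (inf_le_mem (lbA w)); exists 1 => /=; first exact: ler01.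
  by rewrite scale1r mul1r.
Qed.

(* A minimal element among the sublinear functions below [p] is additive. *)
Lemma hahn_banach {V : lmodType R} (p : V -> R) : sublinear p ->
  exists2 f, linear_form f & forall x, f x <= p x.
Proof.
move=> sp.
pose T := {q : V -> R | sublinear q /\ forall x, q x <= p x}.
pose Rl : rel T := fun q1 q2 => `[< forall x, sval q2 x <= sval q1 x >].
have t0 : T by exists p; split.
pose mkT q (sq : sublinear q) (qp : forall x, q x <= p x) : T :=
  exist (fun q : V -> R => sublinear q /\ forall x, q x <= p x) q (conj sq qp).
have lbT (q : T) x : - p (- x) <= sval q x.
  case: q => q /= [sq qp]; have := sublinearN_ge x sq; have := qp (- x); lra.
have [|q1 q2 q3 /asboolP h1 /asboolP h2|A totA|q qmax] := @ZL_preorder T t0 Rl.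
- by move=> t; apply/asboolP.
- by apply/asboolP => x; apply: le_trans (h2 x) (h1 x).
- have [[q0 Aq0]|An] := pselect (A !=set0); last first.
    by exists t0 => s As; exfalso; apply: An; exists s.
  pose B w := [set sval q w | q in A].
  have lbB w r : B w r -> - p (- w) <= r by move=> [q _ <-].
  have sB : sublinear (fun w => inf (B w)).
    apply: (@sublinear_inf V B (fun w => - p (- w))) => //.
    + by move=> w; exists (sval q0 w), q0.
    + move=> w w' _ _ [q Aq <-] [q' Aq' <-].
      have [/asboolP h|/asboolP h] := totA _ _ Aq Aq'.
        exists (sval q' (w + w')); first by exists q'.
        by apply: (le_trans ((svalP q').1.1 _ _)); rewrite lerD2r.
      exists (sval q (w + w')); first by exists q.
      by apply: (le_trans ((svalP q).1.1 _ _)); rewrite lerD2l.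
    + move=> t w _ tp [q Aq <-]; exists (sval q (t *: w)); first by exists q.
      by rewrite (svalP q).1.2// ltW.
    + by exists q0 => //; apply: sublinear0; exact: (svalP q0).1.
    + by rewrite oppr0 (sublinear0 sp) oppr0.
  have hB : forall x, inf (B x) <= p x.
    move=> x; apply: (le_trans (inf_le_mem (lbB x) _)); last exact: (svalP q0).2.
    by exists q0.
  exists (mkT _ sB hB) => s As; apply/asboolP => x /=.
  by apply: (inf_le_mem (lbB x)); exists s.
have sq := (svalP q).1.
have key x0 w : sval q w + sval q x0 <= sval q (w + x0).
  have [q' [sq' q'q q'x]] := sublinear_steep x0 sq.
  have q'p x : q' x <= p x := le_trans (q'q x) ((svalP q).2 x).
  have /asboolP/(_ w)/= : Rl (mkT _ sq' q'p) q by apply: qmax; apply/asboolP.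
  by have := q'x w; lra.
have qD x y : sval q (x + y) = sval q x + sval q y.
  by apply/eqP; rewrite eq_le key sq.1.
have qN x : sval q (- x) = - sval q x.
  by have := qD x (- x); rewrite subrr (sublinear0 sq); lra.
exists (sval q); last exact: (svalP q).2.
move=> a x y; rewrite qD; congr (_ + _).
have [a0|a0] := leP 0 a; first exact: sq.2.
by rewrite -[a in LHS]opprK scaleNr qN sq.2; lra.
Qed.

Lemma linear_form0 {V : lmodType R} (f : V -> R) : linear_form f -> f 0 = 0.
Proof. by move=> /(_ (-1) 0 0); rewrite scaler0 addr0; lra. Qed.

Lemma linear_formD {V : lmodType R} (f : V -> R) x y :
  linear_form f -> f (x + y) = f x + f y.
Proof. by move=> /(_ 1 x y); rewrite scale1r mul1r. Qed.

Lemma linear_formZ {V : lmodType R} (f : V -> R) a x :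
  linear_form f -> f (a *: x) = a * f x.
Proof.
by move=> lf; have := lf a x 0; rewrite !addr0 (linear_form0 lf) addr0.
Qed.

Lemma linear_formN {V : lmodType R} (f : V -> R) x :
  linear_form f -> f (- x) = - f x.
Proof. by move=> lf; rewrite -scaleN1r linear_formZ// mulN1r. Qed.

Lemma linear_formB {V : lmodType R} (f : V -> R) x y :
  linear_form f -> f (x - y) = f x - f y.
Proof. by move=> lf; rewrite linear_formD// linear_formN. Qed.

(** The infimal convolution of [p] with [f0] on [S] is sublinear, below [p], and below [f0] on [S].
    A linear minorant is thus at most [f0] on [S], and [S] being symmetric, equality follows. *)
Lemma hahn_banach_ext {V : lmodType R} (p : V -> R) (S : set V) (f0 : V -> R) :
  sublinear p -> S 0 -> (forall a x y, S x -> S y -> S (a *: x + y)) ->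
  (forall a x y, S x -> S y -> f0 (a *: x + y) = a * f0 x + f0 y) ->
  (forall x, S x -> f0 x <= p x) ->
  exists f, [/\ linear_form f, forall x, f x <= p x & forall x, S x -> f x = f0 x].
Proof.
move=> sp S0 Scl f0l f0p.
have f00 : f0 0 = 0 by have := f0l (-1) 0 0 S0 S0; rewrite scaler0 addr0; lra.
have SN x : S x -> S (- x) by move=> Sx; have := Scl (-1) x 0 Sx S0; rewrite addr0 scaleN1r.
have f0N x : S x -> f0 (- x) = - f0 x.
  by move=> Sx; have := f0l (-1) x 0 Sx S0; rewrite addr0 scaleN1r f00; lra.
pose A w := [set p (w - y) + f0 y | y in S].
have lbA w r : A w r -> - p (- w) <= r.
  move=> [y Sy <-].
  have := f0p _ (SN _ Sy); rewrite f0N// => h.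
  by have := sp.1 (w - y) (- w); rewrite addrAC subrr add0r; lra.
have Ap w : A w (p w) by exists 0 => //; rewrite subr0 f00 addr0.
have sA : sublinear (fun w => inf (A w)).
  apply: (@sublinear_inf V A (fun w => - p (- w))) => //.
  - by move=> w; exists (p w).
  - move=> w w' _ _ [y Sy <-] [y' Sy' <-].
    exists (p ((w + w') - (y + y')) + f0 (y + y')).
      by exists (y + y') => //; have := Scl 1 _ _ Sy Sy'; rewrite scale1r.
    have := f0l 1 _ _ Sy Sy'; rewrite scale1r mul1r => ->.
    by have := sp.1 (w - y) (w' - y'); rewrite addrACA -opprD; lra.
  - move=> t w _ t0 [y Sy <-].
    exists (p (t *: w - t *: y) + f0 (t *: y)).
      by exists (t *: y) => //; have := Scl t _ _ Sy S0; rewrite addr0.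
    have := f0l t _ _ Sy S0; rewrite !addr0 f00 addr0 => ->.
    by rewrite -scalerBr sp.2 ?(ltW t0)// mulrDr.
  - by have := Ap 0; rewrite (sublinear0 sp).
  - by rewrite oppr0 (sublinear0 sp) oppr0.
have [f fl fA] := hahn_banach sA.
have fle x : S x -> f x <= f0 x.
  move=> Sx; apply: (le_trans (fA x)); apply: (inf_le_mem (lbA x)).
  by exists x => //; rewrite subrr (sublinear0 sp) add0r.
exists f; split => // [x|x Sx].
  exact: le_trans (fA x) (inf_le_mem (lbA x) (Ap x)).
apply/eqP; rewrite eq_le fle//=.
by have := fle _ (SN _ Sx); rewrite f0N// (linear_formN _ fl) lerN2.
Qed.

Lemma hahn_banach_at {V : lmodType R} (p : V -> R) (x : V) : sublinear p ->
  exists f, [/\ linear_form f, forall y, f y <= p y & f x = p x].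
Proof.
move=> sp; have [p' [sp' p'p p'x]] := sublinear_steep x sp.
have [f fl fp'] := hahn_banach sp'.
have fp y : f y <= p y := le_trans (fp' y) (p'p y).
exists f; split=> //; apply/eqP; rewrite eq_le fp/=.
have := le_trans (fp' (- x)) (p'x (- x)).
by rewrite addNr (sublinear0 sp) linear_formN// sub0r lerN2.
Qed.

End HahnBanach.

(** * Separable subspaces *)

Section SeparableSubspaces.
Context {R : realType} {E : normedModType R}.
Implicit Types (x y : E) (d : nat -> E).

Lemma closure_normP (A : set E) x :
  closure A x <-> forall eps : R, 0 < eps -> exists2 y, A y & `|x - y| < eps.
Proof.
split=> [clA eps e0|H B /nbhs_normP[eps /= e0 xB]].
  have [y [Ay xy]] := clA _ (nbhsx_ballx x eps e0).
  by exists y => //; move: xy; rewrite -ball_normE.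
have [y Ay xy] := H _ e0; exists y; split=> //; exact: xB.
Qed.

(** Terms in the generators [b] and the binary operations [F]. Generic trees are used because they
    are countable; nodes that are not binary get the default value [b 0]. *)
Fixpoint eval_tree (b : nat -> E) (F : nat -> E -> E -> E)
    (t : GenTree.tree nat) : E :=
  match t with
  | GenTree.Leaf n => b n
  | GenTree.Node n [:: t1; t2] => F n (eval_tree b F t1) (eval_tree b F t2)
  | _ => b 0%N
  end.

Lemma countable_op_closure (b : nat -> E) (F : nat -> E -> E -> E) :
  exists d, (forall n, exists k, d k = b n) /\
    (forall n i j, exists k, d k = F n (d i) (d j)).
Proof.
pose tr k := odflt (GenTree.Leaf 0%N) (unpickle k).
exists (fun k => eval_tree b F (tr k)); split=> [n|n i j].
  by exists (pickle (GenTree.Leaf n)); rewrite /tr pickleK.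
by exists (pickle (GenTree.Node n [:: tr i; tr j])); rewrite {1}/tr pickleK.
Qed.

Lemma closed_subspace_closure d :
  (forall (r : rat) i j, exists k, d k = ratr r *: d i + d j) ->
  closed_subspace (closure (range d)).
Proof.
move=> dcl.
have [k0 k0E] : exists k, d k = 0.
  have [k kE] := dcl (-1) 0%N 0%N.
  by exists k; rewrite kE rmorphN1 scaleN1r addNr.
split; first by apply: subset_closure; exists k0.
split; last exact: closed_closure.
move=> a x y /closure_normP clx /closure_normP cly; apply/closure_normP => eps e0.
have e4 : 0 < eps / 4 by lra.
have [_ [j _ <-] yj] := cly _ e4.
have a0 : 0 < 1 + `|a| by rewrite ltr_wpDr.
have [_ [i _ <-] xi] := clx _ (divr_gt0 e4 a0).
have d0 : 0 < 1 + `|d i| by rewrite ltr_wpDr.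
have ep := divr_gt0 e4 d0.
have [r] : exists r : rat, ratr r \in `]a, a + eps / 4 / (1 + `|d i|)[.
  by apply: rat_in_itvoo; rewrite ltrDl.
rewrite in_itv/= => /andP[ar ra].
have [k kE] := dcl r i j; exists (d k); first by exists k.
have -> : a *: x + y - d k = a *: (x - d i) + (y - d j) + (a - ratr r) *: d i.
  by rewrite kE scalerBr scalerBl [RHS]addrAC subrKA addrACA -opprD.
apply: (le_lt_trans (ler_normD _ _)).
have h1 : `|a *: (x - d i) + (y - d j)| < eps / 4 + eps / 4.
  apply: (le_lt_trans (ler_normD _ _)); apply: ltrD => //.
  rewrite normrZ; apply: (@le_lt_trans _ _ ((1 + `|a|) * `|x - d i|)).
    by apply: ler_wpM2r => //; rewrite lerDr.
  by rewrite mulrC -ltr_pdivlMr.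
have h2 : `|(a - ratr r) *: d i| <= eps / 4.
  rewrite normrZ; apply: (@le_trans _ _ (`|a - ratr r| * (1 + `|d i|))).
    by apply: ler_wpM2l => //; rewrite lerDr.
  rewrite -ler_pdivlMr// distrC gtr0_norm; lra.
lra.
Qed.

(** A Loewenheim-Skolem construction: rational combinations and the maps [F n] are coded as one
    countable family of operations, so that a dense sequence of the subspace is stable under all
    choices encoded in [F]. *)
Lemma rich_separable_subspace (b : nat -> E) (F : nat -> E -> E) :
  exists d, [/\ forall n, exists k, d k = b n,
    forall n i, exists k, d k = F n (d i),
    closed_subspace (closure (range d)) & separable_set (closure (range d))].
Proof.
pose F' n x y := if unpickle n is Some t then
  (match t with inl r => ratr r *: x + y | inr m => F m x end) else x.
have [d [db dF]] := countable_op_closure b F'.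
exists d; split=> //.
- move=> n i; have [k kE] := dF (pickle (inr n : rat + nat)) i i.
  by exists k; rewrite kE /F' pickleK.
- apply: closed_subspace_closure => r i j.
  have [k kE] := dF (pickle (inl r : rat + nat)) i j.
  by exists k; rewrite kE /F' pickleK.
- by exists d; split=> // n; apply: subset_closure; exists n.
Qed.

Lemma separable_subspace_containing (b : nat -> E) :
  exists T : set E, [/\ closed_subspace T, separable_set T & forall n, T (b n)].
Proof.
have [d [db _ dc ds]] := rich_separable_subspace b (fun _ => id).
exists (closure (range d)); split=> // n.
by have [k <-] := db n; apply: subset_closure; exists k.
Qed.

End SeparableSubspaces.

(** * Separable reduction *)

Section SeparableReduction.
Context {R : realType} {E : normedModType R}.

Lemma clin_of_le (f : E -> R) (C : R) : linear_form f ->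
  (forall x, f x <= C * `|x|) -> clin f.
Proof.
move=> lf fC; split; first exact: lf.
have nfC x : `|f x| <= (1 + `|C|) * `|x|.
  have CC : C * `|x| <= (1 + `|C|) * `|x|.
    by apply: ler_wpM2r => //; apply: (le_trans (ler_norm C)); rewrite lerDr.
  have := fC (- x); rewrite linear_formN// normrN => h.
  by rewrite ler_norml; apply/andP; split; [lra|exact: le_trans (fC x) CC].
have C0 : 0 < 1 + `|C| by rewrite ltr_wpDr.
move=> x; apply/cvgrPdist_lt => eps e0.
near=> t; rewrite -linear_formB//; apply: (le_lt_trans (nfC _)).
rewrite mulrC -ltr_pdivlMr//; near: t.
by apply: (@cvgr_dist_lt _ _ _ (nbhs x)); [exact: cvg_id|rewrite divr_gt0].
Unshelve. all: by end_near. Qed.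

Lemma exists_nat_gt (x : R) : exists k : nat, x < k%:R.
Proof.
exists (Num.bound x); apply: (le_lt_trans (ler_norm x)).
by have := archi_boundP (normr_ge0 x); rewrite /Num.bound normr_id.
Qed.

Lemma exists_inv_lt (eps : R) : 0 < eps -> exists k : nat, (k.+1%:R)^-1 < eps.
Proof.
move=> e0; have [k kE] := exists_nat_gt eps^-1; exists k.
rewrite invf_plt ?posrE//; apply: (lt_le_trans kE); by rewrite ler_nat.
Qed.

Variables (Th : set E) (s : E -> R) (C : R).
Hypothesis s_sub : sublinear s.
Hypothesis s_le : forall x, s x <= C * `|x|.

(* An item ((lambda, y), (j, n)) is a weight, a point of [Th], the slope
   1/(j+1) allowed for a normal functional in the direction of that point and
   the radius 1/(n+1) within which this slope is allowed. *)
Local Notation item := ((R * E) * (nat * nat))%type.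

Definition slope_cost (a : E) (l : seq item) : R :=
  \sum_(i <- l) i.1.1 * (`|i.1.2 - a| / i.2.1.+1%:R).
Definition displacement (a : E) (l : seq item) : E :=
  \sum_(i <- l) i.1.1 *: (i.1.2 - a).
(** With nonnegative weights, a functional [nu <= s] obeying the slopes of all items satisfies
    [nu (displacement a l) <= slope_cost a l] and [- nu (displacement a l) <= s (- displacement a
    l)]. A negative cost thus refutes the existence of such a functional. *)
Definition cost (a : E) (l : seq item) : R :=
  slope_cost a l + s (- displacement a l).
Definition weight (l : seq item) : R := \sum_(i <- l) i.1.1.

(** The margin [kap] keeps the radius condition true when the base point moves by at most [kap]. *)
Definition admissible (A : set E) (a : E) (kap : R) (l : seq item) : Prop :=
  forall i, i \in l -> [/\ 0 <= i.1.1, A i.1.2 &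
    `|i.1.2 - a| + kap < (i.2.2.+1%:R)^-1].

Definition no_violation (A : set E) (a : E) (m : nat -> nat) : Prop :=
  forall l : seq item, (forall i, i \in l -> i.2.2 = m i.2.1) ->
    admissible A a 0 l -> 0 <= cost a l.

Lemma weight_ge0 A a kap l : admissible A a kap l -> 0 <= weight l.
Proof.
by move=> adl; rewrite /weight big_seq; apply: sumr_ge0 => i /adl[].
Qed.

Lemma cost_shift A a a' kap l : admissible A a kap l ->
  cost a' l <= cost a l + (1 + C) * weight l * `|a - a'|.
Proof.
move=> adl.
have h1 : slope_cost a' l <= slope_cost a l + weight l * `|a - a'|.
  rewrite /slope_cost /weight mulr_suml -big_split/= big_seq [leRHS]big_seq.
  apply: ler_sum => i /adl[l0 _ _].
  rewrite -mulrDr; apply: ler_wpM2l => //.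
  have j1 : 1 <= i.2.1.+1%:R :> R by rewrite ler1n.
  have j0 : 0 < i.2.1.+1%:R :> R by rewrite ltr0n.
  rewrite ler_pdivrMr// mulrDl divfK ?gt_eqF//.
  apply: (@le_trans _ _ (`|i.1.2 - a| + `|a - a'|)).
    by apply: (le_trans _ (ler_normD _ _)); rewrite subrKA.
  by rewrite lerD2l ler_peMr.
have e : - displacement a' l = - displacement a l + weight l *: (a' - a).
  rewrite /displacement /weight scaler_suml -!sumrN -big_split/=.
  apply: eq_bigr => i _; rewrite -!scalerN -scalerDr !opprB; congr (_ *: _).
  by rewrite [RHS]addrC subrKA.
have h2 : s (- displacement a' l) <= s (- displacement a l) + C * weight l * `|a - a'|.
  rewrite e; apply: (le_trans (s_sub.1 _ _)); rewrite lerD2l.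
  rewrite s_sub.2 ?(weight_ge0 adl)// [C * _]mulrC -mulrA [`|a - _|]distrC.
  by apply: ler_wpM2l; [exact: (weight_ge0 adl)|exact: s_le].
rewrite /cost; lra.
Qed.

Lemma admissible_margin A a l : admissible A a 0 l ->
  exists2 kap : R, 0 < kap & admissible A a kap l.
Proof.
elim: l => [|i l IH] adl; first by exists 1 => //; move=> i; rewrite in_nil.
have [|kap k0 adk] := IH; first by move=> i' il; apply: adl; rewrite in_cons il orbT.
have [l0 Ai] := adl i (mem_head _ _); rewrite addr0 => di.
pose k2 := ((i.2.2.+1%:R)^-1 - `|i.1.2 - a|) / 2.
have k20 : 0 < k2 by rewrite /k2 divr_gt0// subr_gt0.
exists (Num.min kap k2); first by rewrite lt_min k0.
move=> i'; rewrite in_cons => /orP[/eqP ->|/adk[h1 h2 h3]]; split=> //.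
  by apply: (@le_lt_trans _ _ (`|i.1.2 - a| + k2));
    [rewrite lerD2l ge_min lexx orbT|]; move: di; rewrite /k2;
    move: (_^-1) `|_| => r q; lra.
by apply: le_lt_trans h3; rewrite lerD2l ge_min lexx.
Qed.

(** One integer [k] controls the weight, the margin and the negativity of the cost, which sorts
    violations into countably many classes. *)
Definition violates (A : set E) (a : E) (k : nat) (l : seq item) : Prop :=
  [/\ admissible A a (k.+1%:R)^-1 l, weight l <= k%:R &
      cost a l < - (k.+1%:R)^-1].

(* Only the weights and the points of a violation are chosen; its shape
   (indices and radii) and its margin range over a countable set. *)
Lemma separable_no_violation (e0 : E) : exists T : set E,
  [/\ closed_subspace T, separable_set T, T e0 &
  forall e m, T e -> no_violation (Th `&` T) e m -> no_violation Th e m].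
Proof.
have : forall q : E * (seq (nat * nat) * nat), exists l : seq item,
  (exists2 l', map snd l' = q.2.1 & violates Th q.1 q.2.2 l') ->
  map snd l = q.2.1 /\ violates Th q.1 q.2.2 l.
  move=> q; have [[l' h1 h2]|n] := pselect (exists2 l',
    map snd l' = q.2.1 & violates Th q.1 q.2.2 l'); first by exists l'.
  by exists [::].
move=> /choice[W WP].
(* Each map returns one point of the violation chosen at [a] for a given shape and bound; stability
   of the dense sequence under these maps puts all the points chosen at its members into the
   subspace. *)
pose F n a := if (unpickle n : option (seq (nat * nat) * nat * nat)) is Some t
  then nth 0 [seq i.1.2 | i <- W (a, t.1)] t.2 else a.
have [d [db dF dc ds]] := rich_separable_subspace (fun=> e0) F.
exists (closure (range d)); split=> //.
  by have [k <-] := db 0%N; apply: subset_closure; exists k.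
move=> e m Te nvT l lm adl; rewrite leNgt; apply/negP => cl.
have [kap kap0 adk] := admissible_margin adl.
have [k1 k1P] := exists_nat_gt (weight l).
have [k2 k2P] := exists_inv_lt (divr_gt0 kap0 (ltr0n _ 2)).
have [|k3 k3P] := @exists_inv_lt (- cost e l / 2); first by lra.
pose k := maxn k1 (maxn k2 k3).
have kk0 : 0 < (k.+1%:R : R)^-1 by rewrite invr_gt0 ltr0n.
have kk2 : (k.+1%:R : R)^-1 <= (k2.+1%:R)^-1.
  by rewrite lef_pV2 ?posrE ?ltr0n// ler_nat ltnS !leq_max leqnn orbT.
have kk3 : (k.+1%:R : R)^-1 <= (k3.+1%:R)^-1.
  by rewrite lef_pV2 ?posrE ?ltr0n// ler_nat ltnS !leq_max leqnn !orbT.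
have wk : weight l <= k%:R.
  by apply: ltW; apply: (lt_le_trans k1P); rewrite ler_nat leq_maxl.
have Cp : 0 < 1 + (1 + `|C|) * k%:R by rewrite ltr_wpDr// mulr_ge0// addr_ge0.
have kkp := le_lt_trans kk2 k2P; have kkc := le_lt_trans kk3 k3P.
move: kk0 kkp kkc; set kk := (k.+1%:R : R)^-1 => kk0 kkp kkc.
(* The approximation of [e] is so close that moving the base point raises the cost of a list of
   weight at most [k] by less than [kk]. *)
have dl0 := divr_gt0 kk0 Cp.
have [_ [i0 _ <-] ei0] := (closure_normP _ _).1 Te _ dl0.
set dl := `|e - d i0| in ei0.
have dl_ge0 : 0 <= dl by exact: normr_ge0.
have bnd : dl * (1 + (1 + `|C|) * k%:R) < kk by rewrite -ltr_pdivlMr.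
have dlkk : dl < kk.
  apply: le_lt_trans bnd; rewrite ler_peMr// lerDl mulr_ge0// addr_ge0//.
have bnd2 w : 0 <= w -> w <= k%:R -> (1 + C) * w * dl < kk.
  move=> w0 wk'; apply: le_lt_trans bnd; rewrite mulrC; apply: ler_wpM2l => //.
  apply: (@le_trans _ _ ((1 + `|C|) * k%:R)); last by rewrite lerDr.
  apply: (@le_trans _ _ ((1 + `|C|) * w)).
    by apply: ler_wpM2r => //; rewrite lerD2l ler_norm.
  by apply: ler_wpM2l => //; rewrite addr_ge0.
have vl : violates Th (d i0) k l.
  split=> //; last first.
    apply: (le_lt_trans (cost_shift _ adl)); rewrite -/kk.
    have := bnd2 _ (weight_ge0 adl) wk; rewrite /dl; lra.
  move=> i il; have [h1 h2 h3] := adk i il; split=> //; rewrite -/kk.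
  have : `|i.1.2 - d i0| <= `|i.1.2 - e| + dl.
    by apply: (le_trans _ (ler_normD _ _)); rewrite subrKA.
  move: h3; move: (_^-1) => r; lra.
have [Wsh [Wad Ww Wc]] := WP (d i0, (map snd l, k)) (ex_intro2 _ _ l erefl vl).
set l' := W _ in Wsh Wad Ww Wc; rewrite /= in Wsh Wad Ww Wc.
(* Moved back from [d i0] to [e], the chosen violation still has negative cost, and all its points
   lie in the subspace. *)
suff : 0 <= cost e l'.
  have := cost_shift e Wad; have := bnd2 _ (weight_ge0 Wad) Ww.
  by move: Wc; rewrite -/kk /= distrC -/dl; lra.
have subl i : i \in l' -> exists2 i', i' \in l & i.2 = i'.2.
  by move=> il; have /mapP[i' h1 h2] : i.2 \in map snd l;
    [rewrite -Wsh; exact: map_f|exists i'].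
apply: nvT => [i /subl[i' /lm h ->]//|i il].
have [h1 h2 h3] := Wad i il; split=> //.
  split=> //; apply: subset_closure.
  have il' : i.1.2 \in [seq i.1.2 | i <- l'] by exact: (map_f (fun i : item => i.1.2)).
  have [n nE] := dF (pickle ((map snd l, k), index i.1.2 [seq i.1.2 | i <- l'])) i0.
  exists n => //; rewrite nE /F pickleK -/l'; exact: nth_index.
rewrite addr0.
have : `|i.1.2 - e| <= `|i.1.2 - d i0| + dl.
  by rewrite /dl [`|e - _|]distrC; apply: (le_trans _ (ler_normD _ _)); rewrite subrKA.
move: h3; rewrite -/kk; move: (_^-1) => r /=; lra.
Qed.

(** The infimum over admissible lists of [slope_cost e l + s (w - displacement e l)] is the largest
    sublinear function below [s] that obeys the slope bounds, and the absence of violations keeps it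
    finite. A linear minorant is the normal; one-item lists give its slope estimates. *)
Lemma normal_of_no_violation (e : E) (m : nat -> nat) :
  no_violation Th e m -> exists2 nu, fnormal Th e nu & forall x, nu x <= s x.
Proof.
move=> nv.
pose adm : set (seq item) := fun l =>
  (forall i : item, i \in l -> i.2.2 = m i.2.1) /\ admissible Th e 0 l.
pose A w := [set slope_cost e l + s (w - displacement e l) | l in adm].
have lbA w r : A w r -> - s (- w) <= r.
  move=> [l [lm adl] <-]; have := nv l lm adl; rewrite /cost.
  have := s_sub.1 (w - displacement e l) (- w); rewrite addrAC subrr add0r; lra.
have As w : A w (s w).
  exists [::]; first by split=> i; rewrite in_nil.
  by rewrite /slope_cost /displacement !big_nil subr0 add0r.
have sA : sublinear (fun w => inf (A w)).
  apply: (@sublinear_inf _ _ A (fun w => - s (- w))) => //.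
  - by move=> w; exists (s w).
  - move=> w w' _ _ [l [lm adl] <-] [l' [lm' adl'] <-].
    eexists; first (exists (l ++ l'); last reflexivity).
      split=> i; rewrite mem_cat => /orP[]; by [apply: lm|apply: lm'|apply: adl|apply: adl'].
    rewrite /slope_cost /displacement !big_cat/= opprD addrACA.
    have := s_sub.1 (w - displacement e l) (w' - displacement e l').
    rewrite /displacement; lra.
  - move=> t w _ t0 [l [lm adl] <-].
    pose l' := [seq ((t * i.1.1, i.1.2), i.2) | i : item <- l].
    eexists; first (exists l'; last reflexivity).
      split=> i /mapP[i' il ->]/=; first exact: lm.
      by have [h1 h2 h3] := adl _ il; split=> //=; rewrite mulr_ge0// ltW.
    have -> : slope_cost e l' = t * slope_cost e l.
      rewrite /slope_cost big_map mulr_sumr; apply: eq_bigr => i _ /=; by rewrite -mulrA.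
    have -> : displacement e l' = t *: displacement e l.
      rewrite /displacement big_map scaler_sumr; apply: eq_bigr => i _ /=; by rewrite scalerA.
    by rewrite -scalerBr s_sub.2 ?(ltW t0)// mulrDr.
  - by have := As 0; rewrite (sublinear0 s_sub).
  - by rewrite oppr0 (sublinear0 s_sub) oppr0.
have [nu nul nuA] := hahn_banach sA.
have nus x : nu x <= s x := le_trans (nuA x) (inf_le_mem (lbA x) (As x)).
exists nu => //; split.
  by apply: (clin_of_le (C := C)) => // x; exact: le_trans (nus x) (s_le x).
move=> eps e0; have [j jP] := exists_inv_lt e0.
exists ((m j).+1%:R)^-1; first by rewrite invr_gt0 ltr0n.
move=> u Thu ud.
have h : nu (u - e) <= `|u - e| / j.+1%:R.
  apply: (le_trans (nuA _)); apply: (inf_le_mem (lbA _)).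
  exists [:: ((1, u), (j, m j))].
    split=> i; rewrite mem_seq1 => /eqP ->//=; split=> //=; by rewrite addr0.
  rewrite /slope_cost /displacement !big_seq1/= scale1r subrr (sublinear0 s_sub).
  by rewrite mul1r addr0.
apply: (le_trans h); rewrite mulrC; apply: ler_wpM2r => //; exact: ltW.
Qed.

End SeparableReduction.

(** * Geometrically weighted series *)

Section WeightedSums.
Context {R : realType}.
Implicit Types (a b : nat -> R).

(** The weights add up to one, so [wsum] is an average: it preserves constants and upper bounds. *)
Definition wseries a : nat -> R := series (fun j => a j / 2 ^+ j.+1).
Definition wsum a : R := limn (wseries a).

Definition bounded_seq a : Prop := exists B : R, forall j, `|a j| <= B.

Lemma wseries_cst1 : wseries (fun=> 1) @ \oo --> (1 : R).
Proof.
have h : `|2^-1 : R| < 1 by rewrite gtr0_norm// invf_lt1// ltr1n.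
have := @cvg_geometric_series R 2^-1 2^-1 h.
have -> : 2^-1 / (1 - 2^-1) = 1 :> R by field.
have -> // : series (geometric 2^-1 2^-1) = wseries (fun=> 1) :> (nat -> R).
apply/funext => n; rewrite /series/=; apply: eq_bigr => j _.
by rewrite mul1r exprS invfM -exprVn.
Qed.

Lemma wsum_cvg a : bounded_seq a -> wseries a @ \oo --> wsum a.
Proof.
move=> [B aB]; rewrite /wsum; apply: normed_cvg.
apply: (@series_le_cvg _ _ (fun j => B * (1 / 2 ^+ j.+1))) => [j|j|j|].
- exact: normr_ge0.
- by rewrite mulr_ge0 ?divr_ge0 ?exprn_ge0//; exact: le_trans (normr_ge0 _) (aB 0%N).
- rewrite /= normrM mul1r [`|_^-1|]ger0_norm ?invr_ge0 ?exprn_ge0//.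
  by apply: ler_wpM2r => //; rewrite invr_ge0 exprn_ge0.
- have := @is_cvg_seriesZ _ (fun j => 1 / 2 ^+ j.+1) B.
  by apply; apply/cvg_ex; exists 1; exact: wseries_cst1.
Qed.

Lemma le_wsum a b : bounded_seq a -> bounded_seq b ->
  (forall j, a j <= b j) -> wsum a <= wsum b.
Proof.
move=> ba bb ab; apply: ler_lim.
- by apply/cvg_ex; eexists; exact: wsum_cvg.
- by apply/cvg_ex; eexists; exact: wsum_cvg.
- apply: nearW => n; apply: ler_sum => j _.
  by apply: ler_wpM2r => //; rewrite invr_ge0 exprn_ge0.
Qed.

Lemma wsum_cst (c : R) : wsum (fun=> c) = c.
Proof.
apply: cvg_lim => //.
have -> : wseries (fun=> c) = (fun n => c * wseries (fun=> 1) n).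
  apply/funext => n; rewrite /wseries/series/= mulr_sumr.
  by apply: eq_bigr => j _; rewrite mul1r.
rewrite -[X in _ --> X]mulr1; apply: cvgM; [exact: cvg_cst|exact: wseries_cst1].
Qed.

Lemma bounded_seq_cst (c : R) : bounded_seq (fun=> c).
Proof. by exists `|c|. Qed.

Lemma bounded_seqD a b : bounded_seq a -> bounded_seq b ->
  bounded_seq (fun j => a j + b j).
Proof.
move=> [A aA] [B bB]; exists (A + B) => j.
by apply: (le_trans (ler_normD _ _)); exact: lerD.
Qed.

Lemma bounded_seqZ (c : R) a : bounded_seq a -> bounded_seq (fun j => c * a j).
Proof.
move=> [A aA]; exists (`|c| * A) => j; rewrite normrM; exact: ler_wpM2l.
Qed.

Lemma bounded_seq_ge0 a (B : R) :
  (forall j, 0 <= a j) -> (forall j, a j <= B) -> bounded_seq a.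
Proof. by move=> a0 aB; exists B => j; rewrite ger0_norm. Qed.

Lemma wsumD a b : bounded_seq a -> bounded_seq b ->
  wsum (fun j => a j + b j) = wsum a + wsum b.
Proof.
move=> ba bb; apply: cvg_lim => //.
have -> : wseries (fun j => a j + b j) = (fun n => wseries a n + wseries b n).
  apply/funext => n; rewrite /wseries/series/= -big_split/=.
  by apply: eq_bigr => j _; rewrite mulrDl.
by apply: cvgD; exact: wsum_cvg.
Qed.

Lemma wsumZ (c : R) a : bounded_seq a -> wsum (fun j => c * a j) = c * wsum a.
Proof.
move=> ba; apply: cvg_lim => //.
have -> : wseries (fun j => c * a j) = (fun n => c * wseries a n).
  apply/funext => n; rewrite /wseries/series/= mulr_sumr.
  by apply: eq_bigr => j _; rewrite mulrA.
by apply: cvgM; [exact: cvg_cst|exact: wsum_cvg].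
Qed.

Lemma wsum_le_cst a (B : R) : bounded_seq a -> (forall j, a j <= B) -> wsum a <= B.
Proof.
move=> ba aB; rewrite -[leRHS]wsum_cst; apply: le_wsum => //; exact: bounded_seq_cst.
Qed.

Lemma wsum_ge0 a : bounded_seq a -> (forall j, 0 <= a j) -> 0 <= wsum a.
Proof.
move=> ba aB; rewrite -(wsum_cst 0); apply: le_wsum => //; exact: bounded_seq_cst.
Qed.

Lemma wsum_shift a : bounded_seq a ->
  wsum a = a 0%N / 2 + wsum (fun j => a j.+1) / 2.
Proof.
move=> ba; have bs : bounded_seq (fun j => a j.+1).
  by case: ba => B aB; exists B.
apply: cvg_lim => //; rewrite -cvg_shiftS.
have -> : [sequence wseries a n.+1]_n =
    (fun n => a 0%N / 2 + wseries (fun j => a j.+1) n / 2).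
  apply/funext => n; rewrite /wseries/series/= big_nat_recl// expr1; congr (_ + _).
  rewrite mulr_suml; apply: eq_bigr => j _.
  by rewrite [2 ^+ j.+2]exprSr invfM mulrA.
apply: cvgD; first exact: cvg_cst.
by apply: cvgM; [exact: wsum_cvg|exact: cvg_cst].
Qed.

(** The weights of the indices from [J] on add up to [1/2^J]; peeling off the first term gives the
    induction. *)
Lemma wsum_tail_le a (eps C : R) (J : nat) : bounded_seq a -> 0 <= eps ->
  (forall j, (j < J)%N -> a j <= eps) -> (forall j, a j <= C) ->
  wsum a <= eps + C / 2 ^+ J.
Proof.
move=> + e0; elim: J a => [|J IH] a ba aJ aC.
  have := wsum_le_cst ba aC; rewrite expr0 divr1; lra.
have bs : bounded_seq (fun j => a j.+1) by case: ba => B aB; exists B.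
rewrite wsum_shift//.
have h1 := aJ 0%N isT.
have h2 : wsum (fun j => a j.+1) <= eps + C / 2 ^+ J by apply: IH => // j jJ; exact: aJ.
by rewrite exprSr invfM mulrA; lra.
Qed.

Lemma wseries_le_wsum a n : bounded_seq a -> (forall j, 0 <= a j) ->
  wseries a n <= wsum a.
Proof.
move=> ba a0; apply: nondecreasing_cvgn_le.
  apply/nondecreasing_seqP => k; rewrite /wseries/series/= big_nat_recr//=.
  by rewrite lerDl divr_ge0// exprn_ge0.
by apply/cvg_ex; eexists; exact: wsum_cvg.
Qed.

Lemma wsum_le_of_wseries a (B : R) : bounded_seq a ->
  (forall n, wseries a n <= B) -> wsum a <= B.
Proof.
move=> ba aB; apply: limr_le; last by apply: nearW.
by apply/cvg_ex; eexists; exact: wsum_cvg.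
Qed.

Lemma wsum_term_le a j : bounded_seq a -> (forall j, 0 <= a j) ->
  a j / 2 ^+ j.+1 <= wsum a.
Proof.
move=> ba a0; apply: le_trans (wseries_le_wsum j.+1 ba a0).
rewrite /wseries/series/= big_nat_recr//= lerDr sumr_ge0// => k _.
by rewrite divr_ge0// exprn_ge0.
Qed.

End WeightedSums.

(** * Smooth convex functions on a subspace with separable dual *)

Section Ultralimits.
Context {R : realType}.

(** Along one such ultrafilter all bounded real sequences converge at once, so pointwise limits of
    bounded sequences of functionals exist without extracting subsequences. *)
Lemma free_ultrafilter : exists U : set_system nat, UltraFilter U /\ \oo `<=` U.
Proof. exact: ultraFilterLemma. Qed.

Lemma ultra_cvg (U : set_system nat) (a : nat -> R) (B : R) : UltraFilter U ->
  (forall n, `|a n| <= B) -> exists l : R, a @ U --> l.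
Proof.
move=> UU aB.
have cB : compact `[- B, B]%classic by exact: (@segment_compact R).
have [|l [_ al]] := cB (a @ U) _.
  by rewrite /= nbhs_simpl; apply: filterE => n; rewrite /= in_itv/= -ler_norml.
exists l => A lA.
have [//|UC] := in_ultra_setVsetC (a @^-1` A) UU.
by have [r [nA Ar]] := al (~` A) A UC lA.
Qed.

Lemma cvg_ler (U : set_system nat) {FU : ProperFilter U} (a b : nat -> R) (l l' : R) :
  a @ U --> l -> b @ U --> l' -> (forall n, a n <= b n) -> l <= l'.
Proof.
move=> al bl ab; have h : (fun n => b n - a n) @ U --> l' - l by exact: cvgB.
rewrite -subr_ge0 -(cvg_lim (@norm_hausdorff _ _) h); apply: limr_ge.
  by apply/cvg_ex; exists (l' - l).
by apply: nearW => n; rewrite /= subr_ge0.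
Qed.

Lemma cvg_wseries (U : set_system nat) {FU : ProperFilter U}
    (a : nat -> nat -> R) (b : nat -> R) N :
  (forall j, (fun n => a n j) @ U --> b j) ->
  (fun n => wseries (a n) N) @ U --> wseries b N.
Proof.
move=> ab; elim: N => [|N IH].
  have -> : (fun n => wseries (a n) 0) = fun=> 0.
    by apply/funext => n; rewrite /wseries/series/= big_nil.
  rewrite /wseries/series/= big_nil; exact: cvg_cst.
have -> : (fun n => wseries (a n) N.+1) =
    (fun n => wseries (a n) N + a n N / 2 ^+ N.+1).
  by apply/funext => n; rewrite /wseries/series/= big_nat_recr.
rewrite [X in _ --> X]/wseries/series/= big_nat_recr//=.
by apply: cvgD => //; apply: cvgM => //; exact: cvg_cst.
Qed.

End Ultralimits.

(** * Bounded functionals on a closed subspace and their dual norm *)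

Section DualNorm.
Context {R : realType} {E : normedModType R}.
Variable (T : set E).
Implicit Types f g : E -> R.
Hypothesis T_sub : closed_subspace T.

(** Functionals are total functions on [E] with arbitrary values off [T]; hence every estimate about
    them is restricted to [T]. *)
Definition functional (f : E -> R) : Prop := lin_on T f /\ bdd_on T f.

Let T0 : T 0 := T_sub.1.
Let Tl a x y : T x -> T y -> T (a *: x + y) := T_sub.2.1 a x y.

Lemma subspaceD x y : T x -> T y -> T (x + y).
Proof. by move=> Tx Ty; have := Tl 1 Tx Ty; rewrite scale1r. Qed.

Lemma subspaceZ a x : T x -> T (a *: x).
Proof. by move=> Tx; have := Tl a Tx T0; rewrite addr0. Qed.

Lemma subspaceN x : T x -> T (- x).
Proof. by move=> Tx; rewrite -scaleN1r; exact: subspaceZ. Qed.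

Lemma subspaceB x y : T x -> T y -> T (x - y).
Proof. by move=> Tx Ty; apply: subspaceD => //; exact: subspaceN. Qed.

Lemma functional0 f : functional f -> f 0 = 0.
Proof. by case=> lf _; have := lf (-1) 0 0 T0 T0; rewrite scaler0 addr0; lra. Qed.

Lemma functionalD f x y : functional f -> T x -> T y -> f (x + y) = f x + f y.
Proof. by case=> lf _ Tx Ty; have := lf 1 _ _ Tx Ty; rewrite scale1r mul1r. Qed.

Lemma functionalZ f a x : functional f -> T x -> f (a *: x) = a * f x.
Proof.
by move=> ff Tx; have := ff.1 a _ _ Tx T0; rewrite !addr0 (functional0 ff) addr0.
Qed.

Lemma functionalB f x y : functional f -> T x -> T y -> f (x - y) = f x - f y.
Proof.
move=> ff Tx Ty; rewrite functionalD//; last exact: subspaceN.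
by rewrite -scaleN1r functionalZ// mulN1r.
Qed.

Lemma functional_comb f g (a b : R) : functional f -> functional g ->
  functional (fun y => a * f y + b * g y).
Proof.
move=> ff fg; split=> [c x y Tx Ty|].
  by rewrite ff.1// fg.1//; ring.
have [[_ [A fA]] [_ [B gB]]] := (ff, fg).
exists (`|a| * A + `|b| * B) => y Ty.
apply: (le_trans (ler_normD _ _)); rewrite !normrM mulrDl -!mulrA.
by apply: lerD; apply: ler_wpM2l => //; [exact: fA|exact: gB].
Qed.

Definition fnorm (f : E -> R) : R := sup [set `|f y| | y in [set y | T y /\ `|y| <= 1]].

Lemma fnorm_set0 f : [set `|f y| | y in [set y | T y /\ `|y| <= 1]] !=set0.
Proof. by exists `|f 0|, 0 => //=; rewrite normr0. Qed.

Lemma fnorm_ub f : functional f ->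
  exists B, forall r, [set `|f y| | y in [set y | T y /\ `|y| <= 1]] r -> r <= B.
Proof.
move=> [_ [B fB]]; exists `|B| => _ [y [Ty y1] <-].
apply: (le_trans (fB _ Ty)); apply: (@le_trans _ _ (`|B| * `|y|)).
  by apply: ler_wpM2r => //; exact: ler_norm.
by rewrite ler_piMr.
Qed.

Lemma fnorm_ge0 f : functional f -> 0 <= fnorm f.
Proof.
move=> ff; have [B fB] := fnorm_ub ff.
apply: (le_trans (normr_ge0 (f 0))); apply: (le_sup_mem fB).
by exists 0 => //=; rewrite normr0.
Qed.

Lemma le_fnorm f y : functional f -> T y -> `|f y| <= fnorm f * `|y|.
Proof.
move=> ff Ty; have [->|y0] := eqVneq y 0.
  by rewrite (functional0 ff) !normr0 mulr0.
have yp : 0 < `|y| by rewrite normr_gt0.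
have [B fB] := fnorm_ub ff.
have : `|f (`|y|^-1 *: y)| <= fnorm f.
  apply: (le_sup_mem fB); exists (`|y|^-1 *: y) => //=; split; first exact: subspaceZ.
  by rewrite normrZ normfV normr_id mulVf// gt_eqF.
by rewrite functionalZ// normrM normfV normr_id mulrC ler_pdivrMr.
Qed.

Lemma fnorm_le f (B : R) : 0 <= B ->
  (forall y, T y -> `|f y| <= B * `|y|) -> fnorm f <= B.
Proof.
move=> B0 fB; apply: ge_sup; first exact: fnorm_set0.
by move=> _ [y [Ty y1] <-]; apply: (le_trans (fB _ Ty)); rewrite ler_piMr.
Qed.

Lemma fnorm_comb f g (a b : R) : functional f -> functional g ->
  fnorm (fun y => a * f y + b * g y) <= `|a| * fnorm f + `|b| * fnorm g.
Proof.
move=> ff fg; apply: fnorm_le.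
  by rewrite addr_ge0 ?mulr_ge0 ?fnorm_ge0.
move=> y Ty; apply: (le_trans (ler_normD _ _)); rewrite !normrM mulrDl -!mulrA.
by apply: lerD; apply: ler_wpM2l => //; exact: le_fnorm.
Qed.

Lemma functional_cvg (U : set_system nat) {FU : ProperFilter U}
    (fn : nat -> E -> R) f (B : R) :
  (forall n, functional (fn n)) -> (forall n, fnorm (fn n) <= B) ->
  (forall y, T y -> (fun n => fn n y) @ U --> f y) ->
  functional f /\ forall y, T y -> `|f y| <= B * `|y|.
Proof.
move=> ffn fnB cf.
have fB y : T y -> `|f y| <= B * `|y|.
  move=> Ty; have h : (fun n => `|fn n y|) @ U --> `|f y| by apply: cvg_norm; exact: cf.
  apply: (cvg_ler h (cvg_cst (B * `|y|))) => n; apply: (le_trans (le_fnorm (ffn n) Ty)).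
  by apply: ler_wpM2r.
split=> //; split; last by exists B.
move=> a x y Tx Ty.
have h1 := cf _ (Tl a Tx Ty).
have h2 : (fun n => fn n (a *: x + y)) @ U --> a * f x + f y.
  have -> : (fun n => fn n (a *: x + y)) = (fun n => a * fn n x + fn n y).
    by apply/funext => n; rewrite (ffn n).1.
  by apply: cvgD; [apply: cvgM; [exact: cvg_cst|exact: cf]|exact: cf].
exact: (cvg_unique (@norm_hausdorff _ _) h1 h2).
Qed.

End DualNorm.

(** * A rotund penalty on the dual, lower semicontinuous for pointwise limits *)

Section RotundPenalty.
Context {R : realType} {E : normedModType R}.
Variables (T : set E) (ys : nat -> E) (phis : nat -> E -> R).
Implicit Types f g : E -> R.
Hypothesis T_sub : closed_subspace T.
Hypothesis ys_T : forall n, T (ys n).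
Hypothesis phis_fun : forall n, functional T (phis n).

Let pair_of (m : nat) : nat * nat := odflt (0%N, 0%N) (unpickle m).

(* [f - f(y_i) phi_j] is linear in [f] and small when f(y_i) is close to 1 and
   phi_j is close to [f]; its norm is a seminorm, lower semicontinuous for
   pointwise convergence. *)
Definition resid f (m : nat) : E -> R := fun y =>
  1 * f y + (- f (ys (pair_of m).1)) * phis (pair_of m).2 y.
(** Normalization giving [rsemi f m <= fnorm T f] for every [m], hence convergence of the series in
    [theta]. *)
Definition resid_scale (m : nat) : R :=
  1 + `|ys (pair_of m).1| * fnorm T (phis (pair_of m).2).
Definition rsemi f (m : nat) : R := fnorm T (resid f m) / resid_scale m.
Definition esemi f (m : nat) : R := f (ys m) / (1 + `|ys m|).

(** The square of an equivalent dual norm, built in Kadec's manner to be locally uniformly rotund: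
    in a weighted sum of squares, the defect at a midpoint dominates the squared difference of each
    term. *)
Definition theta f : R := fnorm T f ^+ 2 + wsum (fun m => rsemi f m ^+ 2)
  + wsum (fun m => esemi f m ^+ 2).

Definition midf f g : E -> R := fun y => 2^-1 * f y + 2^-1 * g y.

Lemma resid_functional f m : functional T f -> functional T (resid f m).
Proof. by move=> ff; apply: functional_comb. Qed.

Lemma resid_scale_ge1 m : 1 <= resid_scale m.
Proof.
rewrite /resid_scale lerDl; apply: mulr_ge0 => //.
exact: (fnorm_ge0 T_sub (phis_fun _)).
Qed.

Lemma resid_scale_gt0 m : 0 < resid_scale m.
Proof. exact: lt_le_trans ltr01 (resid_scale_ge1 m). Qed.

Lemma rsemi_ge0 f m : functional T f -> 0 <= rsemi f m.
Proof.
move=> ff; apply: divr_ge0; last exact: ltW (resid_scale_gt0 m).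
by apply: fnorm_ge0 => //; exact: resid_functional.
Qed.

Lemma rsemi_le f m : functional T f -> rsemi f m <= fnorm T f.
Proof.
move=> ff; rewrite ler_pdivrMr ?resid_scale_gt0//.
apply: (le_trans (fnorm_comb _ _ _ ff (phis_fun _))) => //.
rewrite normr1 mul1r normrN /resid_scale mulrDr mulr1 lerD2l mulrA.
by apply: ler_wpM2r; [exact: fnorm_ge0|exact: le_fnorm].
Qed.

Lemma esemi_le f m : functional T f -> `|esemi f m| <= fnorm T f.
Proof.
move=> ff; have y0 : 0 < 1 + `|ys m| by rewrite ltr_wpDr.
rewrite normrM normfV (gtr0_norm y0) ler_pdivrMr//.
apply: (le_trans (le_fnorm T_sub ff (ys_T m))).
by apply: ler_wpM2l; [exact: fnorm_ge0|rewrite lerDr].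
Qed.

Lemma esemi_sq_le f m : functional T f -> esemi f m ^+ 2 <= fnorm T f ^+ 2.
Proof.
move=> ff; rewrite -real_normK ?num_real//.
by apply: lerXn2r; rewrite ?nnegrE ?fnorm_ge0//; exact: esemi_le.
Qed.

Lemma rsemi_sq_le f m : functional T f -> rsemi f m ^+ 2 <= fnorm T f ^+ 2.
Proof.
move=> ff; apply: lerXn2r; rewrite ?nnegrE ?fnorm_ge0 ?rsemi_ge0//.
exact: rsemi_le.
Qed.

Lemma bounded_rsemi f : functional T f -> bounded_seq (fun m => rsemi f m ^+ 2).
Proof.
move=> ff; apply: (@bounded_seq_ge0 _ _ (fnorm T f ^+ 2)) => j.
  exact: sqr_ge0.
exact: rsemi_sq_le.
Qed.

Lemma bounded_esemi f : functional T f -> bounded_seq (fun m => esemi f m ^+ 2).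
Proof.
move=> ff; apply: (@bounded_seq_ge0 _ _ (fnorm T f ^+ 2)) => j.
  exact: sqr_ge0.
exact: esemi_sq_le.
Qed.

Lemma theta_ge f : functional T f -> fnorm T f ^+ 2 <= theta f.
Proof.
move=> ff; rewrite /theta -addrA lerDl addr_ge0//; apply: wsum_ge0.
- exact: bounded_rsemi.
- by move=> j; exact: sqr_ge0.
- exact: bounded_esemi.
- by move=> j; exact: sqr_ge0.
Qed.

Lemma theta_le f : functional T f -> theta f <= 3 * fnorm T f ^+ 2.
Proof.
move=> ff; rewrite /theta.
have := wsum_le_cst (bounded_rsemi ff) (fun j => rsemi_sq_le j ff).
have := wsum_le_cst (bounded_esemi ff) (fun j => esemi_sq_le j ff).
lra.
Qed.

Lemma mid_functional f g : functional T f -> functional T g ->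
  functional T (midf f g).
Proof. by move=> ff fg; apply: functional_comb. Qed.

Lemma fnorm_mid f g : functional T f -> functional T g ->
  fnorm T (midf f g) <= (fnorm T f + fnorm T g) / 2.
Proof.
move=> ff fg; apply: (le_trans (fnorm_comb _ _ _ ff fg)) => //.
by rewrite ger0_norm ?invr_ge0//; lra.
Qed.

Lemma rsemi_mid f g m : functional T f -> functional T g ->
  rsemi (midf f g) m <= (rsemi f m + rsemi g m) / 2.
Proof.
move=> ff fg.
have e : resid (midf f g) m = midf (resid f m) (resid g m).
  by apply/funext => y; rewrite /resid /midf; ring.
rewrite /rsemi e -mulrDl mulrAC; apply: ler_wpM2r.
  by rewrite invr_ge0 ltW// resid_scale_gt0.
by apply: fnorm_mid; exact: resid_functional.
Qed.

Lemma esemi_mid f g m : esemi (midf f g) m = (esemi f m + esemi g m) / 2.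
Proof. by rewrite /esemi /midf -mulrDl; ring. Qed.

Lemma sq_mid_le (a b c : R) : 0 <= c -> c <= (a + b) / 2 ->
  c ^+ 2 + ((a - b) / 2) ^+ 2 <= 2^-1 * a ^+ 2 + 2^-1 * b ^+ 2.
Proof.
move=> c0 ch.
have : c ^+ 2 <= ((a + b) / 2) ^+ 2 by apply: lerXn2r; rewrite ?nnegrE//; lra.
by move=> h; rewrite !expr2 in h *; lra.
Qed.

Lemma bounded_half_diff (a b : nat -> R) : bounded_seq (fun m => a m ^+ 2) ->
  bounded_seq (fun m => b m ^+ 2) -> bounded_seq (fun m => ((a m - b m) / 2) ^+ 2).
Proof.
move=> [A aA] [B bB]; exists (A + B) => j.
have := aA j; have := bB j; rewrite !ger0_norm ?sqr_ge0//.
have := sqr_ge0 (a j + b j); have := sqr_ge0 (a j); have := sqr_ge0 (b j).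
by rewrite !expr2 => *; lra.
Qed.

Lemma wsum_mid_le (a b c : nat -> R) :
  bounded_seq (fun m => a m ^+ 2) -> bounded_seq (fun m => b m ^+ 2) ->
  bounded_seq (fun m => c m ^+ 2) ->
  (forall m, c m ^+ 2 + ((a m - b m) / 2) ^+ 2 <= 2^-1 * a m ^+ 2 + 2^-1 * b m ^+ 2) ->
  wsum (fun m => c m ^+ 2) + wsum (fun m => ((a m - b m) / 2) ^+ 2) <=
    (wsum (fun m => a m ^+ 2) + wsum (fun m => b m ^+ 2)) / 2.
Proof.
move=> ba bb bc h; have bd := bounded_half_diff ba bb.
have : wsum (fun m => c m ^+ 2) + wsum (fun m => ((a m - b m) / 2) ^+ 2) <=
    2^-1 * wsum (fun m => a m ^+ 2) + 2^-1 * wsum (fun m => b m ^+ 2).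
  rewrite -!wsumZ// -!wsumD//; try exact: bounded_seqZ.
  by apply: le_wsum => //; apply: bounded_seqD => //; exact: bounded_seqZ.
lra.
Qed.

Lemma theta_mid f g : functional T f -> functional T g ->
  theta (midf f g) + ((fnorm T f - fnorm T g) / 2) ^+ 2
  + wsum (fun m => ((rsemi f m - rsemi g m) / 2) ^+ 2)
  + wsum (fun m => ((esemi f m - esemi g m) / 2) ^+ 2)
  <= (theta f + theta g) / 2.
Proof.
move=> ff fg; have fm := mid_functional ff fg.
have h1 := sq_mid_le (fnorm_ge0 T_sub fm) (fnorm_mid ff fg).
have h2 := wsum_mid_le (bounded_rsemi ff) (bounded_rsemi fg) (bounded_rsemi fm)
  (fun m => sq_mid_le (rsemi_ge0 m fm) (rsemi_mid m ff fg)).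
have h3 : wsum (fun m => esemi (midf f g) m ^+ 2) +
    wsum (fun m => ((esemi f m - esemi g m) / 2) ^+ 2) <=
    (wsum (fun m => esemi f m ^+ 2) + wsum (fun m => esemi g m ^+ 2)) / 2.
  apply: (wsum_mid_le (bounded_esemi ff) (bounded_esemi fg) (bounded_esemi fm)) => m.
  by rewrite esemi_mid !expr2; lra.
by rewrite /theta; lra.
Qed.

(** The defects of the three parts are nonnegative, so each is below the total. Because of the
    weights the control is not uniform in [m]. *)
Lemma theta_gap f g (D : R) : functional T f -> functional T g ->
  (theta f + theta g) / 2 - theta (midf f g) <= D ->
  [/\ ((fnorm T f - fnorm T g) / 2) ^+ 2 <= D,
      forall m, ((rsemi f m - rsemi g m) / 2) ^+ 2 / 2 ^+ m.+1 <= D &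
      forall m, ((esemi f m - esemi g m) / 2) ^+ 2 / 2 ^+ m.+1 <= D].
Proof.
move=> ff fg hD; have := theta_mid ff fg.
have br := bounded_half_diff (bounded_rsemi ff) (bounded_rsemi fg).
have be := bounded_half_diff (bounded_esemi ff) (bounded_esemi fg).
have r0 := wsum_ge0 br (fun m => sqr_ge0 _).
have e0 := wsum_ge0 be (fun m => sqr_ge0 _).
have d0 := sqr_ge0 ((fnorm T f - fnorm T g) / 2).
move=> h; split=> [|m|m]; first by move: h r0 e0; lra.
  have := wsum_term_le m br (fun m => sqr_ge0 _); lra.
have := wsum_term_le m be (fun m => sqr_ge0 _); lra.
Qed.

Lemma theta_lsc (U : set_system nat) {UU : UltraFilter U} (fn : nat -> E -> R) f
    (B : R) (c : nat -> R) (cl : R) :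
  (forall n, functional T (fn n)) -> (forall n, fnorm T (fn n) <= B) ->
  functional T f -> (forall y, T y -> (fun n => fn n y) @ U --> f y) ->
  (forall n, theta (fn n) <= c n) -> c @ U --> cl -> theta f <= cl.
Proof.
move=> ffn fnB ff cf tc ccl.
(* A dual norm is a supremum of evaluations, hence lower semicontinuous; this also serves the
   seminorms, since a residual depends linearly on the functional. *)
have dlsc (hn : nat -> E -> R) (h : E -> R) (l : R) : (forall n, functional T (hn n)) ->
    functional T h -> (forall y, T y -> (fun n => hn n y) @ U --> h y) ->
    (fun n => fnorm T (hn n)) @ U --> l -> fnorm T h <= l.
  move=> fhn fh ch cl'.
  have l0 : 0 <= l.
    by apply: (cvg_ler (cvg_cst 0) cl') => n; exact: fnorm_ge0.
  apply: fnorm_le => // y Ty.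
  have c1 : (fun n => `|hn n y|) @ U --> `|h y| by apply: cvg_norm; exact: ch.
  have c2 : (fun n => fnorm T (hn n) * `|y|) @ U --> l * `|y|.
    by apply: cvgM => //; exact: cvg_cst.
  by apply: (cvg_ler c1 c2) => n; exact: le_fnorm.
have [a aE] : exists l : R, (fun n => fnorm T (fn n)) @ U --> l.
  by apply: (ultra_cvg (B := B)) => n; rewrite ger0_norm// fnorm_ge0.
have /choice[rho rhoE] : forall m, exists l : R, (fun n => rsemi (fn n) m) @ U --> l.
  move=> m; apply: (ultra_cvg (B := B)) => n.
  by rewrite ger0_norm ?rsemi_ge0//; apply: (le_trans (rsemi_le _ _)).
have ha : fnorm T f <= a by exact: (dlsc fn).
have hr m : rsemi f m <= rho m.
  rewrite ler_pdivrMr ?resid_scale_gt0//.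
  apply: (dlsc (fun n => resid (fn n) m)).
  - by move=> n; exact: resid_functional.
  - exact: resid_functional.
  - move=> y Ty; apply: cvgD; first by apply: cvgM; [exact: cvg_cst|exact: cf].
    by apply: cvgM; [apply: cvgN; exact: cf|exact: cvg_cst].
  - have -> : (fun n => fnorm T (resid (fn n) m)) =
        (fun n => rsemi (fn n) m * resid_scale m).
      by apply/funext => n; rewrite /rsemi divfK// gt_eqF// resid_scale_gt0.
    by apply: cvgM => //; exact: cvg_cst.
have he m : (fun n => esemi (fn n) m) @ U --> esemi f m.
  by apply: cvgM; [exact: cf|exact: cvg_cst].
have sqc (x : nat -> R) (l : R) : x @ U --> l -> (fun n => x n ^+ 2) @ U --> l ^+ 2.
  by move=> xl; apply: cvgM.
(* Limits are taken in finite partial sums only; the suprema over [N] and [N'] follow afterwards. *)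
have part N N' : fnorm T f ^+ 2 + wseries (fun m => rsemi f m ^+ 2) N +
    wseries (fun m => esemi f m ^+ 2) N' <= cl.
  apply: (@le_trans _ _ (a ^+ 2 + wseries (fun m => rho m ^+ 2) N +
      wseries (fun m => esemi f m ^+ 2) N')).
    rewrite lerD2r; apply: lerD.
      by apply: lerXn2r; rewrite ?nnegrE ?fnorm_ge0//; apply: le_trans ha; exact: fnorm_ge0.
    apply: ler_sum => m _; apply: ler_wpM2r; first by rewrite invr_ge0 exprn_ge0.
    by apply: lerXn2r; rewrite ?nnegrE ?rsemi_ge0//; apply: le_trans (hr m); exact: rsemi_ge0.
  have c1 : (fun n => fnorm T (fn n) ^+ 2 + wseries (fun m => rsemi (fn n) m ^+ 2) N +
      wseries (fun m => esemi (fn n) m ^+ 2) N') @ U -->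
      a ^+ 2 + wseries (fun m => rho m ^+ 2) N + wseries (fun m => esemi f m ^+ 2) N'.
    apply: cvgD; [apply: cvgD; first exact: sqc|].
      by apply: cvg_wseries => j; exact: sqc.
    by apply: cvg_wseries => j; exact: sqc.
  apply: (cvg_ler c1 ccl) => n; apply: le_trans (tc n); rewrite /theta.
  by apply: lerD; [rewrite lerD2l|]; apply: wseries_le_wsum => //;
    [exact: bounded_rsemi|move=> j; exact: sqr_ge0|exact: bounded_esemi|move=> j; exact: sqr_ge0].
have part2 N : wsum (fun m => rsemi f m ^+ 2) <=
    cl - fnorm T f ^+ 2 - wseries (fun m => esemi f m ^+ 2) N.
  by apply: wsum_le_of_wseries; [exact: bounded_rsemi|move=> n; have := part n N; lra].
have : wsum (fun m => esemi f m ^+ 2) <=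
    cl - fnorm T f ^+ 2 - wsum (fun m => rsemi f m ^+ 2).
  by apply: wsum_le_of_wseries; [exact: bounded_esemi|move=> n; have := part2 n; lra].
by rewrite /theta; lra.
Qed.

End RotundPenalty.

(** * Penalized suprema of functionals: attainment and smoothness *)

Section Envelope.
Context {R : realType} {E : normedModType R}.
Variables (T : set E) (ys : nat -> E) (phis : nat -> E -> R).
Implicit Types f g : E -> R.
Hypothesis T_sub : closed_subspace T.
Hypothesis ys_T : forall n, T (ys n).
Hypothesis phis_fun : forall n, functional T (phis n).
Hypothesis ys_dense : T `<=` closure (range ys).
Hypothesis phis_dense : forall f, functional T f -> forall eps : R, 0 < eps ->
  exists n, forall y, T y -> `|f y - phis n y| <= eps * `|y|.
Variables (C : set (E -> R)) (k : R).
Hypothesis k_gt0 : 0 < k.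
Hypothesis C_fun : forall f, C f -> functional T f.
Hypothesis C_nonempty : C !=set0.
Hypothesis C_mid : forall f g, C f -> C g -> C (midf f g).
Hypothesis C_closed : forall (U : set_system nat), UltraFilter U ->
  forall (fn : nat -> E -> R) f, (forall n, C (fn n)) -> functional T f ->
  (forall y, T y -> (fun n => fn n y) @ U --> f y) -> C f.

Let k4_gt0 : 0 < 4 * k. Proof. by rewrite mulr_gt0. Qed.
Let k2_gt0 : 0 < 2 * k. Proof. by rewrite mulr_gt0. Qed.

Local Notation theta := (theta T ys phis).

Definition pvalue f (x : E) : R := f x - k * theta f.
(** The convex conjugate of [k * theta] restricted to [C]: rotundity of [theta] becomes smoothness
    of [env]. *)
Definition env (x : E) : R := sup [set pvalue f x | f in C].

Lemma pvalue_le f x : functional T f -> T x -> pvalue f x <= `|x| ^+ 2 / (4 * k).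
Proof.
move=> ff Tx; rewrite ler_pdivlMr//.
have h1 := le_fnorm T_sub ff Tx.
have h2 := theta_ge T_sub ys_T phis_fun ff.
have h3 := ler_norm (f x).
have h4 := sqr_ge0 (2 * k * fnorm T f - `|x|).
have h5 : pvalue f x <= fnorm T f * `|x| - k * fnorm T f ^+ 2.
  have : k * fnorm T f ^+ 2 <= k * theta f by rewrite ler_pM2l.
  by rewrite /pvalue; lra.
have : pvalue f x * (4 * k) <= (fnorm T f * `|x| - k * fnorm T f ^+ 2) * (4 * k).
  by apply: ler_wpM2r => //; exact: ltW.
by move: h4; rewrite !expr2; lra.
Qed.

Let env_set0 x : [set pvalue f x | f in C] !=set0.
Proof. by have [f Cf] := C_nonempty; exists (pvalue f x), f. Qed.

Let env_ub x r : T x -> [set pvalue f x | f in C] r -> r <= `|x| ^+ 2 / (4 * k).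
Proof. by move=> Tx [f Cf <-]; apply: pvalue_le => //; exact: C_fun. Qed.

Lemma le_env f x : C f -> T x -> pvalue f x <= env x.
Proof. by move=> Cf Tx; apply: (le_sup_mem (fun r => @env_ub x r Tx)); exists f. Qed.

Lemma env_approx x (tau : R) : T x -> 0 < tau ->
  exists2 f, C f & env x - tau < pvalue f x.
Proof.
move=> Tx t0; have [_ [f Cf <-] h] := sup_approx (env_set0 x) (fun r => @env_ub x r Tx) t0.
by exists f.
Qed.

Lemma env_le x (c : R) : (forall f, C f -> pvalue f x <= c) -> env x <= c.
Proof. by move=> h; apply: ge_sup => // _ [f Cf <-]; exact: h. Qed.

Lemma env_convex x y (t : R) : T x -> T y -> 0 <= t -> t <= 1 ->
  env (t *: x + (1 - t) *: y) <= t * env x + (1 - t) * env y.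
Proof.
move=> Tx Ty t0 t1; apply: env_le => f Cf.
have ff := C_fun Cf.
rewrite /pvalue (functionalD ff); try exact: subspaceZ.
rewrite !(functionalZ T_sub)//.
have h1 : t * pvalue f x <= t * env x by apply: ler_wpM2l => //; exact: le_env.
have h2 : (1 - t) * pvalue f y <= (1 - t) * env y.
  by apply: ler_wpM2l; [lra|exact: le_env].
by move: h1 h2; rewrite /pvalue; lra.
Qed.

(** Coercivity: in the norm of [f], the value [f x] grows at most linearly and [k * theta f] at
    least quadratically. *)
Lemma fnorm_near_max f x (r c : R) : C f -> T x -> `|x| <= r -> 0 <= c ->
  - c <= pvalue f x -> fnorm T f <= 1 + (r + c) / k.
Proof.
move=> Cf Tx xr c0 pc; have ff := C_fun Cf.
have h1 := le_fnorm T_sub ff Tx; have h3 := ler_norm (f x).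
have h2 : k * fnorm T f ^+ 2 <= k * theta f.
  by rewrite ler_pM2l//; exact: theta_ge.
have n0 := fnorm_ge0 T_sub ff.
have r0 : 0 <= r := le_trans (normr_ge0 x) xr.
have rk : 0 <= (r + c) / k by apply: divr_ge0; [exact: addr_ge0|exact: ltW].
have [|n1] := leP (fnorm T f) 1; first by lra.
apply: (@le_trans _ _ ((r + c) / k)); last by lra.
rewrite ler_pdivlMr//.
have h4 : k * fnorm T f ^+ 2 <= fnorm T f * r + c.
  have : fnorm T f * `|x| <= fnorm T f * r by apply: ler_wpM2l.
  by move: pc; rewrite /pvalue; lra.
have : fnorm T f * (fnorm T f * k) <= fnorm T f * (r + c).
  have : c <= fnorm T f * c by rewrite ler_peMl// ltW.
  by move: h4; rewrite expr2; lra.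
by rewrite ler_pM2l//; lra.
Qed.

(** A maximizing sequence is bounded, its ultralimit stays in [C], and [theta] is lower
    semicontinuous. *)
Lemma env_attained x : T x -> exists2 f, C f & pvalue f x = env x.
Proof.
move=> Tx.
have /choice[fn fnP] : forall n : nat, exists f, C f /\ env x - (n.+1%:R)^-1 < pvalue f x.
  move=> n; have [|f] := @env_approx x ((n.+1%:R)^-1) Tx; first by rewrite invr_gt0.
  by exists f.
have inv1 (n : nat) : (n.+1%:R : R)^-1 <= 1 by rewrite invf_le1// ler1n.
pose c := 1 + `|env x|.
have c0 : 0 <= c by rewrite addr_ge0.
pose B := 1 + (`|x| + c) / k.
have fnB n : fnorm T (fn n) <= B.
  apply: (fnorm_near_max (fnP n).1 Tx (lexx _) c0).
  have := (fnP n).2; have := inv1 n; have := ler_norm (- env x); rewrite normrN /c.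
  by move: (_^-1) => i; lra.
have ffn n := C_fun (fnP n).1.
have [U [UU ooU]] := free_ultrafilter.
have /choice[f fP] : forall y, exists l : R, T y -> (fun n => fn n y) @ U --> l.
  move=> y; have [Ty|nTy] := pselect (T y); last by exists 0.
  have [l lE] : exists l : R, (fun n => fn n y) @ U --> l.
    apply: (ultra_cvg (B := B * `|y|)) => n.
    by apply: (le_trans (le_fnorm T_sub (ffn n) Ty)); exact: ler_wpM2r.
  by exists l.
have [ff _] := functional_cvg T_sub ffn fnB fP.
have Cf : C f by apply: (C_closed UU (fun n => (fnP n).1) ff fP).
exists f => //; apply/eqP; rewrite eq_le le_env//=.
have cinv : (fun n : nat => (n.+1%:R : R)^-1) @ U --> (0 : R).
  by apply: cvg_trans (@cvg_harmonic R); exact: cvg_app.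
have ccl : (fun n => (fn n x - env x + (n.+1%:R)^-1) / k) @ U --> (f x - env x + 0) / k.
  apply: cvgM; last exact: cvg_cst.
  by apply: cvgD => //; apply: cvgB; [exact: fP|exact: cvg_cst].
have : theta f <= (f x - env x + 0) / k.
  apply: (theta_lsc T_sub ys_T phis_fun ffn fnB ff fP _ ccl) => n.
  rewrite ler_pdivlMr//; have := (fnP n).2; rewrite /pvalue.
  by move: (_^-1) => i; lra.
by rewrite ler_pdivlMr// /pvalue; lra.
Qed.

Lemma sq_half_le (a b tau : R) : 0 <= tau ->
  ((a - b) / 2) ^+ 2 <= (tau / 2) ^+ 2 -> `|a - b| <= tau.
Proof.
move=> t0; rewrite -[X in X <= _ -> _]real_normK ?num_real// => h.
have : `|(a - b) / 2| <= tau / 2.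
  by rewrite -(@ler_pXn2r _ 2)// ?nnegrE//; lra.
by rewrite normrM [`|2^-1|]ger0_norm ?invr_ge0//; lra.
Qed.

(** The midpoint competes in the supremum and the linear parts cancel; what remains is the midpoint
    defect of [theta]. *)
Lemma near_max_gap f g x (eta : R) : C f -> C g -> T x ->
  pvalue f x = env x -> env x - eta <= pvalue g x ->
  (theta g + theta f) / 2 - theta (midf g f) <= eta / (2 * k).
Proof.
move=> Cf Cg Tx fm gm.
have h := le_env (C_mid Cg Cf) Tx.
rewrite ler_pdivlMr//.
by move: h fm gm; rewrite /pvalue /midf; lra.
Qed.

(** If [f (ys i)] is close to 1 and [phis j] close to [f], the residual of [f] is small. Rotundity
    transfers this to a near-maximizer [g] and brings [g (ys i)] close to [f (ys i)], so [g] is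
    close to [g (ys i) * phis j] and hence to [f]. *)
Lemma near_max_close f x : C f -> T x -> pvalue f x = env x ->
  forall (eps : R), 0 < eps -> exists2 eta : R, 0 < eta &
    forall g, C g -> env x - eta <= pvalue g x ->
      forall u, T u -> `|g u - f u| <= eps * `|u|.
Proof.
move=> Cf Tx fm eps e0; have ff := C_fun Cf.
have ctl (tau : R) (m : nat) : 0 < tau -> exists2 eta : R, 0 < eta &
    forall g, C g -> env x - eta <= pvalue g x ->
    [/\ `|fnorm T g - fnorm T f| <= tau,
        `|rsemi T ys phis g m - rsemi T ys phis f m| <= tau &
        `|esemi ys g m - esemi ys f m| <= tau].
  move=> t0; pose eta := 2 * k * ((tau / 2) ^+ 2 / 2 ^+ m.+1).
  have p2 : 1 <= 2 ^+ m.+1 :> R by rewrite exprn_ege1// ler1n.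
  have p0 : 0 < 2 ^+ m.+1 :> R by exact: lt_le_trans ltr01 p2.
  have t2 : 0 < (tau / 2) ^+ 2 by rewrite exprn_gt0//; lra.
  have q0 : 0 < (tau / 2) ^+ 2 / 2 ^+ m.+1 by rewrite divr_gt0.
  exists eta; first by rewrite /eta mulr_gt0.
  move=> g Cg gm; have fg := C_fun Cg.
  have := near_max_gap Cf Cg Tx fm gm.
  have -> : eta / (2 * k) = (tau / 2) ^+ 2 / 2 ^+ m.+1.
    rewrite /eta mulrAC divff ?mul1r//; exact: lt0r_neq0.
  move=> /(theta_gap T_sub ys_T phis_fun fg ff)[h1 h2 h3].
  split; apply: (sq_half_le (ltW t0)).
  - by apply: (le_trans h1); rewrite ler_pdivrMr// ler_peMr//; exact: ltW.
  - by have := h2 m; rewrite ler_pM2r// invr_gt0.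
  - by have := h3 m; rewrite ler_pM2r// invr_gt0.
(* If [f] is small in norm, so are its near-maximizers. This covers [f] vanishing on [T], where no
   point has value 1. *)
have [small|big] := leP (fnorm T f) (eps / 4).
  have [|eta et0 etaP] := ctl (eps / 4) 0%N; first by lra.
  exists eta => // g Cg gm u Tu; have [h _ _] := etaP g Cg gm.
  have fg := C_fun Cg.
  apply: (le_trans (ler_normB _ _)).
  have h1 := le_fnorm T_sub ff Tu; have h2 := le_fnorm T_sub fg Tu.
  apply: (@le_trans _ _ ((fnorm T g + fnorm T f) * `|u|)); first by lra.
  apply: ler_wpM2r => //; move: h; rewrite ler_norml => /andP[]; lra.
have [y0 [Ty0 fy0]] : exists y, T y /\ f y = 1.
  have [[y [Ty fy]]|n] := pselect (exists y, T y /\ f y != 0).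
    exists ((f y)^-1 *: y); split; first exact: subspaceZ.
    by rewrite (functionalZ T_sub)// mulVf.
  suff : fnorm T f <= 0 by lra.
  apply: fnorm_le => // y Ty; rewrite mul0r.
  have [->|fy] := eqVneq (f y) 0; first by rewrite normr0.
  by exfalso; apply: n; exists y.
have N0 := fnorm_ge0 T_sub ff; set N := fnorm T f in N0 big *.
have N1 : 0 < 1 + N by lra.
(* Error budget for the residual of [f]: [eps / 8] from [1 - f (ys i)] and, as |f (ys i)| is at most
   2, another [eps / 8] from [f - phis j]. *)
pose rho := Num.min 1 (eps / 8 / (1 + N)).
have rho0 : 0 < rho by rewrite lt_min ltr01 divr_gt0//; lra.
have [_ [i _ <-] yi] := (closure_normP _ _).1 (ys_dense Ty0) _ (divr_gt0 rho0 N1).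
have fyi : `|1 - f (ys i)| <= rho.
  rewrite -fy0 -(functionalB T_sub ff)//.
  apply: (le_trans (le_fnorm T_sub ff (subspaceB T_sub Ty0 (ys_T i)))).
  rewrite -/N; apply: (@le_trans _ _ (`|y0 - ys i| * (1 + N))).
    by rewrite mulrC; apply: ler_wpM2l => //; lra.
  by rewrite -ler_pdivlMr// ltW.
have [|j phij] := phis_dense ff (_ : 0 < eps / 16); first by lra.
pose m := pickle (i, j).
have rE g y : resid ys phis g m y = g y - g (ys i) * phis j y.
  by rewrite /resid /m pickleK /= mul1r mulNr.
have sE : resid_scale T ys phis m = 1 + `|ys i| * fnorm T (phis j).
  by rewrite /resid_scale /m pickleK.
have s0 := resid_scale_gt0 ys T_sub phis_fun m.
set S := resid_scale T ys phis m in sE s0.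
have resf : fnorm T (resid ys phis f m) <= eps / 4.
  apply: (fnorm_le T_sub); first by lra.
  move=> y Ty; rewrite rE.
  have -> : f y - f (ys i) * phis j y =
      (1 - f (ys i)) * f y + f (ys i) * (f y - phis j y) by ring.
  apply: (le_trans (ler_normD _ _)); rewrite !normrM.
  have h1 : `|1 - f (ys i)| * `|f y| <= eps / 8 * `|y|.
    apply: (@le_trans _ _ (eps / 8 / (1 + N) * (N * `|y|))).
      apply: ler_pM => //; first by apply: (le_trans fyi); rewrite /rho ge_min lexx orbT.
      exact: le_fnorm.
    rewrite mulrA; apply: ler_wpM2r => //.
    by rewrite mulrAC ler_pdivrMr// ler_pM2l//; lra.
  have h2 : `|f (ys i)| <= 2.
    have : `|1 - f (ys i)| <= 1 by apply: (le_trans fyi); rewrite /rho ge_min lexx.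
    by rewrite !ler_norml => /andP[a b]; apply/andP; split; lra.
  have h3 : `|f (ys i)| * `|f y - phis j y| <= 2 * (eps / 16 * `|y|).
    by apply: ler_pM => //; exact: phij.
  lra.
have NP := fnorm_ge0 T_sub (phis_fun j).
(* Each bound costs [eps / 4]: one for the residual of [g] against that of [f], one for
   [(g (ys i) - f (ys i)) * phis j]. *)
pose tau := Num.min (eps / 4 / S) (eps / 4 / ((1 + `|ys i|) * (1 + fnorm T (phis j)))).
have yp : 0 < (1 + `|ys i|) * (1 + fnorm T (phis j)).
  by apply: mulr_gt0; [rewrite ltr_wpDr|rewrite ltr_wpDr].
have tau0 : 0 < tau by rewrite lt_min !divr_gt0//; lra.
have [eta1 et1 eta1P] := ctl tau m tau0.
have [eta2 et2 eta2P] := ctl tau i tau0.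
exists (Num.min eta1 eta2); first by rewrite lt_min et1.
move=> g Cg gm u Tu; have fg := C_fun Cg.
have [_ hr _] : [/\ `|fnorm T g - fnorm T f| <= tau,
        `|rsemi T ys phis g m - rsemi T ys phis f m| <= tau &
        `|esemi ys g m - esemi ys f m| <= tau].
  apply: eta1P => //; apply: le_trans gm; rewrite lerD2l lerN2.
  by rewrite ge_min lexx.
have [_ _ he] : [/\ `|fnorm T g - fnorm T f| <= tau,
        `|rsemi T ys phis g i - rsemi T ys phis f i| <= tau &
        `|esemi ys g i - esemi ys f i| <= tau].
  apply: eta2P => //; apply: le_trans gm; rewrite lerD2l lerN2.
  by rewrite ge_min lexx orbT.
have resg : fnorm T (resid ys phis g m) <= eps / 2.
  have : fnorm T (resid ys phis g m) / S <= fnorm T (resid ys phis f m) / S + eps / 4 / S.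
    have : tau <= eps / 4 / S by rewrite /tau ge_min lexx.
    move: hr; rewrite /rsemi -/S ler_norml => /andP[_].
    by move: (_ / S) (_ / S) (_ / S) => p q r; lra.
  rewrite -mulrDl ler_pM2r ?invr_gt0//; lra.
have gi : `|g (ys i) - f (ys i)| * fnorm T (phis j) <= eps / 4.
  have y1 : 0 < 1 + `|ys i| by rewrite ltr_wpDr.
  move: he; rewrite /esemi -mulrBl normrM normfV (gtr0_norm y1) ler_pdivrMr// => he.
  apply: (@le_trans _ _ ((tau * (1 + `|ys i|)) * (1 + fnorm T (phis j)))).
    by apply: ler_pM => //; lra.
  rewrite -mulrA -ler_pdivlMr//; by rewrite /tau ge_min lexx orbT.
have -> : g u - f u = resid ys phis g m u - resid ys phis f m u +
    (g (ys i) - f (ys i)) * phis j u by rewrite !rE; ring.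
apply: (le_trans (ler_normD _ _)).
have k1 := le_fnorm T_sub (resid_functional ys phis_fun m fg) Tu.
have k2 := le_fnorm T_sub (resid_functional ys phis_fun m ff) Tu.
have k3 : `|(g (ys i) - f (ys i)) * phis j u| <= eps / 4 * `|u|.
  rewrite normrM; apply: (@le_trans _ _ (`|g (ys i) - f (ys i)| * (fnorm T (phis j) * `|u|))).
    by apply: ler_wpM2l => //; exact: le_fnorm.
  by rewrite mulrA; apply: ler_wpM2r.
have k4 := ler_normB (resid ys phis g m u) (resid ys phis f m u).
have k5 : fnorm T (resid ys phis g m) * `|u| <= eps / 2 * `|u| by exact: ler_wpM2r.
have k6 : fnorm T (resid ys phis f m) * `|u| <= eps / 4 * `|u| by exact: ler_wpM2r.
lra.
Qed.

(** Smulian's test: near-maximizers at [x + u] and [x - u] are near-maximizers at [x], hence close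
    in norm to the maximizer [f], and the contributions [f u] and [f (- u)] cancel. *)
Lemma env_smooth x : T x -> forall eps : R, 0 < eps -> exists2 delta : R, 0 < delta &
  forall u, T u -> `|u| < delta -> env (x + u) + env (x - u) - 2 * env x <= eps * `|u|.
Proof.
move=> Tx eps e0; have [f Cf fm] := env_attained Tx; have ff := C_fun Cf.
have [|eta et0 etaP] := near_max_close Cf Tx fm (_ : 0 < eps / 4); first by lra.
set N := fnorm T f; have N0 : 0 <= N := fnorm_ge0 T_sub ff.
pose c := N + 1 + `|env x|.
have c0 : 0 <= c by rewrite !addr_ge0.
pose B := 1 + (`|x| + 1 + c) / k.
have B0 : 0 < B.
  by rewrite /B ltr_wpDr//; apply: divr_ge0; [rewrite !addr_ge0|exact: ltW].
have D0 : 0 < N + B + eps by lra.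
(* The first two bounds give the near-maximizers norm at most [B]; the third makes them
   [eta]-maximizers at [x], since the passage between [x] and [x + v] costs at most
   [(N + B + eps) |u|]. *)
pose delta := Num.min (Num.min 1 (1 / eps)) (eta / (N + B + eps)).
exists delta; first by rewrite !lt_min ltr01 !divr_gt0.
move=> u Tu; rewrite !lt_min => /andP[/andP[u1 ueps] uD].
have [->|u0] := eqVneq u 0.
  by rewrite addr0 subr0 normr0 mulr0; lra.
have up : 0 < `|u| by rewrite normr_gt0.
have t0 : 0 < eps * `|u| / 4 by rewrite divr_gt0// mulr_gt0.
have t1 : eps * `|u| < 1 by rewrite mulrC -ltr_pdivlMr.
have tD : `|u| * (N + B + eps) < eta by rewrite -ltr_pdivlMr.
have main v : T v -> `|v| = `|u| -> exists2 g, C g &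
    env (x + v) <= pvalue g x + g v + eps * `|u| / 4 /\ `|g v - f v| <= eps / 4 * `|u|.
  move=> Tv vu; have Txv := subspaceD T_sub Tx Tv.
  have [g Cg gm] := env_approx Txv t0; have fg := C_fun Cg.
  have gE : pvalue g (x + v) = pvalue g x + g v.
    by rewrite /pvalue (functionalD fg)//; ring.
  have low : env x - N * `|u| <= env (x + v).
    apply: le_trans (le_env Cf Txv); rewrite -fm /pvalue (functionalD ff)//.
    have := le_fnorm T_sub ff Tv; rewrite vu -/N ler_norml => /andP[]; lra.
  have Nu : N * `|u| <= N by rewrite ler_piMr// ltW.
  have gB : fnorm T g <= B.
    apply: (fnorm_near_max Cg Txv _ c0); first by apply: (le_trans (ler_normD _ _)); lra.
    have := ler_norm (- env x); rewrite normrN /c; lra.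
  have gv : `|g v| <= B * `|u|.
    by apply: (le_trans (le_fnorm T_sub fg Tv)); rewrite vu; apply: ler_wpM2r.
  have gv' : g v <= B * `|u| := le_trans (ler_norm _) gv.
  exists g => //; split; first by lra.
  rewrite -vu; apply: etaP => //; lra.
have [g1 Cg1 [h1 h2]] := main u Tu erefl.
have [g2 Cg2 [h3 h4]] := main (- u) (subspaceN T_sub Tu) (normrN u).
have e1 := le_env Cg1 Tx; have e2 := le_env Cg2 Tx.
have fN : f (- u) = - f u by rewrite -scaleN1r (functionalZ T_sub)// mulN1r.
rewrite fN in h4.
move: (le_trans (ler_norm _) h2) (le_trans (ler_norm _) h4); lra.
Qed.

End Envelope.

(** * Smooth gauges and smooth approximations of sublinear functions *)

Section SmoothApproximation.
Context {R : realType} {E : normedModType R}.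
Variable (T : set E).
Implicit Types f g : E -> R.
Hypothesis T_sub : closed_subspace T.
Hypothesis T_sep : separable_set T.
Hypothesis T_dual : separable_dual_of T.

Definition convex_on (k : E -> R) : Prop := forall x y (t : R), T x -> T y ->
  0 <= t -> t <= 1 -> k (t *: x + (1 - t) *: y) <= t * k x + (1 - t) * k y.

(** For a continuous convex function this amounts to Frechet differentiability along [T]; second
    differences name no derivative and add up under sums. *)
Definition smooth_at (k : E -> R) (x : E) : Prop := forall eps : R, 0 < eps ->
  exists2 delta : R, 0 < delta & forall u, T u -> `|u| < delta ->
    k (x + u) + k (x - u) - 2 * k x <= eps * `|u|.

Lemma linear_form_functional f (M : R) : linear_form f ->
  (forall y, T y -> f y <= M * `|y|) -> functional T f.
Proof.
move=> lf fM; split; first by move=> a x y _ _; exact: lf.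
exists M => y Ty; rewrite ler_norml fM// andbT lerNl.
by rewrite -(linear_formN _ lf) -normrN; apply: fM; exact: subspaceN.
Qed.

Lemma norm_sublinear : sublinear (fun x : E => `|x|).
Proof.
by split=> [x y|t x t0]; [exact: ler_normD|rewrite normrZ ger0_norm].
Qed.

(** A smooth substitute for the squared norm: the conjugate of [theta] on the whole dual of [T]. The
    factors 1/12 and 1/4 reflect that [theta] lies between one and three times the squared dual
    norm. A maximizer at [x + u] has norm at most |x + u| because [q] is nonnegative, whence the
    third estimate. *)
Lemma smooth_gauge : exists q : E -> R,
  [/\ forall x, T x -> `|x| ^+ 2 / 12 <= q x,
      forall x, T x -> q x <= `|x| ^+ 2 / 4,
      forall x u, T x -> T u -> q (x + u) <= q x + `|x + u| * `|u|,
      convex_on q & forall x, T x -> smooth_at q x].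
Proof.
have [ys [ysT ysd]] := T_sep; have [phis [phisf phisd]] := T_dual.
have phisd' f : functional T f -> forall eps : R, 0 < eps ->
    exists n, forall y, T y -> `|f y - phis n y| <= eps * `|y|.
  by move=> [lf bf]; exact: phisd.
pose C : set (E -> R) := functional T.
have C0 : functional T (fun=> 0 : R).
  split; first by move=> *; rewrite mulr0 addr0.
  by exists 0 => y _; rewrite normr0 mul0r.
have CC f : C f -> functional T f by [].
have Cne : C !=set0 by exists (fun=> 0).
have Cmid f g : C f -> C g -> C (midf f g) by exact: mid_functional.
have Ccl (U : set_system nat) : UltraFilter U -> forall (fn : nat -> E -> R) f,
    (forall n, C (fn n)) -> functional T f ->
    (forall y, T y -> (fun n => fn n y) @ U --> f y) -> C f by [].
pose q := env T ys phis C 1.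
have pvE f x : pvalue T ys phis 1 f x = f x - theta T ys phis f.
  by rewrite /pvalue mul1r.
have q0 x : T x -> 0 <= q x.
  move=> Tx; apply: le_trans (le_env T_sub ysT phisf ltr01 CC C0 Tx); rewrite pvE.
  have n0 : fnorm T (fun=> 0 : R) <= 0.
    by apply: (fnorm_le T_sub) => // y _; rewrite normr0 mul0r.
  have n0' : fnorm T (fun=> 0 : R) = 0.
    by apply/eqP; rewrite eq_le n0 fnorm_ge0.
  have := theta_le T_sub ysT phisf C0; rewrite n0' expr0n/= mulr0; lra.
exists q; split.
- move=> x Tx.
  have [f [lf fle fx]] := hahn_banach_at x norm_sublinear.
  (* This [t] maximizes [t |x| - 3 t^2], with value [|x|^2 / 12]. *)
  pose t := `|x| / 6.
  have t0 : 0 <= t by rewrite divr_ge0.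
  have ltf : linear_form (fun y => t * f y).
    by move=> a y z; rewrite lf; ring.
  have tf : functional T (fun y => t * f y).
    apply: (linear_form_functional ltf (M := t)) => y _; exact: ler_wpM2l.
  have nt : fnorm T (fun y => t * f y) <= t.
    apply: (fnorm_le T_sub) => // y Ty; rewrite normrM (ger0_norm t0).
    apply: ler_wpM2l => //; rewrite ler_norml fle andbT lerNl.
    by rewrite -(linear_formN _ lf) -normrN; exact: fle.
  apply: le_trans (le_env T_sub ysT phisf ltr01 CC tf Tx); rewrite pvE fx.
  have h1 := theta_le T_sub ysT phisf tf.
  have h2 : fnorm T (fun y => t * f y) ^+ 2 <= t ^+ 2.
    by apply: lerXn2r; rewrite ?nnegrE ?fnorm_ge0.
  have h3 : theta T ys phis (fun y => t * f y) <= 3 * t ^+ 2 by lra.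
  apply: le_trans (lerD (lexx _) (_ : - (3 * t ^+ 2) <= _)); last by rewrite lerN2.
  by rewrite /t !expr2; lra.
- move=> x Tx; apply: env_le => // f Cf.
  have := pvalue_le T_sub ysT phisf ltr01 (CC _ Cf) Tx; by rewrite mulr1.
- move=> x u Tx Tu; have Txu := subspaceD T_sub Tx Tu.
  have [f Cf fm] := env_attained T_sub ysT phisf ltr01 CC Cne Ccl Txu.
  have ff := CC _ Cf.
  have h1 := le_env T_sub ysT phisf ltr01 CC Cf Tx.
  have h2 := q0 _ Txu; have h3 := theta_ge T_sub ysT phisf ff.
  have h4 := le_fnorm T_sub ff Txu; have h5 := ler_norm (f (x + u)).
  have h6 := le_fnorm T_sub ff Tu; have h7 := ler_norm (f u).
  have n0 := fnorm_ge0 T_sub ff.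
  have nb : fnorm T f <= `|x + u|.
    have [|np] := leP (fnorm T f) 0; first by move=> h; exact: le_trans h (normr_ge0 _).
    rewrite -(@ler_pM2l _ (fnorm T f))// -expr2.
    by move: fm h2; rewrite /q => <-; rewrite pvE; lra.
  have : fnorm T f * `|u| <= `|x + u| * `|u| by apply: ler_wpM2r.
  move: h1 fm; rewrite /q => h1 <-; move: h1.
  by rewrite !pvE (functionalD ff Tx Tu) -/C; lra.
- by move=> x y t Tx Ty t0 t1; apply: env_convex.
- by move=> x Tx; apply: env_smooth.
Qed.

(** By Hahn-Banach [s] is the supremum of the functionals it dominates, all of norm at most [M]; on
    these the penalty with factor [k = eta / (3 M^2)] stays between 0 and [eta]. Since each
    competitor is below [s], so are the increments of the supremum. *)
Lemma smooth_approx (s : E -> R) (C eta : R) : sublinear s ->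
  (forall x, s x <= C * `|x|) -> 0 < eta -> exists sig : E -> R,
  [/\ forall x, T x -> s x - eta <= sig x <= s x,
      forall x u, T x -> T u -> sig (x + u) <= sig x + s u,
      convex_on sig & forall x, T x -> smooth_at sig x].
Proof.
move=> ssub sC eta0.
have [ys [ysT ysd]] := T_sep; have [phis [phisf phisd]] := T_dual.
have phisd' f : functional T f -> forall eps : R, 0 < eps ->
    exists n, forall y, T y -> `|f y - phis n y| <= eps * `|y|.
  by move=> [lf bf]; exact: phisd.
pose D : set (E -> R) := fun f => functional T f /\ forall y, T y -> f y <= s y.
have HB x : exists2 f, D f & f x = s x.
  have [f [lf fs fx]] := hahn_banach_at x ssub; exists f => //; split => //.
  by apply: (linear_form_functional lf (M := C)) => y _; exact: le_trans (fs y) (sC y).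
have DC f : D f -> functional T f by case.
have Dne : D !=set0 by have [f Df _] := HB 0; exists f.
have Dmid f g : D f -> D g -> D (midf f g).
  move=> [ff fs] [fg gs]; split; first exact: mid_functional.
  by move=> y Ty; have := fs y Ty; have := gs y Ty; rewrite /midf; lra.
have Dcl (U : set_system nat) : UltraFilter U -> forall (fn : nat -> E -> R) f,
    (forall n, D (fn n)) -> functional T f ->
    (forall y, T y -> (fun n => fn n y) @ U --> f y) -> D f.
  move=> UU fn f Dfn ff cf; split=> // y Ty.
  by apply: (cvg_ler (cf y Ty) (cvg_cst (s y))) => n; exact: (Dfn n).2.
pose M := 1 + `|C|.
have M0 : 0 < M by rewrite ltr_wpDr.
have CM x : s x <= M * `|x|.
  apply: (le_trans (sC x)); apply: ler_wpM2r => //.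
  by apply: (le_trans (ler_norm C)); rewrite lerDr.
have DM f : D f -> fnorm T f <= M.
  move=> [ff fs]; apply: (fnorm_le T_sub) => [|y Ty]; first exact: ltW.
  rewrite ler_norml (le_trans (fs y Ty) (CM y)) andbT lerNl.
  have -> : - f y = f (- y) by rewrite -[- y]scaleN1r (functionalZ T_sub)// mulN1r.
  by rewrite -normrN; apply: le_trans (fs _ (subspaceN T_sub Ty)) (CM _).
have M3 : 0 < 3 * M ^+ 2 by rewrite mulr_gt0// exprn_gt0.
pose k := eta / (3 * M ^+ 2).
have k0 : 0 < k by rewrite divr_gt0.
have th0 f : D f -> 0 <= k * theta T ys phis f <= eta.
  move=> Df; have ff := DC _ Df; apply/andP; split.
    by apply: mulr_ge0 (ltW k0) (le_trans (sqr_ge0 _) (theta_ge T_sub ysT phisf ff)).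
  apply: (@le_trans _ _ (k * (3 * M ^+ 2))); last by rewrite /k divfK// gt_eqF.
  rewrite ler_pM2l//; apply: (le_trans (theta_le T_sub ysT phisf ff)).
  by rewrite ler_pM2l//; apply: lerXn2r; rewrite ?nnegrE ?fnorm_ge0//; [exact: ltW|exact: DM].
exists (env T ys phis D k); split.
- move=> x Tx; apply/andP; split.
    have [f Df <-] := HB x.
    apply: le_trans (le_env T_sub ysT phisf k0 DC Df Tx).
    by rewrite /pvalue lerD2l lerN2; have /andP[] := th0 f Df.
  apply: env_le => // f Df; have /andP[h _] := th0 f Df.
  by have := Df.2 x Tx; rewrite /pvalue; lra.
- move=> x u Tx Tu; apply: env_le => // f Df.
  have := le_env T_sub ysT phisf k0 DC Df Tx; have := Df.2 u Tu.
  by rewrite /pvalue (functionalD Df.1 Tx Tu); lra.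
- by move=> x y t Tx Ty t0 t1; apply: env_convex.
- by move=> x Tx; apply: env_smooth.
Qed.

End SmoothApproximation.

(** * A smooth variational principle and approximate normals at a minimizer *)

Section BorweinPreiss.
Context {R : realType} {E : normedModType R}.

(** Completeness as a predicate on normed modules, so that it passes to products by a lemma. *)
Definition seq_complete (V : normedModType R) : Prop :=
  forall u : nat -> V,
  (forall eps : R, 0 < eps -> exists N : nat, forall m n, (N <= m)%N -> (N <= n)%N ->
     `|u m - u n| <= eps) -> exists l : V, u @ \oo --> l.

Lemma cvg_seqP (V : normedModType R) (u : nat -> V) (l : V) :
  u @ \oo --> l <-> forall eps : R, 0 < eps ->
    exists N : nat, forall n, (N <= n)%N -> `|u n - l| <= eps.
Proof.
split=> [/cvgrPdist_le h eps e0|h].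
  have [N _ NP] := h _ e0; exists N => n Nn; rewrite distrC; exact: NP.
apply/cvgrPdist_le => eps e0; have [N NP] := h _ e0.
by exists N => // n /= Nn; rewrite distrC; exact: NP.
Qed.

Hypothesis E_complete : seq_complete E.
Variables (M : set E) (k0 q : E -> R) (z0 : E) (r Ck : R).
Hypothesis r_gt0 : 0 < r.
Hypothesis M_closed : closed M.
Hypothesis M_z0 : M z0.
Hypothesis Ck_ge0 : 0 <= Ck.
Hypothesis k0_lip : forall y z, M y -> M z -> k0 z <= k0 y + Ck * `|y - z|.
Hypothesis k0_lb : forall y, M y -> - (r ^+ 2 / 24) <= k0 y.
Hypothesis k0_z0 : k0 z0 <= 0.
Hypothesis q_lb : forall y z, M y -> M z -> `|y - z| ^+ 2 / 12 <= q (y - z).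
Hypothesis q_ub : forall y z, M y -> M z -> q (y - z) <= `|y - z| ^+ 2 / 4.
Hypothesis q_lip : forall y z w, M y -> M z -> M w ->
  q (z - w) <= q (y - w) + `|z - w| * `|z - y|.

(** The decay by 8 beats the weight [1/2^(i+1)] of the new penalty: as [q] is at least |.|^2 / 12,
    accuracy [eta n] yields steps of length at most [r / 2^n]. *)
Let eta (i : nat) : R := r ^+ 2 / 24 / 8 ^+ i.

Let eta_gt0 i : 0 < eta i.
Proof. by rewrite /eta !divr_gt0// exprn_gt0. Qed.

Let step_ex : forall t : nat * (E -> R) * E, exists z' : E,
  M t.2 -> (forall y, M y -> - (r ^+ 2 / 24) <= t.1.2 y) ->
  [/\ M z', t.1.2 z' <= t.1.2 t.2 & forall e, M e -> t.1.2 z' <= t.1.2 e + eta t.1.1].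
Proof.
move=> [[i Phi] z] /=.
have [[Mz lb]|n] := pselect (M z /\ forall y, M y -> - (r ^+ 2 / 24) <= Phi y);
  last by exists z => Mz lb; exfalso; apply: n.
pose A := [set Phi y | y in M].
have lbA x : A x -> - (r ^+ 2 / 24) <= x by move=> [y My <-]; exact: lb.
have A0 : A !=set0 by exists (Phi z), z.
have [_ [w Mw <-] wi] := inf_approx A0 lbA (eta_gt0 i).
have wP e : M e -> Phi w <= Phi e + eta i.
  move=> Me; have : inf A <= Phi e by apply: (inf_le_mem lbA); exists e.
  lra.
have [wz|zw] := leP (Phi w) (Phi z); first by exists w.
by exists z => _ _; split=> // e Me; apply: (le_trans (ltW zw)); exact: wP.
Qed.

(** Each [zs n.+1] nearly minimizes the function penalizing the earlier points, without exceeding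
    its value at [zs n], where the newest penalty vanishes. The steps are geometric, and the limit
    is an exact minimizer because the accuracy [eta n] tends to 0. *)
Lemma borwein_preiss : exists (zs : nat -> E) (ehat : E),
  [/\ forall n, M (zs n), M ehat, zs 0%N = z0, forall n, `|ehat - zs n| <= 2 * r &
      forall e, M e -> k0 ehat + wsum (fun j => q (ehat - zs j)) <=
                       k0 e + wsum (fun j => q (e - zs j))].
Proof.
have q_ge0 y z : M y -> M z -> 0 <= q (y - z).
  by move=> My Mz; apply: le_trans (q_lb My Mz); rewrite divr_ge0// sqr_ge0.
have [pick pickP] := choice step_ex.
pose upd (i : nat) (Phi : E -> R) (z : E) : E -> R :=
  fun y => Phi y + q (y - z) / 2 ^+ i.+1.
pose st := fix st n : (E -> R) * E := if n is i.+1 then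
  let Phi' := upd i (st i).1 (st i).2 in (Phi', pick (i.+1, Phi', (st i).2))
  else (k0, z0).
pose zs n := (st n).2; pose Phi n := (st n).1.
have PhiS n y : Phi n.+1 y = Phi n y + q (y - zs n) / 2 ^+ n.+1 by [].
have inv n : M (zs n) /\ forall y, M y -> - (r ^+ 2 / 24) <= Phi n y.
  elim: n => [|n [Mz lb]]; first by split.
  have lb' y : M y -> - (r ^+ 2 / 24) <= Phi n.+1 y.
    move=> My; rewrite PhiS; have := lb y My.
    have : 0 <= q (y - zs n) / 2 ^+ n.+1 by rewrite divr_ge0 ?exprn_ge0 ?q_ge0.
    lra.
  by have [h _ _] := pickP (n.+1, Phi n.+1, zs n) Mz lb'.
have Mzs n := (inv n).1.
have stepP n : Phi n.+1 (zs n.+1) <= Phi n.+1 (zs n) /\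
    forall e, M e -> Phi n.+1 (zs n.+1) <= Phi n.+1 e + eta n.+1.
  by have [_ h1 h2] := pickP (n.+1, Phi n.+1, zs n) (Mzs n) (inv n.+1).2.
have nearmin n e : M e -> Phi n (zs n) <= Phi n e + eta n.
  case: n => [|n] Me; last exact: (stepP n).2.
  have := k0_lb Me; have := k0_z0; rewrite /Phi /zs /= /eta expr0 divr1; lra.
have qxx y : M y -> q (y - y) = 0.
  move=> My; apply/eqP; rewrite eq_le q_ge0// andbT.
  by apply: (le_trans (q_ub My My)); rewrite subrr normr0 expr0n/= mul0r.
have dz n : `|zs n.+1 - zs n| <= r / 2 ^+ n.
  have h1 := (stepP n).1; rewrite !PhiS qxx// mul0r addr0 in h1.
  have h2 := nearmin n _ (Mzs n.+1).
  have p0 : 0 < 2 ^+ n.+1 :> R by rewrite exprn_gt0.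
  have h3 : q (zs n.+1 - zs n) / 2 ^+ n.+1 <= eta n by lra.
  rewrite ler_pdivrMr// in h3.
  have h4 := q_lb (Mzs n.+1) (Mzs n).
  have h5 : eta n * 2 ^+ n.+1 = (r / 2 ^+ n) ^+ 2 / 12.
    have p1 : 2 ^+ n != 0 :> R by rewrite expf_neq0.
    have -> : eta n = r ^+ 2 / 24 / (2 ^+ n) ^+ 3.
      by rewrite /eta -exprM mulnC exprM; congr (_ / _ ^+ _); ring.
    by rewrite [2 ^+ n.+1]exprS; move: (2 ^+ n) p1 => p p1; field.
  rewrite -(@ler_pXn2r _ 2)// ?nnegrE ?divr_ge0 ?exprn_ge0 ?(ltW r_gt0)//.
  by rewrite h5 in h3; lra.
have dzn m n : (m <= n)%N -> `|zs n - zs m| <= 2 * r / 2 ^+ m - 2 * r / 2 ^+ n.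
  move=> /subnK <-; elim: (n - m)%N => [|i IH]; first by rewrite add0n !subrr normr0.
  rewrite addSn.
  have -> : zs (i + m).+1 - zs m = (zs (i + m).+1 - zs (i + m)%N) + (zs (i + m)%N - zs m).
    by rewrite subrKA.
  apply: (le_trans (ler_normD _ _)); have := dz (i + m)%N.
  have -> : 2 * r / 2 ^+ (i + m).+1 = r / 2 ^+ (i + m).
    by rewrite exprS invfM mulrACA divff ?mul1r.
  move: IH; have -> : 2 * r / 2 ^+ (i + m) = r / 2 ^+ (i + m) + r / 2 ^+ (i + m) by ring.
  lra.
have dzn' m n : (m <= n)%N -> `|zs n - zs m| <= 2 * r / 2 ^+ m.
  move=> mn; apply: (le_trans (dzn m n mn)); rewrite gerBl.
  by rewrite divr_ge0 ?exprn_ge0// mulr_ge0// ltW.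
have small (c eps : R) : 0 <= c -> 0 < eps -> exists N : nat, c / 2 ^+ N <= eps.
  move=> c0 e0; have [N NP] := exists_nat_gt (c / eps).
  exists N; rewrite ler_pdivrMr ?exprn_gt0// mulrC -ler_pdivrMr//.
  apply: ltW; apply: (lt_le_trans NP).
  by rewrite -natrX ler_nat; exact: ltnW (ltn_expl _ _).
have r2 : 0 <= 2 * r by rewrite mulr_ge0// ltW.
have [|ehat ehatP] := E_complete (u := zs).
  move=> eps e0; have e2 : 0 < eps / 2 by lra.
  have [N NP] := small _ _ r2 e2.
  exists N => m n Nm Nn.
  have h1 := dzn' _ _ Nm; have h2 := dzn' _ _ Nn.
  have -> : zs m - zs n = (zs m - zs N) - (zs n - zs N) by rewrite opprB subrKA.
  apply: (le_trans (ler_normB _ _)); lra.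
have ehd m : `|ehat - zs m| <= 2 * r / 2 ^+ m.
  apply: le_eps => eps e0; have [N NP] := (cvg_seqP _ _).1 ehatP _ e0.
  have := NP (maxn N m) (leq_maxl _ _); rewrite distrC => h1.
  have h2 := dzn' m (maxn N m) (leq_maxr _ _).
  have -> : ehat - zs m = (ehat - zs (maxn N m)) + (zs (maxn N m) - zs m).
    by rewrite subrKA.
  apply: (le_trans (ler_normD _ _)); lra.
have ehr m : `|ehat - zs m| <= 2 * r.
  apply: (le_trans (ehd m)); rewrite ler_pdivrMr ?exprn_gt0// ler_peMr//.
  by rewrite exprn_ege1// ler1n.
have Me : M ehat.
  apply: M_closed; apply/closure_normP => eps e0.
  have [N NP] := small _ _ r2 (divr_gt0 e0 (ltr0n _ 2)).
  exists (zs N) => //; have := ehd N; lra.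
exists zs, ehat; split=> // e Me'.
have bq y : M y -> bounded_seq (fun j => q (y - zs j)).
  move=> My; apply: (@bounded_seq_ge0 _ _ ((`|y - ehat| + 2 * r) ^+ 2 / 4)) => j.
    exact: q_ge0.
  apply: (le_trans (q_ub My (Mzs j))); apply: ler_wpM2r => //.
  apply: lerXn2r; rewrite ?nnegrE ?addr_ge0//.
  have -> : y - zs j = (y - ehat) + (ehat - zs j) by rewrite subrKA.
  by apply: (le_trans (ler_normD _ _)); rewrite lerD2l.
have PhiE n y : Phi n y = k0 y + wseries (fun j => q (y - zs j)) n.
  elim: n => [|n IH]; first by rewrite /wseries /series /= big_nil addr0.
  by rewrite PhiS IH /wseries /series /= big_nat_recr//= addrA.
have Phi_le n y : M y -> Phi n y <= k0 y + wsum (fun j => q (y - zs j)).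
  move=> My; rewrite PhiE lerD2l; apply: wseries_le_wsum; first exact: bq.
  by move=> j; exact: q_ge0.
have Phi_mono m n y : M y -> (m <= n)%N -> Phi m y <= Phi n y.
  move=> My /subnK <-; elim: (n - m)%N => [|i IH]; first by rewrite add0n.
  apply: (le_trans IH); rewrite addSn PhiS lerDl.
  by rewrite divr_ge0 ?exprn_ge0 ?q_ge0.
(* The constant does not depend on [j], because [ehat] is within [2 * r] of all the points. *)
have lipP j i : Phi j ehat <= Phi j (zs i) + (Ck + 2 * r) * `|ehat - zs i|.
  have h1 := k0_lip (Mzs i) Me; rewrite [`|zs i - _|]distrC in h1.
  suff : wseries (fun l => q (ehat - zs l)) j <=
      wseries (fun l => q (zs i - zs l)) j + 2 * r * `|ehat - zs i|.
    by rewrite !PhiE; lra.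
  apply: (@le_trans _ _ (wseries (fun l => q (zs i - zs l)) j +
      wseries (fun=> 2 * r * `|ehat - zs i|) j)).
    rewrite /wseries /series/= -big_split/=; apply: ler_sum => l _.
    rewrite -mulrDl; apply: ler_wpM2r; first by rewrite invr_ge0 exprn_ge0.
    apply: (le_trans (q_lip (Mzs i) Me (Mzs l))); rewrite lerD2l.
    exact: ler_wpM2r.
  rewrite lerD2l -[leRHS]wsum_cst; apply: wseries_le_wsum.
    exact: bounded_seq_cst.
  by move=> _; rewrite mulr_ge0.
set W := k0 e + _.
(* For [i >= j], the value [Phi j ehat] is compared with [Phi j (zs i) <= Phi i (zs i)], which
   exceeds [Phi i e] by at most [eta i]. *)
have key j : Phi j ehat <= W.
  apply: le_eps => eps e0.
  have A0 : 0 <= r ^+ 2 / 24 + (Ck + 2 * r) * (2 * r).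
    by rewrite addr_ge0 ?mulr_ge0 ?addr_ge0 ?sqr_ge0 ?divr_ge0// ltW.
  have [N NP] := small _ _ A0 e0; pose i := maxn N j.
  have NPi : (r ^+ 2 / 24 + (Ck + 2 * r) * (2 * r)) / 2 ^+ i <= eps.
    apply: le_trans NP; apply: ler_wpM2l => //.
    by rewrite lef_pV2 ?posrE ?exprn_gt0// ler_eXn2l ?ltr1n// leq_maxl.
  have h1 := lipP j i; have h2 := Phi_mono j i _ (Mzs i) (leq_maxr N j).
  have h3 := nearmin i e Me'; have h4 := Phi_le i e Me'.
  have h5 : (Ck + 2 * r) * `|ehat - zs i| <= (Ck + 2 * r) * (2 * r / 2 ^+ i).
    by apply: ler_wpM2l; [rewrite addr_ge0|exact: ehd].
  have h6 : eta i <= r ^+ 2 / 24 / 2 ^+ i.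
    rewrite /eta; apply: ler_wpM2l; first by rewrite divr_ge0// sqr_ge0.
    by rewrite lef_pV2 ?posrE ?exprn_gt0// lerXn2r ?nnegrE// ler_nat.
  move: NPi; rewrite mulrDl -mulrA -/W in h4 *; rewrite -!mulrA in h5 h6 *; lra.
have : wsum (fun j => q (ehat - zs j)) <= W - k0 ehat.
  apply: wsum_le_of_wseries; first exact: bq.
  by move=> n; have := key n; rewrite PhiE; lra.
lra.
Qed.

End BorweinPreiss.

(** * Frechet normals near a minimizer of a sublinear function *)

Section NormalsAtMinimizers.
Context {R : realType} {E : normedModType R}.

(** Jensen's inequality for total mass below 1, the missing mass sitting at 0, where [K] vanishes.
    Strictness allows the induction to divide by the complementary mass. *)
Lemma jensen0 (T : set E) (K : E -> R) (l : seq ((R * E) * (nat * nat))) (e : E)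
    (t : R) :
  closed_subspace T -> convex_on T K -> K 0 = 0 -> T e ->
  (forall i, i \in l -> 0 <= i.1.1 /\ T i.1.2) ->
  0 < t -> t * weight l < 1 ->
  K (- (t *: displacement e l)) <=
    t * \sum_(i <- l) i.1.1 * K (- (i.1.2 - e)).
Proof.
move=> Ts Kc K0 Te; elim: l t => [|i l IH] t lP t0.
  by rewrite /displacement !big_nil scaler0 oppr0 K0 mulr0.
rewrite /weight /displacement !big_cons => tl.
have [l0 Ti] := lP i (mem_head _ _).
have lP' i' : i' \in l -> 0 <= i'.1.1 /\ T i'.1.2.
  by move=> il; apply: lP; rewrite in_cons il orbT.
have w0 : 0 <= weight l.
  by rewrite /weight big_seq; apply: sumr_ge0 => i' /lP'[].
set a := t * i.1.1.
have a0 : 0 <= a by rewrite mulr_ge0// ltW.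
have tw0 : 0 <= t * weight l by rewrite mulr_ge0// ltW.
have a1 : 0 < 1 - a by move: tl tw0; rewrite mulrDr -/a /weight; lra.
have t1 : 0 < t / (1 - a) by rewrite divr_gt0.
have tl1 : t / (1 - a) * weight l < 1.
  by rewrite mulrAC ltr_pdivrMr// mul1r; move: tl; rewrite mulrDr -/a /weight; lra.
have IHl := IH _ lP' t1 tl1.
have Tw : T (- ((t / (1 - a)) *: displacement e l)).
  apply: subspaceN => //; apply: subspaceZ => //.
  rewrite /displacement big_seq; elim/big_ind: _.
  - exact: Ts.1.
  - by move=> x y Tx Ty; exact: subspaceD.
  - by move=> i' /lP'[_ Ti']; apply: subspaceZ => //; exact: subspaceB.
have Tu : T (- (i.1.2 - e)) by apply: subspaceN => //; exact: subspaceB.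
have := Kc _ _ a Tu Tw a0 (ltac:(lra)).
have -> : a *: (- (i.1.2 - e)) + (1 - a) *: (- ((t / (1 - a)) *: displacement e l)) =
    - (t *: (i.1.1 *: (i.1.2 - e) + \sum_(j <- l) j.1.1 *: (j.1.2 - e))).
  have -> : (1 - a) *: (- ((t / (1 - a)) *: displacement e l)) = - (t *: displacement e l).
    by rewrite scalerN scalerA [(1 - a) * _]mulrC divfK ?gt_eqF.
  by rewrite scalerN /a -scalerA -opprD -scalerDr.
move=> h; apply: (le_trans h); rewrite mulrDr mulrA -/a lerD2l.
apply: (le_trans (ler_wpM2l (ltW a1) IHl)).
by rewrite mulrA [(1 - a) * _]mulrC divfK ?gt_eqF.
Qed.

(** For [u] pointing to an item, minimality gives [0 <= K u] and smoothness bounds [K u + K (- u)],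
    so [K (- u)] is below the slope cost of the item. Jensen's inequality collects these bounds, and
    [0 <= K v + K (- v)] together with [K v <= s (- v)] makes the cost nonnegative. *)
Lemma no_violation_of_convex (T Th : set E) (s K : E -> R) (e : E) (rho : R) :
  closed_subspace T -> sublinear s -> T e -> 0 < rho ->
  convex_on T K -> K 0 = 0 ->
  (forall y, Th y -> T y -> 0 <= K (y - e)) ->
  (forall w, T w -> `|w| <= rho -> K w <= s (- w)) ->
  smooth_at T K 0 -> exists m, no_violation s (Th `&` T) e m.
Proof.
move=> Ts ss Te rho0 Kc K0 Kmin Ks Ksm.
have /choice[m mP] : forall j : nat, exists n : nat, forall u, T u ->
    `|u| < (n.+1%:R)^-1 -> K u + K (- u) <= `|u| / j.+1%:R.
  move=> j; have j0 : 0 < (j.+1%:R : R)^-1 by rewrite invr_gt0.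
  have [dl dl0 dlP] := Ksm _ j0; have [n nP] := exists_inv_lt dl0.
  exists n => u Tu un; have := dlP u Tu (lt_trans un nP).
  by rewrite add0r sub0r K0 mulr0 subr0 [_^-1 * _]mulrC.
exists m => l lm adl.
have lP i : i \in l -> 0 <= i.1.1 /\ T i.1.2 by move=> /adl[h1 [_ h2] _].
have w0 := weight_ge0 adl.
pose V := displacement e l.
have V1 : 0 < 1 + `|V| by rewrite ltr_wpDr.
have w1 : 0 < 1 + weight l by rewrite ltr_wpDr.
(* Scaling is harmless since the cost is homogeneous in the weights; it meets the mass condition and
   the radius [rho]. *)
pose t := Num.min (1 + weight l)^-1 (rho / (1 + `|V|)).
have t0 : 0 < t by rewrite lt_min invr_gt0 w1 divr_gt0.
have tw : t * weight l < 1.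
  apply: (@le_lt_trans _ _ ((1 + weight l)^-1 * weight l)).
    by apply: ler_wpM2r => //; rewrite /t ge_min lexx.
  by rewrite mulrC ltr_pdivrMr// mul1r ltrDr.
have tV : `|t *: V| <= rho.
  rewrite normrZ (gtr0_norm t0); apply: (@le_trans _ _ (rho / (1 + `|V|) * `|V|)).
    by apply: ler_wpM2r => //; rewrite /t ge_min lexx orbT.
  by rewrite mulrAC ler_pdivrMr// ler_pM2l// lerDr.
have TV : T (t *: V).
  apply: subspaceZ => //; rewrite /V /displacement big_seq; elim/big_ind: _.
  - exact: Ts.1.
  - by move=> x y Tx Ty; exact: subspaceD.
  - by move=> i' /lP[_ Ti']; apply: subspaceZ => //; exact: subspaceB.
have h1 := jensen0 Ts Kc K0 Te lP t0 tw; rewrite -/V in h1.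
have h2 : \sum_(i <- l) i.1.1 * K (- (i.1.2 - e)) <= slope_cost e l.
  rewrite /slope_cost big_seq [leRHS]big_seq; apply: ler_sum => i il.
  have [l0 [Thi Ti]] := adl i il; rewrite addr0 => di.
  apply: ler_wpM2l => //.
  have := mP i.2.1 (i.1.2 - e) (subspaceB Ts Ti Te); rewrite -(lm i il) => /(_ di).
  by have := Kmin _ Thi Ti; move: (_ / _) => c; lra.
have h3 := Ks _ TV tV; rewrite -scalerN ss.2 ?(ltW t0)// in h3.
have h4 : 0 <= K (t *: V) + K (- (t *: V)).
  have := Kc _ _ (2^-1) TV (subspaceN Ts TV).
  have -> : 1 - 2^-1 = 2^-1 :> R by field.
  rewrite -scalerDr subrr scaler0 K0 => /(_ ltac:(lra) ltac:(lra)); lra.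
have h5 : t * \sum_(i <- l) i.1.1 * K (- (i.1.2 - e)) <= t * slope_cost e l.
  by rewrite ler_pM2l.
have : 0 <= t * cost s e l by rewrite /cost mulrDr -/V; lra.
by rewrite pmulr_rge0.
Qed.

(** The Asplund condition on plain normed modules, so that it applies to products. *)
Definition dual_separable (V : normedModType R) : Prop :=
  forall S : set V, closed_subspace S -> separable_set S -> separable_dual_of S.

(* The smooth convex function [K] below is minimal at [e] on [Th] inside the
   separable subspace [T]; its second differences exclude violations there, and
   the choice of [T] transfers this to the whole space. *)
Theorem normal_at_minimizer (Th : set E) (s : E -> R) (C : R) (e0 : E) (gam : R) :
  seq_complete E -> dual_separable E -> closed Th -> sublinear s ->
  (forall x, s x <= C * `|x|) -> Th e0 -> (forall e, Th e -> 0 <= s (e0 - e)) ->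
  0 < gam -> exists e nu, [/\ Th e, `|e - e0| < gam, fnormal Th e nu &
    forall x, nu x <= s x + gam * `|x|].
Proof.
move=> Ec Ed Thc ss sC Th0 smin g0.
(* The slack pays for the slope of the perturbation added by the variational principle. *)
pose s' x := s x + gam * `|x|.
have ss' : sublinear s'.
  split=> [x y|t x t0].
    have := ss.1 x y; have : gam * `|x + y| <= gam * (`|x| + `|y|).
      by rewrite ler_pM2l// ler_normD.
    by rewrite /s'; lra.
  by rewrite /s' ss.2// normrZ ger0_norm//; ring.
have sC' x : s' x <= (C + gam) * `|x| by have := sC x; rewrite /s'; lra.
have [T [Ts Tsep Te0 Tred]] := separable_no_violation Th ss' sC' e0.
have Td := Ed T Ts Tsep.
have [q [qlb qub qlip qc qsm]] := smooth_gauge Ts Tsep Td.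
(* [2 * r < gam] bounds the distance to [e0], and [4 * r = gam] bounds the slope of [q] on the
   relevant ball. *)
pose r := gam / 4; have r0 : 0 < r by rewrite divr_gt0.
have eta0 : 0 < r ^+ 2 / 24 by rewrite divr_gt0// exprn_gt0.
have [sig [sigb siglip sigc sigsm]] := smooth_approx Ts Tsep Td ss sC eta0.
pose M := Th `&` T.
have Mc : closed M by apply: closedI => //; exact: Ts.2.2.
have MT y : M y -> T y by case.
pose k0 e := sig (e0 - e).
have CC : 0 <= `|C| by [].
have k0lip y z : M y -> M z -> k0 z <= k0 y + `|C| * `|y - z|.
  move=> /MT Ty /MT Tz; rewrite /k0.
  have -> : e0 - z = (e0 - y) + (y - z) by rewrite subrKA.
  apply: (le_trans (siglip _ _ (subspaceB Ts Te0 Ty) (subspaceB Ts Ty Tz))).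
  rewrite lerD2l; apply: (le_trans (sC _)); apply: ler_wpM2r => //.
  exact: ler_norm.
have k0lb y : M y -> - (r ^+ 2 / 24) <= k0 y.
  move=> [Thy Ty]; have /andP[h _] := sigb _ (subspaceB Ts Te0 Ty).
  by have := smin _ Thy; rewrite /k0; lra.
have k0z : k0 e0 <= 0.
  rewrite /k0 subrr; have /andP[_] := sigb _ Ts.1; by rewrite (sublinear0 ss).
have [|||zs [e [zsM eM zs0 ezs emin]]] := borwein_preiss Ec r0 Mc (conj Th0 Te0) CC
    k0lip k0lb k0z (q := q).
- by move=> y z /MT Ty /MT Tz; apply: qlb; exact: subspaceB.
- by move=> y z /MT Ty /MT Tz; apply: qub; exact: subspaceB.
- move=> y z w /MT Ty /MT Tz /MT Tw.
  have := qlip (y - w) (z - y) (subspaceB Ts Ty Tw) (subspaceB Ts Tz Ty).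
  by rewrite [y - w + _]addrC subrKA.
have zsT n := MT _ (zsM n); have Te := MT _ eM.
pose d j := e - zs j.
have dT j : T (d j) by exact: subspaceB.
have dr j : `|d j| <= 2 * r := ezs j.
have q0 x : T x -> 0 <= q x.
  by move=> Tx; apply: le_trans (qlb x Tx); rewrite divr_ge0// sqr_ge0.
have r2 : 0 <= 2 * r by rewrite mulr_ge0// ltW.
have bq w : T w -> bounded_seq (fun j => q (w + d j)).
  move=> Tw; have Twd j := subspaceD Ts Tw (dT j).
  apply: (@bounded_seq_ge0 _ _ ((`|w| + 2 * r) ^+ 2 / 4)) => j; first exact: q0.
  apply: (le_trans (qub _ (Twd j))); apply: ler_wpM2r => //.
  apply: lerXn2r; rewrite ?nnegrE ?addr_ge0//.
  by apply: (le_trans (ler_normD _ _)); rewrite lerD2l.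
(* The perturbed function in the variable [w = y - e], so that its minimum sits at 0. *)
pose Kf w := sig (e0 - e - w) + wsum (fun j => q (w + d j)).
pose K w := Kf w - Kf 0.
have Te0e := subspaceB Ts Te0 Te.
have Kf0 : Kf 0 = k0 e + wsum (fun j => q (e - zs j)).
  by rewrite /Kf subr0 /k0; congr (_ + wsum _); apply/funext => j; rewrite add0r.
have KfE y : Kf (y - e) = k0 y + wsum (fun j => q (y - zs j)).
  rewrite /Kf /k0; congr (sig _ + wsum _); first by rewrite opprB subrKA.
  by apply/funext => j; rewrite /d subrKA.
have Kc : convex_on T K.
  move=> x y t Tx Ty t0 t1.
  have h1 := sigc _ _ t (subspaceB Ts Te0e Tx) (subspaceB Ts Te0e Ty) t0 t1.
  have e1 : t *: (e0 - e - x) + (1 - t) *: (e0 - e - y) =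
      e0 - e - (t *: x + (1 - t) *: y).
    move: (e0 - e) => c.
    by rewrite !scalerBr addrACA -opprD -scalerDl [t + _]addrC subrK scale1r.
  rewrite e1 in h1.
  have Txy : T (t *: x + (1 - t) *: y).
    by apply: subspaceD => //; exact: subspaceZ.
  have h2 : wsum (fun j => q (t *: x + (1 - t) *: y + d j)) <=
      t * wsum (fun j => q (x + d j)) + (1 - t) * wsum (fun j => q (y + d j)).
    rewrite -!wsumZ; try exact: bq.
    rewrite -wsumD; try by apply: bounded_seqZ; exact: bq.
    apply: le_wsum; first exact: bq.
      by apply: bounded_seqD; apply: bounded_seqZ; exact: bq.
    move=> j.
    have -> : t *: x + (1 - t) *: y + d j = t *: (x + d j) + (1 - t) *: (y + d j).
      move: (d j) => c.
      by rewrite !scalerDr addrACA -scalerDl [t + (1 - t)]addrC subrK scale1r.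
    by apply: qc => //; exact: subspaceD.
  by rewrite /K /Kf; lra.
have Ksm : smooth_at T K 0.
  move=> eps eps0.
  have e4 : 0 < eps / 4 by lra.
  have [d1 d10 d1P] := sigsm _ Te0e _ e4.
  (* Terms before [J] are handled by smoothness of [q], the tail by its Lipschitz estimate and small
     total weight. *)
  have [J JP] : exists J : nat, 4 * gam / 2 ^+ J <= eps / 4.
    have [J JP] := exists_nat_gt (4 * gam / (eps / 4)).
    exists J; rewrite ler_pdivrMr ?exprn_gt0// [eps / 4 * _]mulrC -ler_pdivrMr//.
    apply: ltW; apply: (lt_le_trans JP).
    by rewrite -natrX ler_nat; exact: ltnW (ltn_expl _ _).
  have [d2 d20 d2P] : exists2 d2 : R, 0 < d2 & forall j u, (j < J)%N -> T u ->
      `|u| < d2 -> q (d j + u) + q (d j - u) - 2 * q (d j) <= eps / 4 * `|u|.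
    elim: J {JP} => [|J [d2 d20 d2P]]; first by exists 1.
    have [d3 d30 d3P] := qsm _ (dT J) _ e4.
    exists (Num.min d2 d3); first by rewrite lt_min d20.
    move=> j u; rewrite ltnS leq_eqVlt lt_min => /orP[/eqP ->|jJ] Tu /andP[u2 u3].
      exact: d3P.
    exact: d2P.
  exists (Num.min d1 (Num.min d2 (2 * r))).
    by rewrite !lt_min d10 d20 mulr_gt0.
  move=> u Tu; rewrite !lt_min => /and3P[u1 u2 u3].
  have h1 := d1P u Tu u1.
  rewrite add0r sub0r.
  have TNu := subspaceN Ts Tu.
  have qd j w : T w -> `|w| = `|u| -> q (d j + w) - q (d j) <= gam * `|u|.
    move=> Tw wu; have := qlip _ _ (dT j) Tw; rewrite wu.
    have : `|d j + w| * `|u| <= gam * `|u|.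
      apply: ler_wpM2r => //; apply: (le_trans (ler_normD _ _)).
      by have := dr j; rewrite wu /r; rewrite /r in u3; lra.
    lra.
  pose D j := q (u + d j) + q (- u + d j) - 2 * q (0 + d j).
  have bD : bounded_seq D.
    rewrite /D; have -> : (fun j => q (u + d j) + q (- u + d j) - 2 * q (0 + d j)) =
        (fun j => q (u + d j) + (q (- u + d j) + (-2) * q (0 + d j))).
      by apply/funext => j; ring.
    apply: bounded_seqD; first exact: bq.
    by apply: bounded_seqD; [exact: bq|apply: bounded_seqZ; exact: (bq _ Ts.1)].
  have wD : wsum D = wsum (fun j => q (u + d j)) + wsum (fun j => q (- u + d j))
      - 2 * wsum (fun j => q (0 + d j)).
    have -> : D = (fun j => q (u + d j) + (q (- u + d j) + (-2) * q (0 + d j))).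
      by apply/funext => j; rewrite /D; ring.
    rewrite wsumD; [|exact: bq|]; last first.
      by apply: bounded_seqD; [exact: bq|apply: bounded_seqZ; exact: (bq _ Ts.1)].
    rewrite wsumD; [|exact: bq|apply: bounded_seqZ; exact: (bq _ Ts.1)].
    by rewrite wsumZ; [ring|exact: (bq _ Ts.1)].
  have hD : wsum D <= eps / 4 * `|u| + 4 * gam * `|u| / 2 ^+ J.
    apply: wsum_tail_le => //.
    - by rewrite mulr_ge0// ltW.
    - move=> j jJ; rewrite /D add0r [u + _]addrC [- u + _]addrC; exact: d2P.
    - move=> j; rewrite /D add0r [u + _]addrC [- u + _]addrC.
      have := qd j _ Tu erefl; have := qd j _ TNu (normrN u).
      have : 0 <= gam * `|u| by rewrite mulr_ge0// ltW.
      lra.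
  have hJ : 4 * gam * `|u| / 2 ^+ J <= eps / 4 * `|u|.
    by rewrite mulrAC; apply: ler_wpM2r.
  have h0 : 0 <= eps / 4 * `|u| by rewrite mulr_ge0// ltW.
  by rewrite /K /Kf opprK subr0; move: hD; rewrite wD; lra.
have [] := @no_violation_of_convex T Th s' K e (2 * r) Ts ss' Te _ Kc.
- by rewrite mulr_gt0.
- by rewrite /K subrr.
- move=> y Thy Ty; have := emin y (conj Thy Ty).
  by rewrite /K KfE Kf0; lra.
- move=> w Tw wr.
  have h1 := siglip _ _ Te0e (subspaceN Ts Tw).
  have h2 : wsum (fun j => q (w + d j)) <= wsum (fun j => q (0 + d j)) + gam * `|w|.
    rewrite -[X in _ + X]wsum_cst -wsumD; [|exact: (bq _ Ts.1)|exact: bounded_seq_cst].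
    apply: le_wsum; first exact: bq.
      by apply: bounded_seqD; [exact: (bq _ Ts.1)|exact: bounded_seq_cst].
    move=> j; rewrite add0r addrC; apply: (le_trans (qlip _ _ (dT j) Tw)).
    rewrite lerD2l; apply: ler_wpM2r => //; apply: (le_trans (ler_normD _ _)).
    by have := dr j; rewrite /r; rewrite /r in wr; lra.
  by rewrite /K /Kf /s' normrN subr0; lra.
- exact: Ksm.
move=> m /(Tred _ _ Te) nv.
have [nu nuN nus] := normal_of_no_violation ss' sC' nv.
exists e, nu; split=> //; first exact: eM.1.
by apply: le_lt_trans (_ : 2 * r < gam); [rewrite -zs0|rewrite /r; lra].
Qed.

End NormalsAtMinimizers.

(** * Weak-star sequential compactness *)

Section WeakStarCompactness.
Context {R : realType}.

Lemma complete_seq_complete (V : completeNormedModType R) : seq_complete V.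
Proof.
move=> u uc; have /cauchy_cvgP/cvg_ex[l ul] : cauchy (u @ \oo).
  apply: cauchy_exP => eps e0; have [N NP] := uc _ (divr_gt0 e0 (ltr0n _ 2)).
  exists (u N); exists N => // n /= Nn; rewrite -ball_normE /=.
  by apply: (le_lt_trans (NP N n (leqnn _) Nn)); lra.
by exists l.
Qed.

Lemma prod_seq_complete (V W : normedModType R) :
  seq_complete V -> seq_complete W -> seq_complete (V * W)%type.
Proof.
move=> cV cW u uc.
have [|l1 h1] := cV (fun n => (u n).1).
  move=> eps e0; have [N NP] := uc _ e0; exists N => m n Nm Nn.
  by apply: le_trans (NP m n Nm Nn); rewrite prod_normE le_max lexx.
have [|l2 h2] := cW (fun n => (u n).2).
  move=> eps e0; have [N NP] := uc _ e0; exists N => m n Nm Nn.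
  by apply: le_trans (NP m n Nm Nn); rewrite prod_normE le_max lexx orbT.
exists (l1, l2); apply/cvg_seqP => eps e0.
have [N1 N1P] := (cvg_seqP _ _).1 h1 _ e0; have [N2 N2P] := (cvg_seqP _ _).1 h2 _ e0.
exists (maxn N1 N2) => n; rewrite geq_max => /andP[n1 n2].
by rewrite prod_normE ge_max; apply/andP; split; [exact: N1P|exact: N2P].
Qed.

Definition infinite_nat (A : set nat) : Prop :=
  forall N : nat, exists2 n, (N <= n)%N & A n.

Lemma diagonal_subsequence (A : nat -> set nat) : (forall k, infinite_nat (A k)) ->
  exists2 phi : nat -> nat, {homo phi : m n / (m < n)%N} & forall k, A k (phi k).
Proof.
move=> Ai; have /choice[pick pickP] : forall t : nat * nat, exists n,
    (t.2 <= n)%N /\ A t.1 n by move=> [k N]; have [n h1 h2] := Ai k N; exists n.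
pose phi := fix phi k := if k is k'.+1 then pick (k, (phi k').+1) else pick (0, 0)%N.
exists phi; last by case=> [|k]; [exact: (pickP (0, 0)%N).2|exact: (pickP (k.+1, (phi k).+1)).2].
apply: homo_ltn; first exact: ltn_trans.
by move=> k; exact: (pickP (k.+1, (phi k).+1)).1.
Qed.

Lemma homo_ge_id (phi : nat -> nat) n : {homo phi : m n / (m < n)%N} -> (n <= phi n)%N.
Proof.
by move=> h; elim: n => // n IH; apply: (leq_ltn_trans IH); exact: h.
Qed.

Lemma no_injection_cantor (N : (nat -> bool) -> nat) :
  ~ (forall b b', N b = N b' -> b = b').
Proof.
move=> Ninj; have /choice[inv invP] : forall k, exists b0,
    (exists b, N b = k) -> N b0 = k.
  move=> k; have [[b bk]|n] := pselect (exists b, N b = k); first by exists b.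
  by exists (fun=> true).
pose d k := ~~ inv k k.
have e : inv (N d) = d by apply: Ninj; apply: invP; exists d.
have : d (N d) = ~~ d (N d) by rewrite {1}/d e.
by case: (d (N d)).
Qed.

Variables (X : normedModType R) (fn : nat -> X -> R) (C : R).
Hypothesis X_dual : dual_separable X.
Hypothesis fn_lin : forall n, linear_form (fn n).
Hypothesis fn_bd : forall n x, `|fn n x| <= C * `|x|.

Let small_osc (A : set nat) (eps : R) : Prop := forall x, exists N : nat, forall m n,
  A m -> A n -> (N <= m)%N -> (N <= n)%N -> `|fn m x - fn n x| <= eps * `|x|.

(** Let [b0] be the supremum of the levels reached infinitely often along [A], and
    [eta = eps |x| / 8]. Infinitely many values are at least [b0 - eta], and eventually all are
    below [b0 + eta]; were only finitely many at most [b0 - 2 eta], the oscillation would be too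
    small. *)
Let split_osc (A : set nat) (eps : R) : 0 < eps -> infinite_nat A ->
  ~ small_osc A eps -> exists t : X * R * (set nat * set nat),
  [/\ 0 < `|t.1.1|, t.2.1 `<=` A /\ t.2.2 `<=` A,
      infinite_nat t.2.1 /\ infinite_nat t.2.2,
      forall n, t.2.1 n -> t.1.2 + eps / 8 * `|t.1.1| <= fn n t.1.1 &
      forall n, t.2.2 n -> fn n t.1.1 <= t.1.2].
Proof.
move=> e0 Ai /existsNP[x xP].
have xosc N : exists m n, [/\ A m, A n, (N <= m)%N, (N <= n)%N &
    eps * `|x| < `|fn m x - fn n x|].
  apply: contrapT => h; apply: xP; exists N => m n Am An Nm Nn.
  by rewrite leNgt; apply/negP => h'; apply: h; exists m, n.
have x0 : 0 < `|x|.
  rewrite normr_gt0; apply/eqP => x0; have [m [n [_ _ _ _]]] := xosc 0%N.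
  by rewrite x0 !(linear_form0 (fn_lin _)) subrr !normr0 mulr0 ltxx.
pose S := [set r : R | infinite_nat [set n | A n /\ r <= fn n x]].
have fb n : - (C * `|x|) <= fn n x <= C * `|x| by rewrite -ler_norml.
have Sub r : S r -> r <= C * `|x|.
  move=> Sr; have [n _ [_ h]] := Sr 0%N; apply: (le_trans h).
  by have /andP[] := fb n.
have S0 : S !=set0.
  exists (- (C * `|x|)) => N; have [n Nn An] := Ai N; exists n => //; split=> //.
  by have /andP[] := fb n.
pose eta := eps / 8 * `|x|.
have eta0 : 0 < eta by rewrite mulr_gt0// divr_gt0.
pose b0 := sup S.
exists ((x, b0 - 2 * eta), ([set n | A n /\ b0 - eta <= fn n x],
  [set n | A n /\ fn n x <= b0 - 2 * eta])); split=> //=.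
- by split=> n [].
- split.
    have [r Sr rb] := sup_approx S0 Sub eta0.
    by move=> N; have [n Nn [An h]] := Sr N; exists n => //; split=> //;
      apply: le_trans h; rewrite ltW.
  have [N1 N1P] : exists N, forall n, (N <= n)%N -> A n -> fn n x < b0 + eta.
    apply: contrapT => h; have : S (b0 + eta).
      move=> N; apply: contrapT => h'; apply: h; exists N => n Nn An.
      by rewrite ltNge; apply/negP => h''; apply: h'; exists n.
    by move=> /(le_sup_mem Sub); rewrite -/b0; lra.
  move=> N; apply: contrapT => h.
  have [m [n [Am An Nm Nn]]] := xosc (maxn N N1).
  move: Nm Nn; rewrite !geq_max => /andP[m1 m2] /andP[n1 n2].
  have low k : (N <= k)%N -> A k -> b0 - 2 * eta < fn k x.
    by move=> Nk Ak; rewrite ltNge; apply/negP => h'; apply: h; exists k.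
  have := low m m1 Am; have := low n n1 An; have := N1P m m2 Am; have := N1P n n2 An.
  have -> : eps * `|x| = 8 * eta by rewrite /eta; field.
  move=> *; have : `|fn m x - fn n x| < 8 * eta.
    by rewrite ltr_norml; apply/andP; split; lra.
  lra.
- by move=> n [_]; rewrite /eta; lra.
- by move=> n [].
Qed.

(** The newest bit comes first, so that lengthening a prefix refines its node. *)
Let pre (b : nat -> bool) := fix pre k : seq bool :=
  if k is k'.+1 then b k' :: pre k' else [::].

(* Otherwise a dyadic tree of subsequences yields continuum many functionals,
   one for each branch, uniformly separated on a separable subspace. *)
Let small_osc_subset (A : set nat) (eps : R) : 0 < eps -> infinite_nat A ->
  exists A', [/\ A' `<=` A, infinite_nat A' & small_osc A' eps].
Proof.
move=> e0 Ai; apply: contrapT => nA.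
have /choice[Sp SpP] : forall B : set nat, exists t : X * R * (set nat * set nat),
    B `<=` A -> infinite_nat B ->
    [/\ 0 < `|t.1.1|, t.2.1 `<=` B /\ t.2.2 `<=` B,
      infinite_nat t.2.1 /\ infinite_nat t.2.2,
      forall n, t.2.1 n -> t.1.2 + eps / 8 * `|t.1.1| <= fn n t.1.1 &
      forall n, t.2.2 n -> fn n t.1.1 <= t.1.2].
  move=> B; have [[BA Bi]|n] := pselect (B `<=` A /\ infinite_nat B); last first.
    by exists ((0, 0), (set0, set0)) => h1 h2; exfalso; apply: n.
  have [|t tP] := split_osc e0 Bi; last by exists t.
  by move=> so; apply: nA; exists B.
pose At := fix At (l : seq bool) : set nat := if l is c :: l' then
  (if c then (Sp (At l')).2.1 else (Sp (At l')).2.2) else A.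
have AtP l : At l `<=` A /\ infinite_nat (At l).
  elim: l => [|c l [h1 h2]] /=; first by split.
  have [_ [s1 s2] [i1 i2] _ _] := SpP _ h1 h2.
  by case: c; split=> // n h; apply: h1; first [exact: s1|exact: s2].
pose xs l := (Sp (At l)).1.1; pose be l := (Sp (At l)).1.2.
have xs0 l : 0 < `|xs l| by have [] := SpP _ (AtP l).1 (AtP l).2.
(* The nodes are countably many, so all separating vectors fit in one separable subspace. *)
have [T [Ts Tsep Txs]] := separable_subspace_containing
  (fun n => xs (odflt [::] (unpickle n))).
have Tx l : T (xs l) by have := Txs (pickle l); rewrite pickleK.
have [fs [_ fsd]] := X_dual Ts Tsep.
have [U [UU ooU]] := free_ultrafilter.
have /choice[ph phP] : forall b : nat -> bool, exists phi : nat -> nat,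
    {homo phi : m n / (m < n)%N} /\ forall k, At (pre b k) (phi k).
  move=> b; have [|phi h1 h2] := @diagonal_subsequence (fun k => At (pre b k)).
    by move=> k; exact: (AtP _).2.
  by exists phi.
have /choice[fb fbP] : forall b, exists f : X -> R,
    forall x, (fun k => fn (ph b k) x) @ U --> f x.
  move=> b; have /choice[f fP] : forall x, exists l : R,
      (fun k => fn (ph b k) x) @ U --> l.
    by move=> x; apply: (ultra_cvg (B := C * `|x|)) => n.
  by exists f.
have fblin b : linear_form (fb b).
  move=> a x y; have h1 := fbP b (a *: x + y).
  have h2 : (fun k => fn (ph b k) (a *: x + y)) @ U --> a * fb b x + fb b y.
    have -> : (fun k => fn (ph b k) (a *: x + y)) =
        (fun k => a * fn (ph b k) x + fn (ph b k) y).
      by apply/funext => k; rewrite fn_lin.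
    by apply: cvgD => //; apply: cvgM => //; exact: cvg_cst.
  exact: (cvg_unique (@norm_hausdorff _ _) h1 h2).
have fbbd b x : `|fb b x| <= C * `|x|.
  have c1 : (fun k => `|fn (ph b k) x|) @ U --> `|fb b x| by exact: cvg_norm.
  by apply: (cvg_ler c1 (cvg_cst (C * `|x|))) => k.
have e32 : 0 < eps / 32 by lra.
have /choice[N NP] : forall b, exists n, forall y, T y ->
    `|fb b y - fs n y| <= eps / 32 * `|y|.
  move=> b; apply: fsd => //; first by move=> a x y _ _; exact: fblin.
  by exists C => y _.
have pre_sub b k j : At (pre b (j + k)) `<=` At (pre b k).
  elim: j => [|j IH] //= n; have [_ [s1 s2] _ _ _] := SpP _ (AtP (pre b (j + k))).1 (AtP _).2.
  by case: (b _) => h; apply: IH; first [exact: s1|exact: s2].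
have evU k : U [set j | (k <= j)%N].
  by apply: ooU; exists k.
have evf b y ep : 0 < ep -> U [set j | `|fb b y - fn (ph b j) y| <= ep].
  by move=> ep0; have /cvgrPdist_le/(_ _ ep0) := fbP b y.
have valt b k : b k = true ->
    be (pre b k) + eps / 8 * `|xs (pre b k)| <= fb b (xs (pre b k)).
  move=> bk; apply: le_eps => ep ep0.
  have h := evf b (xs (pre b k)) _ ep0.
  have [j [/= kj hj]] := filter_ex (filterI (evU k.+1) h).
  have := (phP b).2 j; rewrite -(subnK kj) => /pre_sub /=; rewrite bk subnK//.
  have [_ _ _ hv _] := SpP _ (AtP (pre b k)).1 (AtP _).2 => /hv.
  rewrite -/(xs _) -/(be _).
  by move: hj; rewrite ler_norml => /andP[]; lra.
have valf b k : b k = false -> fb b (xs (pre b k)) <= be (pre b k).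
  move=> bk; apply: le_eps => ep ep0.
  have h := evf b (xs (pre b k)) _ ep0.
  have [j [/= kj hj]] := filter_ex (filterI (evU k.+1) h).
  have := (phP b).2 j; rewrite -(subnK kj) => /pre_sub /=; rewrite bk subnK//.
  have [_ _ _ _ hv] := SpP _ (AtP (pre b k)).1 (AtP _).2 => /hv.
  rewrite -/(xs _) -/(be _).
  by move: hj; rewrite ler_norml => /andP[]; lra.
(* Two functionals separated by [eps / 8] cannot both be within [eps / 32] of the same member of the
   dense sequence. *)
have sep b b' k : N b = N b' -> pre b k = pre b' k -> b k = true -> b' k = false -> False.
  move=> NN pk bk b'k; have h1 := valt _ _ bk; have h2 := valf _ _ b'k.
  rewrite -pk in h2; have := NP b _ (Tx (pre b k)); have := NP b' _ (Tx (pre b k)).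
  rewrite -NN; have := xs0 (pre b k); set y := xs _ => y0.
  rewrite !ler_norml => /andP[a1 a2] /andP[a3 a4].
  have : 0 < eps * `|y| by rewrite mulr_gt0.
  by move: h1 h2; rewrite -/y; lra.
apply: (@no_injection_cantor N) => b b' NN; apply/funext => k0.
apply: contrapT => /eqP nk0.
have ex : exists k, b k != b' k by exists k0.
pose k := ex_minn ex.
have [bk kmin] : b k != b' k /\ forall j, (j < k)%N -> b j = b' j.
  rewrite /k; case: ex_minnP => k1 h1 h2; split=> // j jk; apply/eqP.
  by apply: contraTT jk => h; rewrite -leqNgt; exact: h2.
have pk : pre b k = pre b' k.
  have : forall j, (j <= k)%N -> pre b j = pre b' j.
    by elim=> [//|j IH] jk /=; rewrite kmin// IH// ltnW.
  exact.
move: bk; case E1: (b k); case E2: (b' k) => // _.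
  exact: (sep b b' k).
by apply: (sep b' b k).
Qed.

(** The sets [As k] decrease, and along [As k.+1] the oscillation at [x] is eventually at most
    [|x| / (k+1)]; a diagonal subsequence is therefore Cauchy at every point. *)
Lemma weak_star_subsequence : exists phi : nat -> nat,
  {homo phi : m n / (m < n)%N} /\ exists f : X -> R,
  [/\ linear_form f, forall x, `|f x| <= C * `|x| &
      forall x, (fun k => fn (phi k) x) @ \oo --> f x].
Proof.
have /choice[G GP] : forall t : set nat * nat, exists A', infinite_nat t.1 ->
    [/\ A' `<=` t.1, infinite_nat A' & small_osc A' (t.2.+1%:R)^-1].
  move=> [A k]; have [Ai|n] := pselect (infinite_nat A); last by exists A.
  have [|A' A'P] := small_osc_subset (_ : 0 < (k.+1%:R)^-1) Ai.
    by rewrite invr_gt0.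
  by exists A'.
pose As := fix As k : set nat := if k is k'.+1 then G (As k', k') else setT.
have AsI k : infinite_nat (As k).
  elim: k => [N|k IH]; first by exists N.
  by have [] := GP (As k, k) IH.
have AsS k j : As (j + k)%N `<=` As k.
  elim: j => [//|j IH] n; rewrite addSn => h; apply: IH.
  by have [h' _ _] := GP (As (j + k)%N, (j + k)%N) (AsI _); exact: h'.
have [phi phih phiA] := diagonal_subsequence AsI.
exists phi; split=> //.
have /choice[f fP] : forall x, exists l : R, (fun k => fn (phi k) x) @ \oo --> l.
  move=> x; apply: (@complete_seq_complete R^o) => eps e0.
  have x1 : 0 < 1 + `|x| by rewrite ltr_wpDr.
  have [k kP] := exists_inv_lt (divr_gt0 e0 x1).
  have [_ _ /(_ x)[N NP]] := GP (As k, k) (AsI k).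
  exists (maxn N k.+1) => m n; rewrite !geq_max => /andP[m1 m2] /andP[n1 n2].
  have inA j : (k.+1 <= j)%N -> As k.+1 (phi j).
    by move=> kj; have := phiA j; rewrite -{1}(subnK kj) => /AsS.
  apply: (le_trans (NP (phi m) (phi n) (inA _ m2) (inA _ n2) _ _)).
  - exact: leq_trans m1 (homo_ge_id _ phih).
  - exact: leq_trans n1 (homo_ge_id _ phih).
  apply: (@le_trans _ _ (eps / (1 + `|x|) * `|x|)).
    by apply: ler_wpM2r => //; rewrite ltW.
  by rewrite mulrAC ler_pdivrMr// ler_pM2l// lerDr.
exists f; split=> // [a x y|x].
  have h2 : (fun k => fn (phi k) (a *: x + y)) @ \oo --> a * f x + f y.
    have -> : (fun k => fn (phi k) (a *: x + y)) =
        (fun k => a * fn (phi k) x + fn (phi k) y).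
      by apply/funext => k; rewrite fn_lin.
    by apply: cvgD => //; apply: cvgM => //; exact: cvg_cst.
  exact: (cvg_unique (@norm_hausdorff _ _) (fP _) h2).
have c1 : (fun k => `|fn (phi k) x|) @ \oo --> `|f x| by exact: cvg_norm.
by apply: (cvg_ler c1 (cvg_cst (C * `|x|))) => k.
Qed.

End WeakStarCompactness.

(** * Separable duals for the real line and for products *)

Section DualSeparability.
Context {R : realType}.

Lemma real_dual_separable : dual_separable (R^o : normedModType R).
Proof.
move=> S [S0 [Sl _]] _.
exists (fun n (y : R^o) => ratr (odflt 0 (unpickle n : option rat)) * (y : R)); split.
  move=> n; split; first by move=> a x y _ _; rewrite mulrDr mulrCA.
  by eexists => y _; rewrite normrM.
move=> f fl _ eps e0.
have f0 : f 0 = 0.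
  by have := fl (-1) 0 0 S0 S0; rewrite scaler0 addr0; lra.
have [c cP] : exists c : R, forall y, S y -> f y = c * (y : R).
  have [[y0 [Sy0 y00]]|n] := pselect (exists y : R^o, S y /\ y != 0).
    exists (f y0 / y0) => y Sy.
    have := fl (y / y0) y0 0 Sy0 S0; rewrite addr0 f0 addr0.
    have -> : (y / y0 : R) *: y0 = y by rewrite /GRing.scale /= divfK.
    by move=> ->; rewrite mulrAC [RHS]mulrAC [f y0 * _]mulrC.
  exists 0 => y Sy; have [->|y0] := eqVneq y 0; first by rewrite f0 mulr0.
  by exfalso; apply: n; exists y.
have [r] : exists r : rat, ratr r \in `]c, c + eps[.
  by apply: rat_in_itvoo; rewrite ltrDl.
rewrite in_itv/= => /andP[r1 r2].
exists (pickle r) => y Sy; rewrite pickleK /= cP// -mulrBl normrM.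
by apply: ler_wpM2r => //; rewrite distrC gtr0_norm; lra.
Qed.

(** The subspace [S] need not be a product, so [(y.1, 0)] may lie outside it: [f] is extended to the
    whole space and then approximated on separable subspaces containing the two projections of
    [S]. *)
Lemma prod_dual_separable (V W : normedModType R) :
  dual_separable V -> dual_separable W -> dual_separable (V * W)%type.
Proof.
move=> dV dW S [S0 [Sl Sc]] [s [sS Sd]].
have [S1 [S1s S1p S1c]] := separable_subspace_containing (fun n => (s n).1).
have [S2 [S2s S2p S2c]] := separable_subspace_containing (fun n => (s n).2).
have SS1 z : S z -> S1 z.1.
  move=> /Sd/closure_normP h; apply: S1s.2.2; apply/closure_normP => eps e0.
  have [_ [n _ <-] zn] := h _ e0; exists (s n).1 => //.
  by apply: le_lt_trans zn; rewrite prod_normE le_max lexx.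
have SS2 z : S z -> S2 z.2.
  move=> /Sd/closure_normP h; apply: S2s.2.2; apply/closure_normP => eps e0.
  have [_ [n _ <-] zn] := h _ e0; exists (s n).2 => //.
  by apply: le_lt_trans zn; rewrite prod_normE le_max lexx orbT.
have n1 (z : V * W) : `|z.1| <= `|z| by rewrite prod_normE le_max lexx.
have n2 (z : V * W) : `|z.2| <= `|z| by rewrite prod_normE le_max lexx orbT.
have [f1 [f1P f1d]] := dV _ S1s S1p; have [f2 [f2P f2d]] := dW _ S2s S2p.
pose pr n := odflt (0%N, 0%N) (unpickle n : option (nat * nat)).
exists (fun n z => f1 (pr n).1 z.1 + f2 (pr n).2 z.2); split.
  move=> n; have [l1 [C1 b1]] := f1P (pr n).1; have [l2 [C2 b2]] := f2P (pr n).2.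
  split=> [a x y Sx Sy|].
    rewrite /= l1; [|exact: SS1|exact: SS1]; rewrite l2; [|exact: SS2|exact: SS2].
    by ring.
  exists (`|C1| + `|C2|) => y Sy; apply: (le_trans (ler_normD _ _)); rewrite mulrDl.
  apply: lerD.
    apply: (le_trans (b1 _ (SS1 _ Sy))); apply: (le_trans (ler_norm _)).
    by rewrite normrM normr_id; apply: ler_wpM2l.
  apply: (le_trans (b2 _ (SS2 _ Sy))); apply: (le_trans (ler_norm _)).
  by rewrite normrM normr_id; apply: ler_wpM2l.
move=> f fl [C fC] eps e0.
have ps : sublinear (fun z : V * W => `|C| * `|z|).
  split=> [x y|t x t0]; first by rewrite -mulrDr; apply: ler_wpM2l => //; exact: ler_normD.
  by rewrite normrZ ger0_norm// mulrCA.
have fC' x : S x -> f x <= `|C| * `|x|.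
  move=> Sx; apply: (le_trans (ler_norm _)); apply: (le_trans (fC _ Sx)).
  by apply: ler_wpM2r => //; exact: ler_norm.
have [F [Fl Fp FE]] := hahn_banach_ext ps S0 Sl fl fC'.
have Fn z : `|F z| <= `|C| * `|z|.
  rewrite ler_norml Fp andbT lerNl -(linear_formN _ Fl) -normrN; exact: Fp.
have e2 : 0 < eps / 2 by lra.
have [i iP] : exists n, forall y, S1 y -> `|F (y, 0) - f1 n y| <= eps / 2 * `|y|.
  apply: f1d => //.
    move=> a x y _ _; rewrite -Fl; congr F.
    by apply/eqP; rewrite xpair_eqE eqxx /= scaler0 addr0.
  by exists `|C| => y _; apply: (le_trans (Fn _)); rewrite prod_normE /= normr0
    max_l.
have [j jP] : exists n, forall y, S2 y -> `|F (0, y) - f2 n y| <= eps / 2 * `|y|.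
  apply: f2d => //.
    move=> a x y _ _; rewrite -Fl; congr F.
    by apply/eqP; rewrite xpair_eqE eqxx /= scaler0 addr0 eqxx.
  by exists `|C| => y _; apply: (le_trans (Fn _)); rewrite prod_normE /= normr0
    max_r.
exists (pickle (i, j)) => y Sy; rewrite /pr pickleK /=.
have -> : f y = F (y.1, 0) + F (0, y.2).
  rewrite -FE// -linear_formD//; congr F.
  by case: (y) => y1 y2; apply/eqP; rewrite xpair_eqE /= addr0 add0r !eqxx.
have h1 := iP _ (SS1 _ Sy); have h2 := jP _ (SS2 _ Sy).
have h3 : eps / 2 * `|y.1| <= eps / 2 * `|y| by rewrite ler_pM2l.
have h4 : eps / 2 * `|y.2| <= eps / 2 * `|y| by rewrite ler_pM2l.
have -> : F (y.1, 0) + F (0, y.2) - (f1 i y.1 + f2 j y.2) =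
  (F (y.1, 0) - f1 i y.1) + (F (0, y.2) - f2 j y.2) by ring.
apply: (le_trans (ler_normD _ _)); lra.
Qed.

End DualSeparability.

(** * Scalarization *)

Section Gerstewitz.
Context {R : realType} {Z : normedModType R}.

Lemma cone_add (K : set Z) x y : cvx_set K -> is_cone K -> K x -> K y -> K (x + y).
Proof.
move=> Kc Kk Kx Ky.
have h : 0 <= (2^-1 : R) <= 1 by rewrite invr_ge0 ler0n /= invf_le1// ler1n.
have := Kk 2 _ (ler0n _ _) (Kc x y 2^-1 Kx Ky h).
have -> : 1 - 2^-1 = 2^-1 :> R by field.
by rewrite -scalerDr scalerA divff ?scale1r.
Qed.

(* The function z |-> inf {t | t e - z \in K}. *)
Lemma scalarization (K : set Z) (e : Z) : cvx_set K -> is_cone K -> pointed K ->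
  interior K e -> ~ interior K 0 -> exists (phi : Z -> R) (c : R),
  [/\ sublinear phi, 0 < c, forall z, phi z <= c * `|z|,
      forall z, phi z < 0 -> interior K (- z) &
      [/\ forall z, K z -> phi (- z) <= 0, phi e <= 1 & phi (- e) <= -1]].
Proof.
move=> Kc Kk Kp /nbhs_normP[rho /= rho0 rhoK] nK0.
have KD x y := @cone_add K x y Kc Kk.
have Kew w : `|w| < rho -> K (e + w).
  by move=> wr; apply: rhoK; rewrite /ball_ /= opprD addNKr normrN.
have Ke : K e by have := Kew 0; rewrite addr0 normr0; exact.
have K0 : K 0 by have := Kk 0 e (lexx _) Ke; rewrite scale0r.
(* Otherwise pointedness gives [e = 0], making 0 interior. This exclusion is what bounds [A] from
   below. *)
have nKe : ~ K (- e).
  move=> KNe; have e0 := Kp _ Ke KNe; apply: nK0; rewrite -e0.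
  by apply/nbhs_normP; exists rho.
pose A z := [set t : R | K (t *: e - z)].
(* With this factor [z / (c |z|)] has norm [rho / 2], inside the ball that [e + w] may use. *)
pose c := 2 / rho.
have c0 : 0 < c by rewrite divr_gt0.
have Ac z : A z (c * `|z|).
  have [->|z0] := eqVneq z 0; first by rewrite normr0 mulr0 /A /= scale0r subr0.
  have zp : 0 < `|z| by rewrite normr_gt0.
  have t0 : 0 < c * `|z| by rewrite mulr_gt0.
  rewrite /A /=; have -> : (c * `|z|) *: e - z = (c * `|z|) *: (e - (c * `|z|)^-1 *: z).
    by rewrite scalerBr scalerA divff ?gt_eqF// scale1r.
  apply: Kk; first exact: ltW.
  apply: Kew; rewrite normrN normrZ normfV (gtr0_norm t0) invfM -mulrA mulVf ?gt_eqF//.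
  by rewrite mulr1 /c invf_div ltr_pdivrMr//; lra.
have pos t : K (t *: e) -> 0 <= t.
  move=> Kt; rewrite leNgt; apply/negP => t0; apply: nKe.
  have tn : 0 <= (- t)^-1 by rewrite invr_ge0; lra.
  have := Kk _ _ tn Kt; rewrite scalerA invrN mulNr mulVf ?scaleN1r//.
  by rewrite lt_eqF.
have lbA z t : A z t -> - (c * `|z|) <= t.
  move=> At; have := KD _ _ At (Ac (- z)); rewrite normrN opprK addrACA addNr addr0.
  by rewrite -scalerDl => /pos; lra.
have A00 : A 0 0 by rewrite /A /= scale0r subr0.
have sA : sublinear (fun z => inf (A z)).
  apply: (@sublinear_inf _ _ A (fun z => - (c * `|z|))) => //.
  - by move=> w; exists (c * `|w|).
  - move=> w w' t t' At At'; exists (t + t') => //.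
    by have := KD _ _ At At'; rewrite /A /= addrACA -scalerDl -opprD.
  - move=> t w r t0 Ar; exists (t * r) => //; rewrite /A /= -scalerA -scalerBr.
    by apply: Kk => //; exact: ltW.
  - by rewrite normr0 mulr0 oppr0.
exists (fun z => inf (A z)), c; split=> //.
- by move=> z; exact: (inf_le_mem (lbA z) (Ac z)).
- move=> z zn.
  have [|t At tn] := inf_approx (ex_intro _ _ (Ac z)) (lbA z) (_ : 0 < - inf (A z)).
    by lra.
  rewrite addrN in tn.
  apply/nbhs_normP; exists (- t * rho); first by rewrite /= mulr_gt0//; lra.
  move=> y; rewrite /= -opprD normrN addrC => yz.
  have nt : 0 < - t by lra.
  (* A point of [K] plus the positive multiple [- t] of a point near [e]: these sums fill a ball of
     radius [- t * rho] around [- z]. *)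
  have -> : y = (t *: e - z) + (- t) *: (e + (- t)^-1 *: (y + z)).
    rewrite scalerDr scalerA divff ?gt_eqF// scale1r scaleNr addrACA subrr add0r.
    by rewrite addrC addrK.
  apply: KD => //; apply: Kk; first exact: ltW.
  by apply: Kew; rewrite normrZ normfV (gtr0_norm nt) mulrC ltr_pdivrMr// mulrC.
split.
- move=> z Kz; apply: (inf_le_mem (lbA _)).
  by rewrite /A /= scale0r opprK add0r.
- apply: (inf_le_mem (lbA _)); by rewrite /A /= scale1r subrr.
- apply: (inf_le_mem (lbA _)); by rewrite /A /= scaleN1r opprK addNr.
Qed.

End Gerstewitz.

(** * Strictly Lipschitz maps *)

Section Subsequences.
Context {R : realType} {V : normedModType R}.

Lemma cvg_subseq (u : nat -> V) (l : V) (phi : nat -> nat) :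
  {homo phi : m n / (m < n)%N} -> u @ \oo --> l -> (fun k => u (phi k)) @ \oo --> l.
Proof.
move=> ph /cvg_seqP ul; apply/cvg_seqP => eps e0; have [N NP] := ul _ e0.
by exists N => n Nn; apply: NP; apply: leq_trans Nn (homo_ge_id _ ph).
Qed.

Lemma cvg_of_bound (u : nat -> V) (l : V) (C : R) (d : nat -> R) :
  d @ \oo --> (0 : R) -> (forall k, `|u k - l| <= C * d k) -> u @ \oo --> l.
Proof.
move=> d0 ud; apply/cvg_seqP => eps e0.
have c0 : (fun k => C * d k) @ \oo --> (0 : R).
  by rewrite -(mulr0 C); apply: cvgM => //; exact: cvg_cst.
have [N NP] := (cvg_seqP (V := R^o) (fun k => C * d k) 0).1 c0 _ e0.
exists N => n Nn; apply: (le_trans (ud n)); apply: (le_trans (ler_norm _)).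
by have := NP n Nn; rewrite subr0.
Qed.

End Subsequences.

(** * Subgradients along weak-star null multipliers *)

Section StrictlyLipschitz.
Context {R : realType} {X Z : normedModType R}.

Definition scalar_fsubgrad (h : X -> Z) (x : X) (zeta : Z -> R) (xi : X -> R) : Prop :=
  forall eps : R, 0 < eps -> exists2 delta : R, 0 < delta &
    forall x', `|x' - x| < delta -> xi (x' - x) - zeta (h x' - h x) <= eps * `|x' - x|.

Lemma inv_cvg0 : (fun k : nat => (k.+1%:R : R)^-1) @ \oo --> (0 : R).
Proof. exact: cvg_harmonic. Qed.

(** For short steps the subgradient inequality bounds [bs k v] by [zs k] at a difference quotient of
    [h]. Some subsequence of the quotients converges in norm, and on a norm convergent sequence
    bounded weak-star null functionals tend to 0. *)
Lemma strictly_lipschitz_subgrad0 (h : X -> Z) (xbar : X) (C : R)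
    (vs : nat -> X) (zs : nat -> Z -> R) (bs : nat -> X -> R) :
  strictly_lipschitz h xbar -> vs @ \oo --> xbar ->
  (forall k, linear_form (zs k)) -> (forall k z, `|zs k z| <= C * `|z|) ->
  (forall z, (fun k => zs k z) @ \oo --> (0 : R)) ->
  (forall k, linear_form (bs k)) -> (forall k, scalar_fsubgrad h (vs k) (zs k) (bs k)) ->
  forall v, (fun k => bs k v) @ \oo --> (0 : R).
Proof.
move=> [_ [V0 [V0n V0P]]] vsc zl zC z0 bl bsub.
have [d0 d00 d0P] := (nbhs_normP _ _).1 V0n.
have up v : `|v| < d0 -> forall eps : R, 0 < eps ->
    exists N : nat, forall k, (N <= k)%N -> bs k v <= eps.
  move=> vd eps e0; apply: contrapT => nN.
  pose A := [set k | eps < bs k v].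
  have Ai : infinite_nat A.
    move=> N; apply: contrapT => nA; apply: nN; exists N => k Nk.
    by rewrite leNgt; apply/negP => h'; apply: nA; exists k.
  have [psi psih psiA] := @diagonal_subsequence (fun=> A) (fun=> Ai).
  have v1 : 0 < 1 + `|v| by rewrite ltr_wpDr.
  have e2 : 0 < eps / 2 by lra.
  pose qt k t := t^-1 *: (h (vs (psi k) + t *: v) - h (vs (psi k))).
  (* The step is so short that the subgradient error, divided by [t], is at most [eps / 2]. *)
  have /choice[ts tsP] : forall k : nat, exists t : R, [/\ 0 < t, t <= (k.+1%:R)^-1 &
      bs (psi k) v <= zs (psi k) (qt k t) + eps / 2].
    move=> k; have [dl dl0 dlP] := bsub (psi k) _ (divr_gt0 e2 v1).
    have k0 : 0 < (k.+1%:R : R)^-1 by rewrite invr_gt0.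
    have dv := divr_gt0 dl0 v1.
    pose t := Num.min (k.+1%:R)^-1 (dl / (1 + `|v|) / 2).
    have t0 : 0 < t by rewrite lt_min k0 divr_gt0.
    have tv : `|vs (psi k) + t *: v - vs (psi k)| < dl.
      rewrite addrC addKr normrZ (gtr0_norm t0).
      apply: (@le_lt_trans _ _ (dl / (1 + `|v|) / 2 * (1 + `|v|))).
        apply: ler_pM => //; first exact: ltW.
          by rewrite /t ge_min lexx orbT.
        by rewrite lerDr.
      by rewrite mulrAC divfK ?gt_eqF//; lra.
    exists t; split=> //; first by rewrite /t ge_min lexx.
    have := dlP _ tv; have -> : vs (psi k) + t *: v - vs (psi k) = t *: v.
      by rewrite addrC addKr.
    rewrite (linear_formZ _ _ (bl _)) normrZ (gtr0_norm t0) => hh.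
    have ev : eps / 2 / (1 + `|v|) * `|v| <= eps / 2.
      by rewrite mulrAC ler_pdivrMr// ler_pM2l// lerDr.
    rewrite /qt (linear_formZ _ _ (zl _)) -(@ler_pM2l _ t)// mulrDr mulrA divff ?gt_eqF// mul1r.
    have : t * (eps / 2 / (1 + `|v|) * `|v|) <= t * (eps / 2) by rewrite ler_pM2l.
    move: hh; rewrite [_ * (t * _)]mulrCA; lra.
  have [||||phi [phih [l lP]]] := V0P v _ (fun k => vs (psi k)) ts.
  - by apply: d0P; rewrite /ball_ /= sub0r normrN.
  - exact: cvg_subseq.
  - by move=> k; have [] := tsP k.
  - apply: (cvg_of_bound (V := R^o) (C := 1) inv_cvg0) => k.
    by have [h1 h2 _] := tsP k; rewrite subr0 gtr0_norm// mul1r.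
  have c1 : (fun k => `|zs (psi (phi k)) l|) @ \oo --> (0 : R).
    rewrite -(@normr0 _ R); apply: cvg_norm.
    exact: (cvg_subseq (V := R^o) phih (cvg_subseq (V := R^o) psih (z0 l))).
  have c2 : (fun k => `|qt (phi k) (ts (phi k)) - l|) @ \oo --> (0 : R).
    rewrite -(@normr0 _ Z) -(subrr l); apply: cvg_norm; apply: cvgB => //.
    exact: cvg_cst.
  have c3 : (fun k => `|zs (psi (phi k)) l| + C * `|qt (phi k) (ts (phi k)) - l|
      + eps / 2) @ \oo --> 0 + C * 0 + eps / 2.
    apply: cvgD; last exact: cvg_cst.
    by apply: cvgD => //; apply: cvgM => //; exact: cvg_cst.
  suff hh : forall k, eps <= `|zs (psi (phi k)) l| + C * `|qt (phi k) (ts (phi k)) - l| + eps / 2.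
    have : eps <= 0 + C * 0 + eps / 2 by apply: (cvg_ler (cvg_cst eps) c3).
    by rewrite mulr0; lra.
  move=> k; have [_ _ h2] := tsP (phi k); apply: (le_trans (ltW (psiA (phi k)))).
  apply: (le_trans h2); rewrite lerD2r.
  rewrite -[X in zs _ X](subrK l) (linear_formD _ _ (zl _)) addrC.
  by apply: lerD; [exact: ler_norm|apply: le_trans (ler_norm _) (zC _ _)].
have loc v : `|v| < d0 -> (fun k => bs k v) @ \oo --> (0 : R).
  move=> vd; apply/(cvg_seqP (V := R^o)) => eps e0.
  have [N1 N1P] := up v vd eps e0.
  have [|N2 N2P] := up (- v) _ eps e0; first by rewrite normrN.
  exists (maxn N1 N2) => k; rewrite geq_max => /andP[k1 k2].
  rewrite subr0 ler_norml N1P// andbT lerNl -(linear_formN _ (bl k)); exact: N2P.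
move=> v.
have v1 : 0 < 1 + `|v| by rewrite ltr_wpDr.
pose c := d0 / (1 + `|v|) / 2.
have c0 : 0 < c by rewrite !divr_gt0.
have cv : `|c *: v| < d0.
  rewrite normrZ (gtr0_norm c0); apply: (@le_lt_trans _ _ (c * (1 + `|v|))).
    by rewrite ler_pM2l// lerDr.
  by rewrite /c mulrAC divfK ?gt_eqF//; rewrite /= in d00; lra.
have -> : (fun k => bs k v) = (fun k => c^-1 * bs k (c *: v)).
  by apply/funext => k; rewrite (linear_formZ _ _ (bl k)) mulrA mulVf ?gt_eqF// mul1r.
by rewrite -(mulr0 c^-1); apply: cvgM; [exact: cvg_cst|exact: loc].
Qed.

End StrictlyLipschitz.

(** * Linear and sublinear forms on products *)

Section ProductForms.
Context {R : realType}.

Lemma le_epsM (x y c : R) : 0 <= c -> (forall eps : R, 0 < eps -> x <= y + c * eps) ->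
  x <= y.
Proof.
move=> c0 H; apply: le_eps => eps e0.
have c1 : 0 < 1 + c by lra.
apply: (le_trans (H _ (divr_gt0 e0 c1))); rewrite lerD2l mulrCA ler_piMr ?(ltW e0)//.
by rewrite ler_pdivrMr//; lra.
Qed.

Lemma norm_fst (V W : normedModType R) (z : V * W) : `|z.1| <= `|z|.
Proof. by rewrite prod_normE le_max lexx. Qed.

Lemma norm_snd (V W : normedModType R) (z : V * W) : `|z.2| <= `|z|.
Proof. by rewrite prod_normE le_max lexx orbT. Qed.

Lemma norm_pair_le (V W : normedModType R) (z : V * W) (c : R) :
  `|z.1| <= c -> `|z.2| <= c -> `|z| <= c.
Proof. by move=> h1 h2; rewrite prod_normE ge_max h1. Qed.

Lemma linear_form_pair (V W : lmodType R) (nu : V * W -> R) z : linear_form nu ->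
  nu z = nu (z.1, 0) + nu (0, z.2).
Proof.
move=> nl; rewrite -linear_formD//; congr nu.
by case: z => x y; apply/eqP; rewrite xpair_eqE /= addr0 add0r !eqxx.
Qed.

Lemma linear_form_fst (V W : lmodType R) (nu : V * W -> R) : linear_form nu ->
  linear_form (fun x => nu (x, 0)).
Proof.
move=> nl a x y; rewrite -nl; congr nu.
by apply/eqP; rewrite xpair_eqE eqxx /= scaler0 addr0.
Qed.

Lemma linear_form_snd (V W : lmodType R) (nu : V * W -> R) : linear_form nu ->
  linear_form (fun y => nu (0, y)).
Proof.
move=> nl a x y; rewrite -nl; congr nu.
by apply/eqP; rewrite xpair_eqE eqxx /= scaler0 addr0 eqxx.
Qed.

Lemma linear_form_opp (V : lmodType R) (f : V -> R) : linear_form f ->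
  linear_form (fun x => - f x).
Proof. by move=> fl a x y; rewrite fl; ring. Qed.

Lemma sublinearD (V : lmodType R) (p q : V -> R) : sublinear p -> sublinear q ->
  sublinear (fun x => p x + q x).
Proof.
move=> sp sq; split=> [x y|t x t0]; last by rewrite sp.2// sq.2// mulrDr.
by have := sp.1 x y; have := sq.1 x y; lra.
Qed.

Lemma sublinearZ (V : lmodType R) (c : R) (p : V -> R) : 0 <= c -> sublinear p ->
  sublinear (fun x => c * p x).
Proof.
move=> c0 sp; split=> [x y|t x t0]; last by rewrite sp.2// mulrCA.
by rewrite -mulrDr; apply: ler_wpM2l => //; exact: sp.1.
Qed.

Lemma sublinear_comp (V W : lmodType R) (p : W -> R) (l : V -> W) : sublinear p ->
  (forall x y, l (x + y) = l x + l y) -> (forall t x, l (t *: x) = t *: l x) ->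
  sublinear (fun x => p (l x)).
Proof.
by move=> sp lD lZ; split=> [x y|t x t0]; [rewrite lD; exact: sp.1|rewrite lZ sp.2].
Qed.

Lemma linear_form_sublinear (V : lmodType R) (f : V -> R) : linear_form f -> sublinear f.
Proof.
move=> fl; split=> [x y|t x t0]; first by rewrite linear_formD.
by rewrite linear_formZ.
Qed.

Lemma fnormal_scale (V : normedModType R) (Om : set V) (x : V) (f g : V -> R) (c : R) :
  0 < c -> fnormal Om x f -> (forall y, g y = c * f y) -> fnormal Om x g.
Proof.
move=> c0 [[fl fc] fN] gE.
have -> : g = (fun y => c * f y) by exact/funext.
split.
  split; first by move=> a y z; rewrite fl; ring.
  by move=> y; apply: cvgM; [exact: cvg_cst|exact: fc].
move=> eps e0; have [dl dl0 dlP] := fN _ (divr_gt0 e0 c0); exists dl => // u Omu ud.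
have : c * f (u - x) <= c * (eps / c * `|u - x|) by rewrite ler_pM2l//; exact: dlP.
by rewrite mulrA [c * (eps / c)]mulrC divfK ?gt_eqF.
Qed.

End ProductForms.

(** * A fuzzy sum rule for scalarized maps *)

Section SubdifferentialTransfer.
Context {R : realType} {X Z : normedModType R}.
(** The scalarization by [zeta] is the sum of those by [zst] and by [zeta - zst]. Each summand gets
    its own variable, through an epigraph and through the graph of [h], and the distance of the two
    variables is penalized; the components of a normal then belong to the separate summands. *)
Lemma split_scalar_subgrad (h : X -> Z) (xbar : X) (rho Lh C : R)
    (zst : Z -> R) (x : X) (zeta : Z -> R) (xi : X -> R) (gam : R) :
  0 <= Lh -> 0 <= C ->
  (forall a b, `|a - xbar| <= rho -> `|b - xbar| <= rho ->
    `|h a - h b| <= Lh * `|a - b|) ->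
  seq_complete X -> seq_complete Z -> dual_separable X -> dual_separable Z ->
  linear_form zst -> (forall z, `|zst z| <= C * `|z|) ->
  linear_form zeta -> (forall z, `|zeta z| <= C * `|z|) ->
  linear_form xi -> (forall u, `|xi u| <= C * `|u|) ->
  `|x - xbar| < rho -> scalar_fsubgrad h x zeta xi -> 0 < gam -> gam < 1 ->
  exists (w : X * R^o) (v : X) (a : X -> R) (b : X -> R) (z' : Z -> R),
  [/\ epi (fun x => zst (h x)) w, `|w.1 - x| <= gam /\ `|w.2 - zst (h x)| <= gam,
      exists2 th : R, `|th - 1| <= gam &
        fnormal (epi (fun x => zst (h x))) w (fun q => a q.1 - th * q.2),
      `|v - x| <= gam /\ scalar_fsubgrad h v z' b &
      [/\ linear_form b, linear_form z',
          forall z, `|z' z - (zeta z - zst z)| <= gam * `|z| &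
          forall u, `|a u + b u - xi u| <= gam * `|u|]].
Proof.
move=> Lh_ge0 C_ge0 h_lip X_complete Z_complete X_dual Z_dual.
move=> zl zC zetal zetaC xil xiC xr xsub g0 g1.
have g4 : 0 < gam / 4 by lra.
have [d1 d10 d1P] := xsub _ g4.
pose r := Num.min (d1 / 2) (rho - `|x - xbar|).
have r0 : 0 < r by rewrite lt_min divr_gt0// subr_gt0.
have rd1 : r < d1 by apply: (@le_lt_trans _ _ (d1 / 2)); [rewrite /r ge_min lexx|lra].
have rball u : `|u - x| <= r -> `|u - xbar| <= rho.
  move=> ur; have -> : u - xbar = (u - x) + (x - xbar) by rewrite subrKA.
  apply: (le_trans (ler_normD _ _)).
  have : r <= rho - `|x - xbar| by rewrite /r ge_min lexx orbT.
  lra.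
pose E := ((X * R^o) * (X * Z))%type.
pose Th : set E := [set e | [/\ `|e.1.1 - x| <= r, zst (h e.1.1) <= e.1.2,
  `|e.2.1 - x| <= r & e.2.2 = h e.2.1]].
(* A Lipschitz constant of [zst (h x) - xi x], so that identifying the two variables costs at most
   the penalty. *)
pose D := C * Lh + C.
have D0 : 0 <= D by rewrite addr_ge0// mulr_ge0.
pose s (e : E) : R := - e.1.2 + (- (zeta e.2.2 - zst e.2.2)) + xi e.1.1
  + gam / 4 * `|e.2.1| + D * `|e.1.1 - e.2.1|.
have ss : sublinear s.
  apply: sublinearD; last first.
    apply: sublinearZ => //; apply: (sublinear_comp (l := fun e : E => e.1.1 - e.2.1)).
    - exact: norm_sublinear.
    - by move=> e e'; rewrite /= opprD addrACA.
    - by move=> t e; rewrite /= scalerBr.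
  apply: sublinearD; last first.
    apply: sublinearZ; first exact: ltW.
    by apply: (sublinear_comp (l := fun e : E => e.2.1)) => //; exact: norm_sublinear.
  apply: linear_form_sublinear => t e e' /=.
  rewrite xil zetal zl /GRing.scale /=; ring.
have n11 (e : E) : `|e.1.1| <= `|e| := le_trans (norm_fst _) (norm_fst _).
have n12 (e : E) : `|e.1.2| <= `|e| := le_trans (norm_snd _) (norm_fst _).
have n21 (e : E) : `|e.2.1| <= `|e| := le_trans (norm_fst _) (norm_snd _).
have n22 (e : E) : `|e.2.2| <= `|e| := le_trans (norm_snd _) (norm_snd _).
have sC e : s e <= (1 + C + C + C + gam / 4 + D + D) * `|e|.
  have h1 := le_trans (ler_norm (- e.1.2)) (_ : `|- e.1.2| <= `|e|).
  have {}h1 : - e.1.2 <= `|e| by apply: h1; rewrite normrN.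
  have h2 : - zeta e.2.2 <= C * `|e|.
    apply: (le_trans (ler_norm _)); rewrite normrN; apply: (le_trans (zetaC _)).
    exact: ler_wpM2l.
  have h3 : zst e.2.2 <= C * `|e|.
    apply: (le_trans (ler_norm _)); apply: (le_trans (zC _)); exact: ler_wpM2l.
  have h4 : xi e.1.1 <= C * `|e|.
    apply: (le_trans (ler_norm _)); apply: (le_trans (xiC _)); exact: ler_wpM2l.
  have h5 : gam / 4 * `|e.2.1| <= gam / 4 * `|e| by rewrite ler_pM2l.
  have h6 : D * `|e.1.1 - e.2.1| <= D * (`|e| + `|e|).
    apply: ler_wpM2l => //; apply: (le_trans (ler_normB _ _)); exact: lerD.
  by rewrite /s; clear -h1 h2 h3 h4 h5 h6; lra.
pose e0 : E := ((x, zst (h x) : R^o), (x, h x)).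
have Th0 : Th e0 by split=> //=; rewrite subrr normr0 ltW.
have Thmin e : Th e -> 0 <= s (e0 - e).
  move=> [e1 e2 e3 e4].
  have := d1P e.2.1 (le_lt_trans e3 rd1).
  have hl := h_lip _ _ (rball _ e3) (rball _ e1).
  have z1 : zst (h e.2.1) - zst (h e.1.1) <= C * Lh * `|e.1.1 - e.2.1|.
    rewrite -(linear_formB _ _ zl); apply: (le_trans (ler_norm _)); apply: (le_trans (zC _)).
    by rewrite -mulrA [`|e.1.1 - _|]distrC; apply: ler_wpM2l.
  have x1 : xi e.1.1 - xi e.2.1 <= C * `|e.1.1 - e.2.1|.
    by rewrite -linear_formB//; apply: (le_trans (ler_norm _)).
  have dE : x - e.1.1 - (x - e.2.1) = - (e.1.1 - e.2.1).
    by rewrite opprB addrC subrKA opprB.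
  rewrite /s /= e4 (linear_formB _ _ zetal) !(linear_formB _ _ zl) dE normrN.
  rewrite [`|x - _|]distrC !(linear_formB _ _ xil) (linear_formB _ _ zetal) /D.
  by clear -e2 z1 x1; lra.
have Thc : closed Th.
  move=> e /closure_normP cle.
  have h1 : `|e.1.1 - x| <= r.
    apply: le_eps => eps ep; have [e' [c1 _ _ _] ee] := cle _ ep.
    have -> : e.1.1 - x = (e - e').1.1 + (e'.1.1 - x) by rewrite /= subrKA.
    apply: (le_trans (ler_normD _ _)); have := n11 (e - e'); move: ee c1; clear; lra.
  have h3 : `|e.2.1 - x| <= r.
    apply: le_eps => eps ep; have [e' [_ _ c3 _] ee] := cle _ ep.
    have -> : e.2.1 - x = (e - e').2.1 + (e'.2.1 - x) by rewrite /= subrKA.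
    apply: (le_trans (ler_normD _ _)); have := n21 (e - e'); move: ee c3; clear; lra.
  split=> //.
    apply: (@le_epsM _ _ _ (1 + C * Lh)); first by rewrite addr_ge0// mulr_ge0.
    move=> eps ep; have [e' [c1 c2 _ _] ee] := cle _ ep.
    have hl := h_lip _ _ (rball _ h1) (rball _ c1).
    have z1 : zst (h e.1.1) - zst (h e'.1.1) <= C * Lh * eps.
      rewrite -(linear_formB _ _ zl); apply: (le_trans (ler_norm _)); apply: (le_trans (zC _)).
      rewrite -mulrA; apply: ler_wpM2l => //; apply: (le_trans hl).
      apply: ler_wpM2l => //; apply: (le_trans (n11 (e - e'))); exact: ltW.
    have := le_trans (ler_norm _) (n12 (e' - e)); rewrite [`|e' - e|]distrC /=.
    by move: z1 c2 ee; clear; lra.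
  apply/eqP; rewrite -subr_eq0 -normr_le0.
  apply: (@le_epsM _ _ _ (1 + Lh)); first by rewrite addr_ge0.
  move=> eps ep; have [e' [_ _ c3 c4] ee] := cle _ ep.
  have hl := h_lip _ _ (rball _ c3) (rball _ h3); rewrite add0r.
  have -> : e.2.2 - h e.2.1 = (e - e').2.2 + (h e'.2.1 - h e.2.1).
    by rewrite /= c4 subrKA.
  apply: (le_trans (ler_normD _ _)); rewrite mulrDl mul1r; apply: lerD.
    by apply: (le_trans (n22 _)); exact: ltW.
  apply: (le_trans hl); apply: ler_wpM2l => //; rewrite distrC.
  by apply: (le_trans (n21 (e - e'))); exact: ltW.
(* [g' <= r / 2] keeps the ball constraints inactive near [e], so that normals of [Th] come from the
   epigraph and the graph. *)
pose g' := Num.min (gam / 4) (r / 2).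
have g'0 : 0 < g' by rewrite lt_min g4 divr_gt0.
have g'g : g' <= gam / 4 by rewrite /g' ge_min lexx.
have g'r : g' <= r / 2 by rewrite /g' ge_min lexx orbT.
have Ec : seq_complete E.
  apply: prod_seq_complete; apply: prod_seq_complete => //; exact: (@complete_seq_complete R R^o).
have Ed : dual_separable E.
  apply: prod_dual_separable; apply: prod_dual_separable => //; exact: real_dual_separable.
have [e [nu [The ee0 [[nul nuc] nuN] nus]]] :=
  normal_at_minimizer Ec Ed Thc ss sC Th0 Thmin g'0.
have [t1 t2 t3 t4] := The.
pose a u := nu ((u, 0), (0, 0)); pose th := - nu ((0, 1), (0, 0)).
pose b v := nu ((0, 0), (v, 0)); pose z' z := - nu ((0, 0), (0, z)).
have nu1l := linear_form_fst nul; have nu2l := linear_form_snd nul.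
have al : linear_form a by exact: (linear_form_fst nu1l).
have bl : linear_form b by exact: (linear_form_fst nu2l).
have z'l : linear_form z' by apply: linear_form_opp; exact: (linear_form_snd nu2l).
have nuE (q : E) : nu q = a q.1.1 - th * q.1.2 + (b q.2.1 - z' q.2.2).
  rewrite (linear_form_pair q nul) (linear_form_pair q.1 nu1l) (linear_form_pair q.2 nu2l).
  rewrite /a /th /b /z' opprK; congr (_ + _ + _).
  rewrite mulNr opprK; have := linear_formZ q.1.2 (1 : R^o) (linear_form_snd nu1l).
  by rewrite /GRing.scale /= mulr1 mulrC.
have le11 := le_lt_trans (n11 _) ee0; have le12 := le_lt_trans (n12 _) ee0.
have le21 := le_lt_trans (n21 _) ee0.
rewrite /= in le11 le12 le21.
have b0 : b 0 = 0 := linear_form0 bl. have z'0 : z' 0 = 0 := linear_form0 z'l.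
have a0 : a 0 = 0 := linear_form0 al.
have xi0 : xi 0 = 0 := linear_form0 xil.
have zeta0 : zeta 0 = 0 := linear_form0 zetal.
have zst0 : zst 0 = 0 := linear_form0 zl.
exists e.1, e.2.1, a, b, z'; split.
- exact: t2.
- by split; move: le11 le12 g'g g0; clear; lra.
- exists th.
    have n01 : `|((0, 1), (0, 0)) : E| <= 1.
      by apply: norm_pair_le; apply: norm_pair_le; rewrite /= ?normr0 ?normr1.
    have n0N1 : `|((0, -1), (0, 0)) : E| <= 1.
      by apply: norm_pair_le; apply: norm_pair_le; rewrite /= ?normr0 ?normrN ?normr1.
    have m1 := nus ((0, 1), (0, 0)); have m2 := nus ((0, -1), (0, 0)).
    have k1 := ler_wpM2l (ltW g'0) n01; have k2 := ler_wpM2l (ltW g'0) n0N1.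
    move: m1 m2; rewrite !nuE /s /= a0 b0 z'0 xi0 zeta0 zst0 !subrr !normr0 => m1 m2.
    by rewrite ler_norml; apply/andP; split; move: m1 m2 k1 k2 g'g g0; clear; lra.
  split.
    apply: (clin_of_le (C := 1 + C + C + C + gam / 4 + D + D + g')).
      by move=> t q q'; rewrite /= al /GRing.scale /=; ring.
    move=> q; have := nus (q, 0); have := sC (q, 0); rewrite nuE /= b0 z'0 !subr0 addr0.
    have -> : `|(q, 0) : E| = `|q| by rewrite prod_normE /= normr0 max_l.
    by clear; lra.
  move=> eps ep; have [dl dl0 dlP] := nuN _ ep.
  exists (Num.min dl (r / 2)); first by rewrite lt_min dl0 divr_gt0.
  move=> u epu; rewrite lt_min => /andP[u1 u2].
  have The' : Th (u, e.2).
    split=> //=; have -> : u.1 - x = (u - e.1).1 + (e.1.1 - x) by rewrite /= subrKA.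
    by apply: (le_trans (ler_normD _ _)); have := norm_fst (u - e.1);
      move: u2 le11 g'r; clear; lra.
  have ne : `|((u, e.2) : E) - e| = `|u - e.1|.
    by rewrite prod_normE /= subrr normr0 max_l.
  have := dlP _ The'; rewrite ne => /(_ u1).
  by rewrite nuE /= !subrr b0 z'0 subrr addr0.
- split; first by move: le21 g'g g0; clear; lra.
  move=> eps ep.
  have L1 : 0 < 1 + Lh by rewrite ltr_wpDr.
  have [dl dl0 dlP] := nuN _ (divr_gt0 ep L1).
  exists (Num.min (dl / (1 + Lh)) (r / 2)); first by rewrite lt_min !divr_gt0.
  move=> x'; rewrite lt_min => /andP[u1 u2].
  have x'r : `|x' - x| <= r.
    have -> : x' - x = (x' - e.2.1) + (e.2.1 - x) by rewrite subrKA.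
    by apply: (le_trans (ler_normD _ _)); move: u2 le21 g'r; clear; lra.
  have The' : Th (e.1, (x', h x')) by split.
  have hl := h_lip _ _ (rball _ x'r) (rball _ t3).
  have ne : `|((e.1, (x', h x')) : E) - e| <= (1 + Lh) * `|x' - e.2.1|.
    apply: norm_pair_le; rewrite /=.
      by rewrite subrr normr0 mulr_ge0// ltW.
    rewrite mulrDl mul1r; apply: norm_pair_le => /=.
      by rewrite lerDl mulr_ge0.
    rewrite t4; apply: (le_trans hl); by rewrite lerDr.
  have := dlP _ The'; rewrite nuE /= !subrr a0 mulr0 subr0 add0r t4 => hh.
  apply: (le_trans (hh _)).
    by apply: (le_lt_trans ne); rewrite mulrC -ltr_pdivlMr.
  apply: (le_trans (ler_wpM2l (ltW (divr_gt0 ep L1)) ne)).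
  by rewrite mulrA divfK ?gt_eqF.
- split=> // [z|u].
    have zz w : - z' w <= - (zeta w - zst w) + g' * `|w|.
      have := nus ((0, 0), (0, w)); rewrite nuE /s /= a0 b0 xi0 mulr0 !subrr !normr0.
      have -> : `|((0, 0), (0, w)) : E| = `|w|.
        by rewrite !prod_normE /= !normr0 !max_r// ge_max.
      by rewrite !mulr0; clear; lra.
    have k1 := zz z; have k2 := zz (- z).
    move: k2; rewrite (linear_formN _ z'l) (linear_formN _ zetal) (linear_formN _ zl) normrN => k2.
    have : g' * `|z| <= gam * `|z|.
      by apply: ler_wpM2r => //; move: g'g g0; clear; lra.
    by move=> k3; rewrite ler_norml; apply/andP; split; move: k1 k2 k3; clear; lra.
  (* Along the diagonal the penalty with factor [D] vanishes. *)
  have uu w : a w + b w <= xi w + gam / 4 * `|w| + g' * `|w|.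
    have nw : `|((w, 0), (w, 0)) : E| <= `|w|.
      by apply: norm_pair_le; apply: norm_pair_le; rewrite /= ?normr0.
    have := nus ((w, 0), (w, 0)); have := ler_wpM2l (ltW g'0) nw.
    rewrite nuE /s /= z'0 zeta0 zst0 !subrr normr0 !mulr0 oppr0.
    by clear; lra.
  have k1 := uu u; have k2 := uu (- u).
  move: k2; rewrite (linear_formN _ al) (linear_formN _ bl) (linear_formN _ xil) normrN => k2.
  have : g' * `|u| <= gam / 4 * `|u| by apply: ler_wpM2r.
  have : 0 <= gam * `|u| by rewrite mulr_ge0// ltW.
  by move=> k3 k4; rewrite ler_norml; apply/andP; split;
    move: k1 k2 k3 k4; clear; lra.
Qed.

End SubdifferentialTransfer.

(** * Passage to the limiting subdifferential *)

Section LimitingSubgradient.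
Context {R : realType} {X Z : normedModType R}.
Variables (h : X -> Z) (xbar : X) (rho Lh C : R).
Hypothesis rho_gt0 : 0 < rho.
Hypothesis Lh_ge0 : 0 <= Lh.
Hypothesis C_ge0 : 0 <= C.
Hypothesis h_lip : forall a b, `|a - xbar| <= rho -> `|b - xbar| <= rho ->
  `|h a - h b| <= Lh * `|a - b|.
Hypothesis X_complete : seq_complete X.
Hypothesis Z_complete : seq_complete Z.
Hypothesis X_dual : dual_separable X.
Hypothesis Z_dual : dual_separable Z.

(** Splitting isolates a part carried by functionals close to [zk k - zst], bounded and weak-star
    null. Strict Lipschitz continuity sends its subgradients [b k] to 0, so the epigraphical parts
    [a k] converge to [xi]. *)
Lemma limiting_subgradient (zst : Z -> R) (xi : X -> R) (xk : nat -> X)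
    (zk : nat -> Z -> R) (xik : nat -> X -> R) :
  strictly_lipschitz h xbar ->
  linear_form zst -> (forall z, `|zst z| <= C * `|z|) ->
  linear_form xi -> (forall u, `|xi u| <= C * `|u|) ->
  (forall k, linear_form (zk k)) -> (forall k z, `|zk k z| <= C * `|z|) ->
  (forall k, linear_form (xik k)) -> (forall k u, `|xik k u| <= C * `|u|) ->
  (forall k, `|xk k - xbar| < rho) -> xk @ \oo --> xbar ->
  (forall z, (fun k => zk k z) @ \oo --> zst z) ->
  (forall u, (fun k => xik k u) @ \oo --> xi u) ->
  (forall k, scalar_fsubgrad h (xk k) (zk k) (xik k)) ->
  lsubdiff (fun x => zst (h x)) xbar xi.
Proof.
move=> hs zl zC xil xiC zkl zkC xikl xikC xkr xkc zkc xikc ksub.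
(* The shift by two gives [gam k < 1] also at [k = 0], whence [th k > 0]. *)
pose gam (k : nat) : R := (k.+2%:R)^-1.
have gam0 k : 0 < gam k by rewrite invr_gt0.
have gam1 k : gam k < 1 by rewrite invf_lt1// ltr1n.
have gamc : gam @ \oo --> (0 : R).
  exact: (cvg_subseq (V := R^o) (phi := S) _ inv_cvg0).
have : forall k, exists t : (X * R^o) * X * (X -> R) * (X -> R) * (Z -> R) * R,
    let: (w, v, a, b, z', th) := t in
    [/\ epi (fun x => zst (h x)) w,
      `|w.1 - xk k| <= gam k /\ `|w.2 - zst (h (xk k))| <= gam k,
      `|th - 1| <= gam k /\
        fnormal (epi (fun x => zst (h x))) w (fun q => a q.1 - th * q.2),
      `|v - xk k| <= gam k /\ scalar_fsubgrad h v z' b &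
      [/\ linear_form b, linear_form z',
          forall z, `|z' z - (zk k z - zst z)| <= gam k * `|z| &
          forall u, `|a u + b u - xik k u| <= gam k * `|u|]].
  move=> k.
  have [w [v [a [b [z' [h1 h2 [th h3 h4] h5 h6]]]]]] := split_scalar_subgrad
    Lh_ge0 C_ge0 h_lip X_complete Z_complete X_dual Z_dual zl zC (zkl k) (zkC k)
    (xikl k) (xikC k) (xkr k) (ksub k) (gam0 k) (gam1 k).
  by exists (w, v, a, b, z', th).
move=> /choice[t tP].
pose w k := (t k).1.1.1.1.1; pose v k := (t k).1.1.1.1.2.
pose a k := (t k).1.1.1.2; pose b k := (t k).1.1.2.
pose z' k := (t k).1.2; pose th k := (t k).2.
have {}tP k : [/\ epi (fun x => zst (h x)) (w k),
      `|(w k).1 - xk k| <= gam k /\ `|(w k).2 - zst (h (xk k))| <= gam k,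
      `|th k - 1| <= gam k /\
        fnormal (epi (fun x => zst (h x))) (w k) (fun q => a k q.1 - th k * q.2),
      `|v k - xk k| <= gam k /\ scalar_fsubgrad h (v k) (z' k) (b k) &
      [/\ linear_form (b k), linear_form (z' k),
          forall z, `|z' k z - (zk k z - zst z)| <= gam k * `|z| &
          forall u, `|a k u + b k u - xik k u| <= gam k * `|u|]].
  by have := tP k; rewrite /w /v /a /b /z' /th; case: (t k) => [[[[[]]]]].
have near_cvg (V : normedModType R) (f g : nat -> V) (l : V) (c : R) :
    g @ \oo --> l -> (forall k, `|f k - g k| <= c * gam k) -> f @ \oo --> l.
  move=> gl fg.
  have h1 : (fun k => f k - g k) @ \oo --> (0 : V).
    by apply: (cvg_of_bound gamc (C := c)) => k; rewrite subr0.
  have -> : f = (fun k => (f k - g k) + g k) by apply/funext => k; rewrite subrK.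
  by rewrite -[l]add0r; exact: cvgD.
have vc : v @ \oo --> xbar.
  by apply: (near_cvg _ _ xk _ 1) => // k; have [_ _ _ [h1 _] _] := tP k; rewrite mul1r.
have z'c z : (fun k => z' k z) @ \oo --> (0 : R).
  apply: (near_cvg R^o _ (fun k => zk k z - zst z) _ `|z|).
    by rewrite -(subrr (zst z)); apply: cvgB; [exact: zkc|exact: cvg_cst].
  by move=> k; have [_ _ _ _ [_ _ h1 _]] := tP k; rewrite mulrC.
have z'C k z : `|z' k z| <= (1 + C + C) * `|z|.
  have [_ _ _ _ [_ _ h1 _]] := tP k.
  have -> : z' k z = (z' k z - (zk k z - zst z)) + (zk k z - zst z) by ring.
  apply: (le_trans (ler_normD _ _)); rewrite mulrDl mulrDl -addrA; apply: lerD.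
    apply: (le_trans (h1 z)); apply: ler_wpM2r => //; exact: ltW.
  by apply: (le_trans (ler_normB _ _)); apply: lerD.
have bc u : (fun k => b k u) @ \oo --> (0 : R).
  apply: (strictly_lipschitz_subgrad0 hs vc _ z'C z'c) => k;
    have [_ _ _ [_ h1] [h2 h3 _ _]] := tP k => //.
have ac u : (fun k => a k u) @ \oo --> xi u.
  apply: (near_cvg R^o _ (fun k => xik k u - b k u) _ `|u|).
    by rewrite -[X in _ --> X]subr0; apply: cvgB.
  move=> k; have [_ _ _ _ [_ _ _ h1]] := tP k; rewrite mulrC.
  by have -> : a k u - (xik k u - b k u) = a k u + b k u - xik k u by ring.
have thc : th @ \oo --> (1 : R).
  apply: (near_cvg R^o _ (fun=> 1) _ 1); first exact: cvg_cst.
  by move=> k; have [_ _ [h1 _] _ _] := tP k; rewrite mul1r.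
have th0 k : 0 < th k.
  have [_ _ [+ _] _ _] := tP k; have := gam1 k.
  by rewrite ler_norml => g1 /andP[]; lra.
split.
  apply: (clin_of_le (C := C + 1)).
    by move=> c p q; rewrite /= xil /GRing.scale /=; ring.
  move=> q; rewrite mulrDl mul1r; apply: lerD.
    apply: (le_trans (ler_norm _)); apply: (le_trans (xiC _)).
    by apply: ler_wpM2l => //; exact: norm_fst.
  by apply: (le_trans (ler_norm _)); rewrite normrN; exact: norm_snd.
(* Division by [th k] makes the last component of the normals exactly -1. *)
exists w, (fun k q => (th k)^-1 * (a k q.1 - th k * q.2)); split; last split; last split.
- by move=> k; have [] := tP k.
- apply/cvg_seqP => eps e0.
  have w1c : (fun k => (w k).1) @ \oo --> xbar.
    by apply: (near_cvg _ _ xk _ 1) => // k; have [_ [h1 _] _ _ _] := tP k; rewrite mul1r.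
  have hxc : (fun k => zst (h (xk k))) @ \oo --> zst (h xbar).
    have dc : (fun k => `|xk k - xbar|) @ \oo --> (0 : R).
      rewrite -(@normr0 _ X) -(subrr xbar); apply: cvg_norm; apply: cvgB => //.
      exact: cvg_cst.
    apply: (cvg_of_bound (V := R^o) (C := C * Lh) dc) => k.
    rewrite -(linear_formB _ _ zl); apply: (le_trans (zC _)); rewrite -mulrA.
    apply: ler_wpM2l => //; apply: h_lip; first exact: ltW.
    by rewrite subrr normr0 ltW.
  have w2c : (fun k => (w k).2 : R^o) @ \oo --> (zst (h xbar) : R^o).
    by apply: (near_cvg R^o _ (fun k => zst (h (xk k))) _ 1) => // k;
      have [_ [_ h1] _ _ _] := tP k; rewrite mul1r.
  have [N1 N1P] := (cvg_seqP _ _).1 w1c _ e0; have [N2 N2P] := (cvg_seqP _ _).1 w2c _ e0.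
  exists (maxn N1 N2) => n; rewrite geq_max => /andP[n1 n2].
  by apply: norm_pair_le; [exact: N1P|exact: N2P].
- move=> k; have [_ _ [_ h1] _ _] := tP k.
  have ti : 0 < (th k)^-1 by rewrite invr_gt0.
  exact: (fnormal_scale ti h1).
- move=> q.
  have -> : (fun k => (th k)^-1 * (a k q.1 - th k * q.2)) =
      (fun k => (th k)^-1 * a k q.1 - q.2).
    by apply/funext => k; rewrite mulrBr mulrA mulVf ?gt_eqF// mul1r.
  apply: cvgB; last exact: cvg_cst.
  have c1 : (fun k => (th k)^-1 * a k q.1) @ \oo --> 1^-1 * xi q.1.
    by apply: cvgM => //; apply: cvgV => //; exact: oner_neq0.
  by move: c1; rewrite invr1 mul1r.
Qed.

End LimitingSubgradient.

(** * Approximate multipliers for the penalized problem *)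

Section FuzzyMultipliers.
Context {R : realType} {X Y Z : normedModType R}.

(** Doubling the variable of [X] separates [h] from [F]: one copy moves on the graph of [h], the
    other on that of [F]. The factor [D = c0 * L], a Lipschitz constant of [phi] after [h], pays for
    the distance of the copies. *)
Lemma fuzzy_multipliers (h : X -> Z) (F : X -> set Y) (xbar : X) (phi : Z -> R)
    (rho L c0 c gam : R) :
  0 < rho -> 0 <= L -> 0 <= c0 -> 0 <= c ->
  (forall a b, `|a - xbar| <= rho -> `|b - xbar| <= rho ->
    `|h a - h b| <= L * `|a - b|) ->
  sublinear phi -> (forall z, phi z <= c0 * `|z|) ->
  closed (graph F) -> F xbar 0 ->
  (forall x y, `|x - xbar| <= rho -> `|y| <= rho -> F x y ->
    0 <= phi (h x - h xbar) + c * `|y|) ->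
  seq_complete X -> seq_complete Y -> seq_complete Z ->
  dual_separable X -> dual_separable Y -> dual_separable Z ->
  0 < gam -> exists (x1 : X) (w : X * Y)
    (xi al : X -> R) (zeta : Z -> R) (be : Y -> R),
  [/\ `|x1 - xbar| < gam /\ `|x1 - xbar| < rho,
      graph F w /\ `|w - (xbar, 0)| < gam,
      scalar_fsubgrad h x1 zeta xi,
      fnormal (graph F) w (fun q => al q.1 + be q.2) &
      [/\ [/\ linear_form xi, linear_form zeta & linear_form be],
          forall z, zeta z <= phi z + gam * `|z|,
          forall u, `|xi u + al u| <= gam * `|u|,
          forall y, `|be y| <= (c + gam) * `|y| &
          forall u, `|xi u| <= (c0 * L + gam) * `|u|]].
Proof.
move=> rho_gt0 L_ge0 c0_ge0 c_ge0 h_lip phi_sub phi_le F_closed F_xbar penalized.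
move=> X_complete Y_complete Z_complete X_dual Y_dual Z_dual g0.
pose E := ((X * Z) * (X * Y))%type.
pose Th : set E := [set e | [/\ `|e.1.1 - xbar| <= rho, e.1.2 = h e.1.1,
  `|e.2.1 - xbar| <= rho, `|e.2.2| <= rho & F e.2.1 e.2.2]].
pose D := c0 * L.
have D0 : 0 <= D by rewrite mulr_ge0.
pose s (e : E) : R := phi (- e.1.2) + D * `|e.1.1 - e.2.1| + c * `|e.2.2|.
have ss : sublinear s.
  apply: sublinearD; last first.
    apply: sublinearZ => //.
    by apply: (sublinear_comp (l := fun e : E => e.2.2)) => //; exact: norm_sublinear.
  apply: sublinearD; last first.
    apply: sublinearZ => //; apply: (sublinear_comp (l := fun e : E => e.1.1 - e.2.1)).
    - exact: norm_sublinear.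
    - by move=> e e'; rewrite /= opprD addrACA.
    - by move=> t e; rewrite /= scalerBr.
  apply: (sublinear_comp (l := fun e : E => - e.1.2)) => //.
  - by move=> e e'; rewrite /= opprD.
  - by move=> t e; rewrite /= scalerN.
have n11 (e : E) : `|e.1.1| <= `|e| := le_trans (norm_fst _) (norm_fst _).
have n12 (e : E) : `|e.1.2| <= `|e| := le_trans (norm_snd _) (norm_fst _).
have n21 (e : E) : `|e.2.1| <= `|e| := le_trans (norm_fst _) (norm_snd _).
have n22 (e : E) : `|e.2.2| <= `|e| := le_trans (norm_snd _) (norm_snd _).
have sC e : s e <= (c0 + D + D + c) * `|e|.
  have h1 : phi (- e.1.2) <= c0 * `|e|.
    by apply: (le_trans (phi_le _)); rewrite normrN; apply: ler_wpM2l.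
  have h2 : D * `|e.1.1 - e.2.1| <= D * (`|e| + `|e|).
    apply: ler_wpM2l => //; apply: (le_trans (ler_normB _ _)); exact: lerD.
  have h3 : c * `|e.2.2| <= c * `|e| by apply: ler_wpM2l.
  by rewrite /s; clear -h1 h2 h3; lra.
pose e0 : E := ((xbar, h xbar), (xbar, 0)).
have Th0 : Th e0 by split=> //=; rewrite ?subrr normr0 ltW.
have Thmin e : Th e -> 0 <= s (e0 - e).
  move=> [e1 e2 e3 e4 e5].
  have h1 := penalized _ _ e3 e4 e5.
  have h2 := phi_sub.1 (h e.1.1 - h xbar) (h e.2.1 - h e.1.1).
  rewrite addrC subrKA in h2.
  have h3 : phi (h e.2.1 - h e.1.1) <= D * `|e.1.1 - e.2.1|.
    apply: (le_trans (phi_le _)); rewrite /D -mulrA; apply: ler_wpM2l => //.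
    by rewrite [`|e.1.1 - _|]distrC; exact: h_lip.
  have dE : xbar - e.1.1 - (xbar - e.2.1) = - (e.1.1 - e.2.1).
    by rewrite opprB addrC subrKA opprB.
  rewrite /s /= e2 dE normrN opprB sub0r normrN.
  by clear -h1 h2 h3; lra.
have Thc : closed Th.
  move=> e /closure_normP cle.
  have h1 : `|e.1.1 - xbar| <= rho.
    apply: le_eps => eps ep; have [e' [c1 _ _ _ _] ee] := cle _ ep.
    have -> : e.1.1 - xbar = (e - e').1.1 + (e'.1.1 - xbar) by rewrite /= subrKA.
    apply: (le_trans (ler_normD _ _)); have := n11 (e - e'); move: ee c1; clear; lra.
  have h3 : `|e.2.1 - xbar| <= rho.
    apply: le_eps => eps ep; have [e' [_ _ c3 _ _] ee] := cle _ ep.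
    have -> : e.2.1 - xbar = (e - e').2.1 + (e'.2.1 - xbar) by rewrite /= subrKA.
    apply: (le_trans (ler_normD _ _)); have := n21 (e - e'); move: ee c3; clear; lra.
  have h4 : `|e.2.2| <= rho.
    apply: le_eps => eps ep; have [e' [_ _ _ c4 _] ee] := cle _ ep.
    have -> : e.2.2 = (e - e').2.2 + e'.2.2 by rewrite /= subrK.
    apply: (le_trans (ler_normD _ _)); have := n22 (e - e'); move: ee c4; clear; lra.
  split=> //.
    apply/eqP; rewrite -subr_eq0 -normr_le0.
    apply: (@le_epsM _ _ _ (1 + L)); first by rewrite addr_ge0.
    move=> eps ep; have [e' [c1 c2 _ _ _] ee] := cle _ ep.
    have hl := h_lip _ _ c1 h1; rewrite add0r.
    have -> : e.1.2 - h e.1.1 = (e - e').1.2 + (h e'.1.1 - h e.1.1).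
      by rewrite /= c2 subrKA.
    apply: (le_trans (ler_normD _ _)); rewrite mulrDl mul1r; apply: lerD.
      by apply: (le_trans (n12 _)); exact: ltW.
    apply: (le_trans hl); apply: ler_wpM2l => //; rewrite distrC.
    by apply: (le_trans (n11 (e - e'))); exact: ltW.
  apply: F_closed; apply/closure_normP => eps ep.
  have [e' [_ _ _ _ c5] ee] := cle _ ep; exists e'.2 => //.
  exact: le_lt_trans (norm_snd (e - e')) ee.
pose g' := Num.min gam (rho / 2).
have g'0 : 0 < g' by rewrite lt_min g0 divr_gt0.
have g'g : g' <= gam by rewrite /g' ge_min lexx.
have g'r : g' <= rho / 2 by rewrite /g' ge_min lexx orbT.
have g'rr : g' < rho by move: g'r rho_gt0; clear; lra.
have Ec : seq_complete E by apply: prod_seq_complete; apply: prod_seq_complete.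
have Ed : dual_separable E by apply: prod_dual_separable; apply: prod_dual_separable.
have [e [nu [The ee0 [[nul nuc] nuN] nus]]] :=
  normal_at_minimizer Ec Ed Thc ss sC Th0 Thmin g'0.
have [t1 t2 t3 t4 t5] := The.
(* The sign of [zeta] matches the term [phi (- e.1.2)] of [s], which gives [zeta <= phi] up to
   [gam]. *)
pose xi u := nu ((u, 0), (0, 0)); pose zeta z := - nu ((0, z), (0, 0)).
pose al v := nu ((0, 0), (v, 0)); pose be y := nu ((0, 0), (0, y)).
have nu1l := linear_form_fst nul; have nu2l := linear_form_snd nul.
have xil : linear_form xi by exact: (linear_form_fst nu1l).
have zetal : linear_form zeta by apply: linear_form_opp; exact: (linear_form_snd nu1l).
have all : linear_form al by exact: (linear_form_fst nu2l).
have bel : linear_form be by exact: (linear_form_snd nu2l).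
have nuE (q : E) : nu q = xi q.1.1 - zeta q.1.2 + (al q.2.1 + be q.2.2).
  rewrite (linear_form_pair q nul) (linear_form_pair q.1 nu1l) (linear_form_pair q.2 nu2l).
  by rewrite /xi /zeta /al /be opprK.
have le11 := le_lt_trans (n11 _) ee0; have le21 := le_lt_trans (n21 _) ee0.
have le22 := le_lt_trans (n22 _) ee0.
rewrite /= in le11 le21 le22; rewrite subr0 in le22.
have xi0 : xi 0 = 0 := linear_form0 xil. have zeta0 : zeta 0 = 0 := linear_form0 zetal.
have al0 : al 0 = 0 := linear_form0 all. have be0 : be 0 = 0 := linear_form0 bel.
have phi0 : phi 0 = 0 := sublinear0 phi_sub.
have two_sided (V : normedModType R) (f : V -> R) (C : R) : linear_form f ->
    (forall x, f x <= C * `|x|) -> forall x, `|f x| <= C * `|x|.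
  move=> fl fC x; rewrite ler_norml fC andbT lerNl -(linear_formN _ fl) -normrN.
  exact: fC.
exists e.1.1, e.2, xi, al, zeta, be; split.
- by split; [exact: lt_le_trans le11 g'g|exact: lt_trans le11 g'rr].
- split=> //; apply: (le_lt_trans _ (lt_le_trans ee0 g'g)).
  exact: (norm_snd (e - e0)).
- move=> eps ep.
  have L1 : 0 < 1 + L by rewrite ltr_wpDr.
  have [dl dl0 dlP] := nuN _ (divr_gt0 ep L1).
  exists (Num.min (dl / (1 + L)) (rho / 2)); first by rewrite lt_min !divr_gt0.
  move=> x'; rewrite lt_min => /andP[u1 u2].
  have x'r : `|x' - xbar| <= rho.
    have -> : x' - xbar = (x' - e.1.1) + (e.1.1 - xbar) by rewrite subrKA.
    by apply: (le_trans (ler_normD _ _)); move: u2 le11 g'r; clear; lra.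
  have The' : Th ((x', h x'), e.2) by split.
  have hl := h_lip _ _ x'r t1.
  have ne : `|(((x', h x'), e.2) : E) - e| <= (1 + L) * `|x' - e.1.1|.
    apply: norm_pair_le; rewrite /=; last first.
      by rewrite subrr normr0 mulr_ge0// ltW.
    rewrite mulrDl mul1r; apply: norm_pair_le => /=.
      by rewrite lerDl mulr_ge0.
    rewrite t2; apply: (le_trans hl); by rewrite lerDr.
  have := dlP _ The'; rewrite nuE /= !subrr al0 be0 !addr0 t2 => hh.
  apply: (le_trans (hh _)).
    by apply: (le_lt_trans ne); rewrite mulrC -ltr_pdivlMr.
  apply: (le_trans (ler_wpM2l (ltW (divr_gt0 ep L1)) ne)).
  by rewrite mulrA divfK ?gt_eqF.
- split.
    apply: (clin_of_le (C := (c0 + D + D + c) + g')).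
      by move=> t q q'; rewrite /= all bel; ring.
    move=> q; have := nus (0, q); have := sC (0, q); rewrite nuE /= xi0 zeta0 subrr add0r.
    have -> : `|(0, q) : E| = `|q| by rewrite prod_normE /= normr0 max_r.
    by clear; lra.
  move=> eps ep; have [dl dl0 dlP] := nuN _ ep.
  exists (Num.min dl (rho / 2)); first by rewrite lt_min dl0 divr_gt0.
  move=> u Fu; rewrite lt_min => /andP[u1 u2].
  have The' : Th (e.1, u).
    split=> //=.
      have -> : u.1 - xbar = (u - e.2).1 + (e.2.1 - xbar) by rewrite /= subrKA.
      apply: (le_trans (ler_normD _ _)); have := norm_fst (u - e.2).
      by move: u2 le21 g'r; clear; lra.
    have -> : u.2 = (u - e.2).2 + e.2.2 by rewrite /= subrK.
    apply: (le_trans (ler_normD _ _)); have := norm_snd (u - e.2).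
    by move: u2 le22 g'r; clear; lra.
  have ne : `|((e.1, u) : E) - e| = `|u - e.2|.
    by rewrite prod_normE /= subrr normr0 max_r.
  have := dlP _ The'; rewrite ne => /(_ u1).
  by rewrite nuE /= !subrr xi0 zeta0 subrr add0r.
- split=> //.
  + move=> z; have := nus ((0, - z), (0, 0)).
    rewrite nuE /s /= (linear_formN _ zetal) xi0 al0 be0 !subrr !normr0 [- - z]opprK.
    have nz : `|((0, - z), (0, 0)) : E| <= `|z|.
      by apply: norm_pair_le; apply: norm_pair_le; rewrite /= ?normr0 ?normrN.
    have := ler_wpM2l (ltW g'0) nz; have : g' * `|z| <= gam * `|z| by apply: ler_wpM2r.
    by rewrite !mulr0; clear; lra.
  + apply: two_sided => [a u v|u]; first by rewrite xil all; ring.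
    have nu' : `|((u, 0), (u, 0)) : E| <= `|u|.
      by apply: norm_pair_le; apply: norm_pair_le; rewrite /= ?normr0.
    have := ler_wpM2l (ltW g'0) nu'; have : g' * `|u| <= gam * `|u| by apply: ler_wpM2r.
    have := nus ((u, 0), (u, 0)).
    rewrite nuE /s /= zeta0 be0 !oppr0 phi0 !subrr !normr0 !mulr0.
    by clear; lra.
  + apply: two_sided => // y.
    have ny : `|((0, 0), (0, y)) : E| <= `|y|.
      by apply: norm_pair_le; apply: norm_pair_le; rewrite /= ?normr0.
    have := ler_wpM2l (ltW g'0) ny; have : g' * `|y| <= gam * `|y| by apply: ler_wpM2r.
    have := nus ((0, 0), (0, y)).
    rewrite nuE /s /= zeta0 xi0 al0 !subrr !oppr0 phi0 !normr0 !mulr0.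
    by clear; lra.
  + apply: two_sided => // u.
    have nu' : `|((u, 0), (0, 0)) : E| <= `|u|.
      by apply: norm_pair_le; apply: norm_pair_le; rewrite /= ?normr0.
    have := ler_wpM2l (ltW g'0) nu'; have : g' * `|u| <= gam * `|u| by apply: ler_wpM2r.
    have := nus ((u, 0), (0, 0)).
    rewrite nuE /s /= zeta0 be0 al0 !subr0 !oppr0 phi0 !normr0 !mulr0 -/D.
    by clear; lra.
Qed.

End FuzzyMultipliers.

(* Clarke's exact penalization, combined with the estimate on the distance to
   the solution set. *)
Lemma exact_penalty (R : realType) (X Y Z : normedModType R) (h : X -> Z)
    (F : X -> set Y) (xbar : X) (phi : Z -> R) (L r c0 m : R) :
  0 <= L -> 0 < r -> 0 <= c0 -> 0 < m -> sublinear phi ->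
  (forall z, phi z <= c0 * `|z|) ->
  (forall a b, `|a - xbar| < m -> `|b - xbar| < m -> `|h a - h b| <= L * `|a - b|) ->
  (forall x, `|x - xbar| < m -> F x 0 -> 0 <= phi (h x - h xbar)) ->
  (forall x, `|x - xbar| < m ->
    (dist x [set x | F x 0%R] <= r%:E * dist (0%R : Y) (F x))%E) ->
  forall x y, `|x - xbar| <= m / (4 * (1 + r)) -> `|y| <= m / (4 * (1 + r)) -> F x y ->
    0 <= phi (h x - h xbar) + c0 * L * r * `|y|.
Proof.
move=> L0 r0 c00 m0 sphi phile hlip hmin hreg x y xr yr Fxy.
have r1 : 0 < 1 + r by lra.
(* With [rho + r * rho = m / 4], a near-projection of [x] onto the solution set stays within [m] of
   [xbar]. *)
have m4 : m / (4 * (1 + r)) * (1 + r) = m / 4 by field; apply: lt0r_neq0; lra.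
have rho0 : 0 < m / (4 * (1 + r)) by rewrite divr_gt0// mulr_gt0.
move: (m / (4 * (1 + r))) m4 rho0 xr yr => rho m4 rho0 xr yr.
have rhor : 0 < rho * r by rewrite mulr_gt0.
have yrr : r * `|y| <= rho * r by rewrite mulrC; apply: ler_wpM2r => //; exact: ltW.
have xm : `|x - xbar| < m by lra.
have cL : 0 <= c0 * L by rewrite mulr_ge0.
(* The distance to the solution set need not be attained, hence a tolerance. *)
apply: (@le_epsM _ _ _ (c0 * L)) => // tau0 tau00.
pose tau := Num.min tau0 (m / 4).
have tau1 : 0 < tau by rewrite lt_min tau00 divr_gt0.
have tau2 : tau <= tau0 by rewrite /tau ge_min lexx.
have tau3 : tau <= m / 4 by rewrite /tau ge_min lexx orbT.
have d1 : (dist (0%R : Y) (F x) <= `|y|%:E)%E.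
  apply: ereal_inf_lbound; exists y => //; by rewrite sub0r normrN.
have d2 : (dist x [set x | F x 0%R] < (r * `|y| + tau)%:E)%E.
  apply: (le_lt_trans (hreg _ xm)); apply: (@le_lt_trans _ _ (r%:E * `|y|%:E)%E).
    by apply: lee_wpmul2l => //; rewrite lee_fin ltW.
  by rewrite -EFinM lte_fin ltrDl.
have [_ [x' Fx' <-]] := ereal_inf_lt d2; rewrite lte_fin => xx'.
have x'm : `|x' - xbar| < m.
  have -> : x' - xbar = (x' - x) + (x - xbar) by rewrite subrKA.
  apply: (le_lt_trans (ler_normD _ _)); rewrite distrC; lra.
have h1 := hmin _ x'm Fx'.
have h2 := sphi.1 (h x - h xbar) (h x' - h x); rewrite addrC subrKA in h2.
have h3 := phile (h x' - h x).
have h4 : c0 * `|h x' - h x| <= c0 * L * (r * `|y| + tau0).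
  rewrite -mulrA; apply: ler_wpM2l => //; apply: (le_trans (hlip _ _ x'm xm)).
  by apply: ler_wpM2l => //; rewrite distrC; lra.
lra.
Qed.

(** * From approximate to exact multipliers *)

Theorem theorem4p2 (R : realType) (X Y Z P : completeNormedModType R)
  (K : set Z) (g : X -> P -> Z) (H : X -> P -> set Y) (M : set P)
  (xbar : X) (L : R) :
  asplund X -> asplund Y -> asplund Z -> asplund P ->
  closed K -> cvx_set K -> is_cone K -> pointed K -> interior K !=set0 ->
  M !=set0 -> 0 < L ->
  (* (1) g is L-strictly Lipschitz at xbar w.r.t. M *)
  (forall p, M p -> strictly_lipschitz (fun x => g x p) xbar /\
                    lipschitz_near (fun x => g x p) xbar L) ->
  (* (2) xbar is a weak solution w.r.t. M *)
  (forall p, M p -> solset H p xbar) ->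
  (forall p, M p -> exists2 eps : R, 0 < eps &
     forall x, ball xbar eps x -> solset H p x ->
       ~ (interior K) (- (g x p - g xbar p))) ->
  (* (3) metric subregularity-type estimate *)
  (exists r : R, 0 < r /\ exists V : set X, nbhs xbar V /\
     forall p x, M p -> V x ->
       (dist x (solset H p) <= r%:E * dist (0%R : Y) (H x p))%E) ->
  (* (4) closed graph and Lipschitz-like *)
  (forall p, M p -> closed (graph (fun x => H x p)) /\ lipschitz_like H (xbar, p) 0) ->
  forall (e : Z) (p : P), interior K e -> M p ->
    exists (zs : Z -> R) (ys : Y -> R),
      dual_cone K zs /\ zs e = 1 /\ clin ys /\
      exists (xs1 xs2 : X -> R),
        lsubdiff (fun x => zs (g x p)) xbar xs1 /\
        coderivN (fun x => H x p) xbar 0 ys xs2 /\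
        (forall x, xs1 x + xs2 x = 0).
Proof.
move=> aX aY aZ _ _ Kc Kk Kp _ _ L0 hyp1 hyp2 hyp2' [r [r0 [V [Vn hyp3]]]] hyp4 e p Ke Mp.
pose h x := g x p; pose F x := H x p.
have [hs [N [Nn NL]]] := hyp1 p Mp.
have Fx : F xbar 0 := hyp2 p Mp.
have [eps eps0 epsP] := hyp2' p Mp.
have [Fc _] := hyp4 p Mp.
(* The point [xbar] is feasible, and weak minimality tested at [xbar] itself excludes 0. *)
have nK0 : ~ interior K 0.
  have := epsP xbar (ballxx _ eps0) Fx; by rewrite subrr oppr0.
have [phi [c0 [sphi c00 phile phineg [phiK phie phiNe]]]] :=
  scalarization Kc Kk Kp Ke nK0.
have [r1 /= r10 r1P] := (nbhs_normP _ _).1 Nn.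
have [r2 /= r20 r2P] := (nbhs_normP _ _).1 Vn.
pose m := Num.min eps (Num.min r1 r2).
have m0 : 0 < m by rewrite !lt_min eps0 r10.
have mlt (x : X) : `|x - xbar| < m -> [/\ ball xbar eps x, N x & V x].
  rewrite !lt_min => /and3P[h1 h2 h3]; split.
  - by rewrite -ball_normE /= distrC.
  - by apply: r1P; rewrite /= distrC.
  - by apply: r2P; rewrite /= distrC.
have hlip a b : `|a - xbar| < m -> `|b - xbar| < m -> `|h a - h b| <= L * `|a - b|.
  by move=> /mlt[_ Na _] /mlt[_ Nb _]; exact: NL.
have hmin x : `|x - xbar| < m -> F x 0 -> 0 <= phi (h x - h xbar).
  move=> /mlt[bx _ _] Fx0; rewrite leNgt; apply/negP => /phineg; exact: epsP.
have hreg x : `|x - xbar| < m ->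
    (dist x [set x | F x 0%R] <= r%:E * dist (0%R : Y) (F x))%E.
  by move=> /mlt[_ _ Vx]; exact: hyp3.
pose c := c0 * L * r.
have pen := exact_penalty (ltW L0) r0 (ltW c00) m0 sphi phile hlip hmin hreg.
pose rho := m / (4 * (1 + r)).
have rr0 : 0 < 4 * (1 + r) by rewrite mulr_gt0//; lra.
have rho0 : 0 < rho by rewrite divr_gt0.
have rhom : rho < m by rewrite ltr_pdivrMr// ltr_pMr//; lra.
have hlip' a b : `|a - xbar| <= rho -> `|b - xbar| <= rho -> `|h a - h b| <= L * `|a - b|.
  by move=> ha hb; apply: hlip; apply: le_lt_trans rhom.
have c_ge0 : 0 <= c by rewrite !mulr_ge0// ltW.
have cX := @complete_seq_complete R X; have cY := @complete_seq_complete R Y.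
have cZ := @complete_seq_complete R Z.
pose gam (k : nat) : R := (k.+1%:R)^-1.
have gam0 k : 0 < gam k by rewrite invr_gt0.
have gam1 k : gam k <= 1 by rewrite invf_le1// ler1n.
have : forall k, exists t : X * (X * Y) * (X -> R) * (X -> R) * (Z -> R) * (Y -> R),
    let: (x1, w, xi, al, zeta, be) := t in
  [/\ `|x1 - xbar| < gam k /\ `|x1 - xbar| < rho,
      graph F w /\ `|w - (xbar, 0)| < gam k,
      scalar_fsubgrad h x1 zeta xi,
      fnormal (graph F) w (fun q => al q.1 + be q.2) &
      [/\ [/\ linear_form xi, linear_form zeta & linear_form be],
          forall z, zeta z <= phi z + gam k * `|z|,
          forall u, `|xi u + al u| <= gam k * `|u|,
          forall y, `|be y| <= (c + gam k) * `|y| &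
          forall u, `|xi u| <= (c0 * L + gam k) * `|u|]].
  move=> k; have [x1 [w [xi [al [zeta [be hh]]]]]] := fuzzy_multipliers rho0 (ltW L0)
    (ltW c00) c_ge0 hlip' sphi phile Fc Fx pen cX cY cZ aX aY aZ (gam0 k).
  by exists (x1, w, xi, al, zeta, be).
move=> /choice[t tP].
pose x1 k := (t k).1.1.1.1.1; pose w k := (t k).1.1.1.1.2.
pose xi k := (t k).1.1.1.2; pose al k := (t k).1.1.2.
pose zeta k := (t k).1.2; pose be k := (t k).2.
have {}tP k : [/\ `|x1 k - xbar| < gam k /\ `|x1 k - xbar| < rho,
      graph F (w k) /\ `|w k - (xbar, 0)| < gam k,
      scalar_fsubgrad h (x1 k) (zeta k) (xi k),
      fnormal (graph F) (w k) (fun q => al k q.1 + be k q.2) &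
      [/\ [/\ linear_form (xi k), linear_form (zeta k) & linear_form (be k)],
          forall z, zeta k z <= phi z + gam k * `|z|,
          forall u, `|xi k u + al k u| <= gam k * `|u|,
          forall y, `|be k y| <= (c + gam k) * `|y| &
          forall u, `|xi k u| <= (c0 * L + gam k) * `|u|]].
  by have := tP k; rewrite /x1 /w /xi /al /zeta /be; case: (t k) => [[[[[]]]]].
(* One bound for the multipliers on [X], [Y] and [Z]; the final 1 absorbs [gam k]. *)
pose C := c0 + c0 * L + c + 1.
have cL0 : 0 <= c0 * L by rewrite mulr_ge0// ltW.
have C0 : 0 <= C by rewrite /C; lra.
have xil k : linear_form (xi k) by have [_ _ _ _ [[] ]] := tP k.
have zetal k : linear_form (zeta k) by have [_ _ _ _ [[] ]] := tP k.
have bel k : linear_form (be k) by have [_ _ _ _ [[] ]] := tP k.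
have xiC k u : `|xi k u| <= C * `|u|.
  have [_ _ _ _ [_ _ _ _ h1]] := tP k; apply: (le_trans (h1 u)).
  by apply: ler_wpM2r => //; have := gam1 k; rewrite /C; move: (gam k) => gk; lra.
have beC k u : `|be k u| <= C * `|u|.
  have [_ _ _ _ [_ _ _ h1 _]] := tP k; apply: (le_trans (h1 u)).
  by apply: ler_wpM2r => //; have := gam1 k; rewrite /C; move: (gam k) => gk; lra.
have zetaC k z : `|zeta k z| <= C * `|z|.
  have up z' : zeta k z' <= C * `|z'|.
    have [_ _ _ _ [_ h1 _ _ _]] := tP k; apply: (le_trans (h1 z')).
    apply: (le_trans (lerD (phile z') (lexx _))); rewrite -mulrDl; apply: ler_wpM2r => //.
    by have := gam1 k; rewrite /C; move: (gam k) => gk; lra.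
  by rewrite ler_norml up andbT lerNl -(linear_formN _ (zetal k)) -normrN; exact: up.
have [p1 [p1h [zst [zstl zstC zstc]]]] := weak_star_subsequence aZ zetal zetaC.
have [p2 [p2h [xist [xistl xistC xistc]]]] := weak_star_subsequence aX
  (fun k => xil (p1 k)) (fun k => xiC (p1 k)).
have [p3 [p3h [best [bestl bestC bestc]]]] := weak_star_subsequence aY
  (fun k => bel (p1 (p2 k))) (fun k => beC (p1 (p2 k))).
pose ps k := p1 (p2 (p3 k)).
have psh : {homo ps : m n / (m < n)%N} by move=> i j ij; apply: p1h; apply: p2h; apply: p3h.
have gc : (fun k => gam (ps k)) @ \oo --> (0 : R).
  exact: (cvg_subseq (V := R^o) psh inv_cvg0).
have zc z : (fun k => zeta (ps k) z) @ \oo --> zst z.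
  exact: (cvg_subseq (V := R^o) p3h (cvg_subseq (V := R^o) p2h (zstc z))).
have xc u : (fun k => xi (ps k) u) @ \oo --> xist u.
  exact: (cvg_subseq (V := R^o) p3h (xistc u)).
have x1c : (fun k => x1 (ps k)) @ \oo --> xbar.
  apply: (cvg_of_bound (C := 1) gc) => k; rewrite mul1r.
  by have [[h1 _] _ _ _ _] := tP (ps k); exact: ltW.
have wc : (fun k => w (ps k)) @ \oo --> ((xbar, 0) : X * Y).
  apply: (cvg_of_bound (C := 1) gc) => k; rewrite mul1r.
  by have [_ [_ h1] _ _ _] := tP (ps k); exact: ltW.
(* [xi] and [al] cancel up to [gam], so [al] needs no extraction of its own. *)
have alc u : (fun k => al (ps k) u) @ \oo --> - xist u.
  have -> : (fun k => al (ps k) u) =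
      (fun k => (xi (ps k) u + al (ps k) u) - xi (ps k) u).
    by apply/funext => k; ring.
  rewrite -sub0r; apply: cvgB => //.
  apply: (cvg_of_bound (V := R^o) (C := `|u|) gc) => k; rewrite subr0 mulrC.
  by have [_ _ _ _ [_ _ h1 _ _]] := tP (ps k).
have zphi z : zst z <= phi z.
  have c1 : (fun k => phi z + gam (ps k) * `|z|) @ \oo --> phi z + 0 * `|z|.
    by apply: cvgD; [exact: cvg_cst|apply: cvgM => //; exact: cvg_cst].
  have : zst z <= phi z + 0 * `|z|.
    by apply: (cvg_ler (zc z) c1) => k; have [_ _ _ _ [_ h1 _ _ _]] := tP (ps k).
  by rewrite mul0r addr0.
have zstcl : clin zst.
  by apply: (clin_of_le (C := C)) => // z; exact: le_trans (ler_norm _) (zstC z).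
(* The minus sign comes from the coderivative, which reads normals as [(xs, - ys)]. *)
exists zst, (fun y => - best y); split; [|split; [|split]].
- split=> // z Kz; have := le_trans (zphi (- z)) (phiK z Kz).
  by rewrite (linear_formN _ zstl) oppr_le0.
- have h1 := le_trans (zphi e) phie; have h2 := le_trans (zphi (- e)) phiNe.
  rewrite (linear_formN _ zstl) in h2; apply/eqP; rewrite eq_le h1/=; lra.
- apply: (clin_of_le (C := C)); first exact: linear_form_opp.
  by move=> y; apply: (le_trans (ler_norm _)); rewrite normrN.
exists xist, (fun u => - xist u); split; [|split].
- apply: (limiting_subgradient rho0 (ltW L0) C0 hlip' cX cZ aX aZ hs zstl zstC xistl xistC
    (fun k => zetal (ps k)) (fun k => zetaC (ps k)) (fun k => xil (ps k))
    (fun k => xiC (ps k)) _ x1c zc xc).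
    by move=> k; have [[_ h1] _ _ _ _] := tP (ps k).
  by move=> k; have [_ _ h1 _ _] := tP (ps k).
- split.
    apply: (clin_of_le (C := C + C)).
      by move=> a q q'; rewrite /= xistl bestl; ring.
    move=> q; rewrite opprK mulrDl; apply: lerD.
      apply: (le_trans (ler_norm _)); rewrite normrN; apply: (le_trans (xistC _)).
      by apply: ler_wpM2l => //; exact: norm_fst.
    apply: (le_trans (ler_norm _)); apply: (le_trans (bestC _)).
    by apply: ler_wpM2l => //; exact: norm_snd.
  exists (fun k => w (ps k)), (fun k q => al (ps k) q.1 + be (ps k) q.2).
  split; [|split; [exact: wc|split]].
  + by move=> k; have [_ [h1 _] _ _ _] := tP (ps k).
  + by move=> k; have [_ _ _ h1 _] := tP (ps k).
  + by move=> q; rewrite opprK; apply: cvgD; [exact: alc|exact: bestc].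
- by move=> x; rewrite subrr.
Qed.
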